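(* Let $v$ satisfy Assumption (V) (see context). Assume $2\le m<\infty$, $p\in(0,p^* )$ with $p^*=|v(z_{\max})|/z_{\max}$, and $r_{\rm hc}>0$. Let $d=m-1$ and let $C$ be the positive-definite $d\times d$ matrix defined in the context. Then the Gibbs free energy $g(\beta)=-\lim_{N\to\infty}\frac1{\beta N}\log Q_N(\beta)$ satisfies, as $\beta\to\infty$, $$g(\beta)=e_0-\frac1\beta\log\sqrt{\frac{2\pi}{\beta\,(\det C)^{1/d}}}+o(\beta^{-1}).$$
   Context: $\mathbb N=\{1,2,\ldots\}$, $\mathbb R_+=(0,\infty)$. Assumption (V): $v:(0,\infty)\to\mathbb R\cup\{+\infty\}$ equals $+\infty$ on $(0,r_{\rm hc}]$ for some $r_{\rm hc}\ge 0$ and is $C^2$ on $(r_{\rm hc},\infty)$. There exist $r_{\rm hc}<z_{\min}<z_{\max}<2z_{\min}$ and $\alpha_1,\alpha_2>0$, $s>2$ such that: (i) $z_{\max}$ is the unique minimizer of $v$ and $v(z_{\max})<0$; $v$ is decreasing on $(0,z_{\max})$ and increasing and non-positive on $(z_{\max},\infty)$. (ii) $v(z)\ge-\alpha_1z^{-s}$ for all $z>0$, and $v(z)+v(z_{\max})-2\alpha_1\sum_{n=2}^\infty(nz)^{-s}>0$ for all $z<z_{\min}$. (iii) $v''$ is decreasing on $[z_{\min},z_{\max}]$ and increasing and non-positive on $[2z_{\min},\infty)$. (iv) $v''(z)\ge-\alpha_2z^{-s-2}$ for all $z>r_{\rm hc}$, and $v''(z_{\max})+\sum_{n=2}^\infty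 n^2v''(nz_{\min})>0$. Definitions: $\mathcal E_N(z_1,\ldots,z_{N-1})=\sum_{1\le i<j\le N,\,|i-j|\le m}v(z_i+\cdots+z_{j-1})+p\sum_{j=1}^{N-1}z_j$; $Q_N(\beta)=\int_{\mathbb R_+^{N-1}}e^{-\beta\mathcal E_N}\,dz_1\cdots dz_{N-1}$; the limit defining $g(\beta)$ exists. The number $a$ is the unique minimizer of $r\mapsto pr+\sum_{k=1}^mv(kr)$ on $\mathbb R_+$ and $e_0=pa+\sum_{k=1}^mv(ka)$. The matrix $C$: let $\boldsymbol a=(a,\ldots,a)\in\mathbb R^d$. For $x=(z_1,\ldots,z_d)$, $y=(z_{d+1},\ldots,z_{2d})$ let $W(x,y)=\sum_{1\le i\le d<j\le2d,\ j-i\le d}v(z_i+\cdots+z_j)$, and let $W_{yy}$ be its $d\times d$ Hessian in $y$. Let $S=(S_{ij})_{i,j\in\mathbb N}$ be the Hessian at $(a,a,\ldots)$ of the surface energy, $S_{ij}=\sum_Lv''(a\,\#L)$, the sum being over discrete intervals $L=\{k,k+1,\ldots,l\}\subset\mathbb N$ of cardinality $\#L\le m$ with $\{i,j\}\subset L$; $S$ is positive-definite on $\ell^2(\mathbb N)$. Let $D$ be the positive-definite symmetric $d\times d$ matrix with $\langle x,Dx\rangle=\inf\{\sum_{i,j\in\mathbb N}S_{ij}z_iz_j\mid z\in\ell^2(\mathbb N),\ (z_1,\ldots,z_d)=x\}$ for all $x\in\mathbb R^d$. Then $C:=D+W_{yy}(\boldsymbol a,\boldsymbol a)$. *)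

(* Defs.v *)
From HB Require Import structures.
From mathcomp Require Export all_boot all_order all_algebra.
From mathcomp Require Export all_classical all_reals all_analysis.

Set Implicit Arguments.
Unset Strict Implicit.
Unset Printing Implicit Defensive.

Export Order.TTheory GRing.Theory Num.Theory.
Export numFieldNormedType.Exports.

Local Open Scope classical_set_scope.
Local Open Scope ring_scope.

(* Makes the Landau notations available at +oo. *)
Canonical pinfty_nbhs_filter_on (R : numFieldType) :=
  @FilterType R (pinfty_nbhs R) (@filter_filter R _ proper_pinfty_nbhs).

Section ChainModel.
Context {R : realType}.
Implicit Types (v : R -> \bar R) (m N d : nat) (p a r z beta : R).

(* A potential is a function with values in the extended reals; its values on
   ]-oo, 0] are never used.  Derivatives of v are those of its real part; they
   are only ever taken at points where v is finite on a neighbourhood. *)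
Definition vreal v : R -> R := fun z => fine (v z).

Definition d2 v : R -> R := (vreal v)^`(2)%classic.

Definition C2_beyond v (rhc : R) : Prop :=
  forall z, rhc < z ->
    [/\ v z \is a fin_num,
        derivable (vreal v) z 1,
        derivable (vreal v)^`()%classic z 1
      & {for z, continuous (d2 v)}].

(* The two series below have terms of constant sign, so that they are
   meaningful in the extended reals without a summability hypothesis.
   Monotonicity is understood in the weak sense: v cannot be strictly
   decreasing on ]0, zmax[, since it is constantly +oo on ]0, rhc]. *)
Record assumptionV v (rhc zmin zmax alpha1 alpha2 s : R) : Prop := AssumptionV {
  V_hc_ge0 : 0 <= rhc;
  V_hard_core : forall z, 0 < z -> z <= rhc -> v z = +oo%E;
  V_C2 : C2_beyond v rhc;
  V_zmin_gt : rhc < zmin;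
  V_zmin_zmax : zmin < zmax;
  V_zmax_lt : zmax < 2 * zmin;
  V_alpha1 : 0 < alpha1;
  V_alpha2 : 0 < alpha2;
  V_s : 2 < s;
  V_minimizer : forall z, 0 < z -> z != zmax -> (v zmax < v z)%E;
  V_min_lt0 : (v zmax < 0)%E;
  V_decreasing : {in `]0, zmax[ &, {homo v : x y / x <= y >-> (y <= x)%E}};
  V_increasing : {in `]zmax, +oo[ &, {homo v : x y / x <= y >-> (x <= y)%E}};
  V_le0 : forall z, zmax < z -> (v z <= 0)%E;
  V_lower : forall z, 0 < z -> ((- (alpha1 * z `^ (- s)))%:E <= v z)%E;
  V_repulsive : forall z, 0 < z -> z < zmin ->
    (0 < v z + v zmax
         - (2 * alpha1)%:E * \sum_(2 <= n <oo) ((n%:R * z) `^ (- s))%:E)%E;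
  V_d2_decreasing :
    {in `[zmin, zmax] &, {homo d2 v : x y / x <= y >-> y <= x}};
  V_d2_increasing :
    {in `[2 * zmin, +oo[ &, {homo d2 v : x y / x <= y >-> x <= y}};
  V_d2_le0 : forall z, 2 * zmin <= z -> d2 v z <= 0;
  V_d2_lower : forall z, rhc < z -> - (alpha2 * z `^ (- s - 2)) <= d2 v z;
  V_d2_convex :
    (0 < (d2 v zmax)%:E
         + \sum_(2 <= n <oo) (n%:R ^+ 2 * d2 v (n%:R * zmin))%:E)%E
}.

Definition pstar v (zmax : R) : R := `|fine (v zmax)| / zmax.

(* Particles are numbered from 0, so that the spacing between particles k and
   k.+1 is the entry z`_k. *)
Definition energy v m p N (z : N.-1.-tuple R) : \bar R :=
  (\sum_(i < N) \sum_(j < N | (i < j)%N && (j - i <= m)%N)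
      v (\sum_(i <= k < j) z`_k)%R
   + (p * \sum_(k < N.-1) z`_k)%:E)%E.

(* Lebesgue integral over ]0, +oo[^n, as an iterated integral; by Tonelli this
   is the integral against the product measure for nonnegative measurable F. *)
Fixpoint integral_pos (n : nat) : (n.-tuple R -> \bar R) -> \bar R :=
  match n with
  | 0 => fun F => F [tuple]
  | n'.+1 => fun F =>
      (\int[@lebesgue_measure R]_(x in `]0%R, +oo[)
         integral_pos (fun t : n'.-tuple R => F [tuple of x :: t]))%E
  end.

Definition partition_function v m p N beta : \bar R :=
  integral_pos (fun z : N.-1.-tuple R =>
    expeR (- (beta%:E * energy v m p z)))%E.

Definition gibbs_free_energy v m p beta : R :=
  - limn (fun N =>
      (beta * N%:R)^-1 * ln (fine (partition_function v m p N beta))).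

Definition energy_per_spacing v m p r : \bar R :=
  ((p * r)%:E + \sum_(1 <= k < m.+1) v (k%:R * r)%R)%E.

Definition is_unique_minimizer (f : R -> \bar R) a : Prop :=
  0 < a /\ forall r, 0 < r -> r != a -> (f a < f r)%E.

(* xget 0 A is an element of A if there is one; here A has at most one. *)
Definition equilibrium_spacing v m p : R :=
  xget 0 [set a | is_unique_minimizer (energy_per_spacing v m p) a].

Definition ground_energy v m p : R :=
  fine (energy_per_spacing v m p (equilibrium_spacing v m p)).

(* S i j is the sum of v''(a #L) over the discrete intervals
   L = {k, ..., k + c - 1} with 1 <= c <= m containing i and j; the index set
   {1, 2, ...} is shifted to nat. *)
Definition surface_hessian v m a (i j : nat) : R :=
  \sum_(1 <= c < m.+1) \sum_(0 <= k < (minn i j).+1 | (maxn i j < k + c)%N)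
    d2 v (a * c%:R).

Definition ell2 (z : nat -> R) : Prop := cvgn (series (fun i => z i ^+ 2)).

(* The double sum over nat * nat is taken along squares.  For z in ell2 and
   S = surface_hessian v m a it converges absolutely, since S is bounded and
   S i j = 0 when m <= |i - j|. *)
Definition quad_form (S : nat -> nat -> R) (z : nat -> R) : R :=
  limn (fun n => \sum_(i < n) \sum_(j < n) S i j * z i * z j).

Definition posdef d (A : 'M[R]_d) : Prop :=
  A^T = A /\ forall x : 'cV[R]_d, x != 0 -> 0 < (x^T *m A *m x) 0 0.

Definition is_reduced_matrix (S : nat -> nat -> R) d (D : 'M[R]_d) : Prop :=
  posdef D /\
  forall x : 'cV[R]_d,
    (x^T *m D *m x) 0 0 =
    inf [set quad_form S z |
         z in [set z | ell2 z /\ forall i : 'I_d, z i = x i 0]].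

(* At most one symmetric matrix has a given quadratic form. *)
Definition reduced_matrix (S : nat -> nat -> R) d : 'M[R]_d :=
  xget 0 [set D | is_reduced_matrix S D].

(* row_mx x y is (z_1, ..., z_2d) with indices shifted to {0, ..., 2d - 1}. *)
Definition interaction v d (x y : 'rV[R]_d) : \bar R :=
  (\sum_(i < d + d | (i < d)%N)
     \sum_(j < d + d | (d <= j)%N && (j - i <= d)%N)
       v (\sum_(k < d + d | (i <= k <= j)%N) row_mx x y 0 k)%R)%E.

Definition hessian d (f : 'rV[R]_d -> R) (y : 'rV[R]_d) : 'M[R]_d :=
  \matrix_(i, j) 'D_(delta_mx 0 i) (fun y' => 'D_(delta_mx 0 j) f y') y.

Definition stiffness_matrix v m a : 'M[R]_(m.-1) :=
  reduced_matrix (surface_hessian v m a) m.-1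
  + hessian (fun y => fine (interaction v (const_mx a) y)) (const_mx a).

End ChainModel.

(* Main.v *)
(* Write the spacings as a + w_i.  A neighbour closer than zmin can be deleted
   without raising the energy, and v'' <= 0 beyond 2 zmin makes Jensen's
   inequality distribute each long bond over the spacings that it spans.  Hence
   the excess energy is bounded below, and near w = 0 also above, by a sum of
   quadratic forms H in the last m deviations, up to factors close to 1 and
   bad spacings whose weight is exponentially small in beta.

   Integrating out the most recent deviation of a Gaussian chain maps a
   quadratic form A on the remaining d = m - 1 deviations to its Riccati image
   and produces a factor sqrt(2 pi / (beta gain(A))).  The iterates started at
   0 increase to a fixed point, so Q_N grows at the rate
   exp(- beta e_0) sqrt(2 pi / (beta g)) per particle, where g is the limiting
   gain.

   The same fixed point completes squares in the surface energy: summed along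
   z_1, z_2, ..., it becomes g times the sum of the squared innovations
   z_k + drift(z_{k-1}, ..., z_{k-d}), less the bonds that cross the boundary,
   whose Hessian is W_yy.  Later innovations can be made to vanish, so that
   C = g U^T U with U unit lower triangular, and det C = g^d. *)

(* The upper bound on Q_N has to cope with arbitrary sets of bad spacings, and it comes from a
   supersolution of a transfer operator. The natural candidate, the Gaussian built on the Riccati
   fixed point, is an eigenfunction but has no positive lower bound, so neither the return to the
   start after a bad spacing nor the end of the chain could be paid with it. A combination of the
   finite iterates is used instead: the iterate 0 contributes the constant function 1. In the lower
   bound only paths near the ground state count, and there the fixed point itself serves.

   Every loss in the comparison of the energy with H is a factor close to 1 in the quadratic form.
   Per particle it changes Q_N by a factor close to 1, chosen before beta is sent to infinity, hence
   g(beta) by at most eta / beta for any prescribed eta. A bad spacing weighs exp(- kap beta) up to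
   constants, negligible against the Gaussian factor of order beta^(-1/2).

   The limit that defines g exists because Q_N is submultiplicative up to a constant. The matrix D
   is an infimum over infinitely many variables, so a minimizer has to be exhibited and shown to be
   square summable. *)
Require Import Defs.
From mathcomp Require Import ring lra zify.
From mathcomp Require Import measurable_realfun.

Set Implicit Arguments.
Unset Strict Implicit.
Unset Printing Implicit Defensive.

Local Open Scope classical_set_scope.
Local Open Scope ring_scope.

(** * Quadratic forms on histories and the Riccati recursion *)

(* A history lists the past of the chain, the most recent value at index 0. *)
Definition push (T : Type) (y : T) (x : nat -> T) : nat -> T :=
  fun i => if i is i'.+1 then x i' else y.

Lemma cvg_sumr (R : realType) (T : Type) (F : set_system T) (n : nat)
    (u : 'I_n -> T -> R) (l : 'I_n -> R) : Filter F ->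
  (forall i, u i x @[x --> F] --> l i) ->
  \sum_(i < n) u i x @[x --> F] --> \sum_(i < n) l i.
Proof. by move=> FF ul; apply: cvg_big => //; exact: add_continuous. Qed.

Section QuadraticForms.
Variable R : realType.
Implicit Types (A : nat -> nat -> R) (x y : nat -> R).

Definition qf n A x : R := \sum_(i < n) \sum_(j < n) A i j * x i * x j.

Definition basis_vec (k : nat) : nat -> R := fun i => (i == k)%:R.

Lemma sum_basis_vec n (F : nat -> R) k : (k < n)%N ->
  \sum_(i < n) F i * basis_vec k i = F k.
Proof.
move=> kn; rewrite (bigD1 (Ordinal kn)) //= /basis_vec eqxx mulr1 big1 ?addr0//.
by move=> i ik; rewrite [_ == k](negbTE ik) mulr0.
Qed.

Lemma qf_basis_vec n A k l : (k < n)%N -> (l < n)%N ->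
  qf n A (fun i => basis_vec k i + basis_vec l i) =
  A k k + A l l + (A k l + A l k).
Proof.
move=> kn ln; rewrite /qf.
have H F : \sum_(i < n) F (nat_of_ord i) * (basis_vec k i + basis_vec l i) = F k + F l.
  rewrite -(sum_basis_vec F kn) -(sum_basis_vec F ln) -big_split/=.
  by apply: eq_bigr => i _; rewrite mulrDr.
rewrite (eq_bigr (fun i : 'I_n => (A i k + A i l) * (basis_vec k i + basis_vec l i))).
  by rewrite (H (fun i => A i k + A i l)); ring.
move=> i _; rewrite -(H (fun j => A i j)) mulr_suml; apply: eq_bigr => j _; ring.
Qed.

Lemma qf_basis_vec1 n A k : (k < n)%N -> qf n A (basis_vec k) = A k k.
Proof.
move=> kn; rewrite /qf -[RHS](sum_basis_vec (fun i => A i k) kn).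
apply: eq_bigr => i _; rewrite -[A i k](sum_basis_vec (A i) kn) mulr_suml.
by apply: eq_bigr => j _; ring.
Qed.

Lemma qf_le_sq n A x (B : R) : (forall i j, (i < n)%N -> (j < n)%N -> `|A i j| <= B) ->
  qf n A x <= n%:R * B * \sum_(i < n) x i ^+ 2.
Proof.
move=> AB; pose S := \sum_(i < n) x i ^+ 2.
have -> : n%:R * B * S = \sum_(i < n) \sum_(j < n) (B / 2 * x i ^+ 2 + B / 2 * x j ^+ 2).
  rewrite (eq_bigr (fun i : 'I_n => n%:R * (B / 2 * x i ^+ 2) + B / 2 * S)); last first.
    by move=> i _; rewrite big_split/= sumr_const card_ord [in RHS]mulr_natl -mulr_sumr.
  by rewrite big_split/= sumr_const card_ord -!mulr_sumr -/S -mulr_natl; field.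
rewrite /qf; apply: ler_sum => i _; apply: ler_sum => j _.
have := AB i j (ltn_ord i) (ltn_ord j); rewrite ler_norml => /andP[h1 h2].
have h3 := sqr_ge0 (x i - x j); have h4 := sqr_ge0 (x i + x j).
rewrite -subr_ge0.
have -> : B / 2 * x i ^+ 2 + B / 2 * x j ^+ 2 - A i j * x i * x j =
   (B - A i j) / 4 * (x i + x j) ^+ 2 + (B + A i j) / 4 * (x i - x j) ^+ 2 by field.
by apply: addr_ge0; apply: mulr_ge0 => //; lra.
Qed.

Lemma eq_qf n A x y : (forall i, (i < n)%N -> x i = y i) -> qf n A x = qf n A y.
Proof.
by move=> xy; apply: eq_bigr => i _; apply: eq_bigr => j _; rewrite !xy.
Qed.

Lemma qf0 n A : qf n A (fun=> 0) = 0.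
Proof. by rewrite /qf big1// => i _; rewrite big1// => j _; rewrite mulr0. Qed.

End QuadraticForms.

Section Riccati.
Variables (R : realType) (d : nat) (H : nat -> nat -> R) (mu : R).
Hypothesis Hsym : forall i j, H i j = H j i.
Hypothesis mu_gt0 : 0 < mu.
Hypothesis H_ge : forall w, mu * w 0%N ^+ 2 <= qf d.+1 H w.
Implicit Types (A : nat -> nat -> R) (x : nat -> R) (y : R).

(** The cost [H] of a step together with a form [A] on the history that it leaves. That history
    keeps the newest d entries, so [A] is extended by zero to the oldest index d. [ric A] is the
    Schur complement of the entry (0, 0), and [- drift A x] is the newest value that minimizes the
    total. *)
Definition stage_form A i j : R := H i j + (if (i < d)%N && (j < d)%N then A i j else 0).
Definition gain A : R := stage_form A 0 0.
Definition drift A x : R := \sum_(i < d) stage_form A 0 i.+1 / gain A * x i.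
Definition ric A i j : R :=
  stage_form A i.+1 j.+1 - stage_form A 0 i.+1 * stage_form A 0 j.+1 / gain A.
Definition ricn n : nat -> nat -> R := iter n ric (fun _ _ => 0).

Definition symm A := forall i j, A i j = A j i.

Lemma stage_form_sym A : symm A -> symm (stage_form A).
Proof. by move=> sA i j; rewrite /stage_form Hsym sA andbC. Qed.

Lemma ric_sym A : symm A -> symm (ric A).
Proof. by move=> /stage_form_sym sA i j; rewrite /ric (sA i.+1) [_ * stage_form A 0 j.+1]mulrC. Qed.

Lemma ricn_sym n : symm (ricn n).
Proof. by elim: n => [//|n IH]; apply: ric_sym. Qed.

Lemma qf_push n (M : nat -> nat -> R) y x : symm M ->
  qf n.+1 M (push y x) = M 0%N 0%N * y ^+ 2
    + 2 * y * (\sum_(i < n) M 0%N i.+1 * x i) + qf n (fun i j => M i.+1 j.+1) x.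
Proof.
move=> sM; rewrite /qf big_ord_recl big_ord_recl /=.
rewrite [in X in _ + X](eq_bigr (fun i : 'I_n => M 0%N i.+1 * x i * y
   + \sum_(j < n) M i.+1 j.+1 * x i * x j)); last first.
  by move=> i _; rewrite big_ord_recl /= sM.
rewrite big_split /= -mulr_suml.
rewrite (eq_bigr (fun i : 'I_n => y * (M 0%N i.+1 * x i))) => [|i _]; last by rewrite /bump/=; ring.
by rewrite -mulr_sumr; ring.
Qed.

(** Completing the square in the newest value [y]. The identity serves twice: under the Gaussian
    integral and in the surface energy. *)
Lemma ric_square A y x : symm A -> gain A != 0 ->
  qf d.+1 H (push y x) + qf d A (push y x) =
  qf d (ric A) x + gain A * (y + drift A x) ^+ 2.
Proof.
move=> sA g0; set w := push y x.
have -> : qf d A w = qf d.+1 (fun i j => if (i < d)%N && (j < d)%N then A i j else 0) w.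
  rewrite /qf big_ord_recr /= [X in _ + X]big1 ?addr0; last first.
    by move=> i _; rewrite ltnn /= !mul0r.
  apply: eq_bigr => i _; rewrite big_ord_recr /= ltnn andbF !mul0r addr0.
  by apply: eq_bigr => j _; rewrite !ltn_ord.
have -> : qf d.+1 H w + qf d.+1 (fun i j => if (i < d)%N && (j < d)%N then A i j else 0) w =
   qf d.+1 (stage_form A) w.
  rewrite /qf -big_split/=; apply: eq_bigr => i _; rewrite -big_split/=.
  by apply: eq_bigr => j _; rewrite -!mulrDl.
rewrite qf_push; last exact: stage_form_sym.
pose B := \sum_(i < d) stage_form A 0%N i.+1 * x i.
have -> : drift A x = B / gain A.
  by rewrite /drift /B mulr_suml; apply: eq_bigr => i _; rewrite mulrAC.
have -> : qf d (ric A) x = qf d (fun i j => stage_form A i.+1 j.+1) x - B ^+ 2 / gain A.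
  rewrite expr2 {1}/B !mulr_suml -sumrB; apply: eq_bigr => i _.
  rewrite mulrAC mulr_sumr -sumrB; apply: eq_bigr => j _.
  by rewrite /ric !mulrBl; congr (_ - _); ring.
by rewrite -/(gain A) -/B; field.
Qed.

Definition nonneg_form A := forall x, 0 <= qf d A x.

Lemma H00_ge : mu <= H 0%N 0%N.
Proof.
have := H_ge (basis_vec R 0); rewrite qf_basis_vec1 //.
by rewrite /basis_vec eqxx expr1n mulr1.
Qed.

Lemma gain_ge A : nonneg_form A -> mu <= gain A.
Proof.
move=> pA; apply: le_trans H00_ge _; rewrite /gain /stage_form lerDl.
case: ifPn => // /andP[d0 _]; have := pA (basis_vec R 0).
by rewrite qf_basis_vec1.
Qed.

Lemma gain_gt0 A : nonneg_form A -> 0 < gain A.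
Proof. by move=> /gain_ge; exact: lt_le_trans. Qed.

Lemma H_nonneg w : 0 <= qf d.+1 H w.
Proof. by apply: le_trans (H_ge w); rewrite mulr_ge0 ?sqr_ge0// ltW. Qed.

(** Together with [ric_le] this describes [ric A x] as a minimum over the next value; positivity and
    monotonicity then follow without computing with Schur complements. *)
Lemma ric_min A x : symm A -> nonneg_form A ->
  qf d (ric A) x = qf d.+1 H (push (- drift A x) x) + qf d A (push (- drift A x) x).
Proof.
move=> sA pA; rewrite ric_square ?gt_eqF ?gain_gt0//.
by rewrite addNr expr0n mulr0 addr0.
Qed.

Lemma ric_le A x y : symm A -> nonneg_form A ->
  qf d (ric A) x <= qf d.+1 H (push y x) + qf d A (push y x).
Proof.
move=> sA pA; rewrite ric_square ?gt_eqF ?gain_gt0// lerDl mulr_ge0 ?sqr_ge0//.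
by rewrite ltW// gain_gt0.
Qed.

Lemma ric_nonneg A : symm A -> nonneg_form A -> nonneg_form (ric A).
Proof. by move=> sA pA x; rewrite ric_min// addr_ge0// H_nonneg. Qed.

Lemma ricn_nonneg n : nonneg_form (ricn n).
Proof.
elim: n => [|n IH]; last by apply: ric_nonneg => //; exact: ricn_sym.
by move=> x; rewrite /qf big1// => i _; rewrite big1// => j _; rewrite !mul0r.
Qed.

(** The minimizer for [B] is a competitor for [A]. *)
Lemma ric_mono A B x : symm A -> symm B -> nonneg_form A -> nonneg_form B ->
  (forall x, qf d A x <= qf d B x) -> qf d (ric A) x <= qf d (ric B) x.
Proof.
move=> sA sB pA pB AB; rewrite (ric_min x sB pB).
by apply: le_trans (ric_le x (- drift B x) sA pA) _; rewrite lerD2l.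
Qed.

Lemma ricn_le_succ n x : qf d (ricn n) x <= qf d (ricn n.+1) x.
Proof.
elim: n x => [|n IH] x.
  rewrite [leLHS](_ : _ = 0); first exact: ricn_nonneg.
  by rewrite /qf big1// => i _; rewrite big1// => j _; rewrite !mul0r.
exact: (ric_mono x (@ricn_sym n) (@ricn_sym n.+1) (@ricn_nonneg n) (@ricn_nonneg n.+1) IH).
Qed.

Lemma ricn_mono x : {homo (fun n => qf d (ricn n) x) : n m / (n <= m)%N >-> n <= m}.
Proof. by apply: homo_leq; [exact: lexx|exact: le_trans|move=> n; exact: ricn_le_succ]. Qed.

(* Moving to [0] at once and staying there costs at most the weighted sum of
   squares, since every entry survives in the history for [d] steps. *)
Lemma ricn_bounded : exists2 K, 0 <= K &
  forall n x, qf d (ricn n) x <= K * \sum_(i < d) x i ^+ 2.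
Proof.
pose B := \sum_(i < d.+1) \sum_(j < d.+1) `|H i j|.
have HB i j : (i < d.+1)%N -> (j < d.+1)%N -> `|H i j| <= B.
  move=> hi hj; rewrite /B (bigD1 (Ordinal hi))//= (bigD1 (Ordinal hj))//= -addrA lerDl.
  by rewrite addr_ge0// sumr_ge0// => ? _; rewrite sumr_ge0.
have B0 : 0 <= B by rewrite sumr_ge0// => ? _; rewrite sumr_ge0.
pose K := d.+1%:R * B; have K0 : 0 <= K by rewrite mulr_ge0.
exists (K * d%:R); first by rewrite mulr_ge0.
move=> n x.
suff : qf d (ricn n) x <= K * \sum_(i < d) (d - i)%:R * x i ^+ 2.
  move=> h; apply: (le_trans h); rewrite -(mulrA K) ler_wpM2l// mulr_sumr.
  by apply: ler_sum => i _; rewrite ler_wpM2r ?sqr_ge0// ler_nat leq_subr.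
elim: n x => [|n IH] x.
  rewrite [leLHS](_ : _ = 0).
    by rewrite mulr_ge0// sumr_ge0// => i _; rewrite mulr_ge0 ?sqr_ge0.
  by rewrite /qf big1// => i _; rewrite big1// => j _; rewrite !mul0r.
apply: le_trans (ric_le x 0 (@ricn_sym n) (@ricn_nonneg n)) _.
apply: le_trans (lerD (qf_le_sq (push 0 x) HB) (IH _)) _.
rewrite -/K -mulrDr ler_wpM2l//.
have hs : \sum_(i < d) (d - i)%:R * push 0 x i ^+ 2 <= \sum_(i < d) (d - i.+1)%:R * x i ^+ 2.
  case: d x => [|k] x; first by rewrite !big_ord0.
  rewrite big_ord_recl /= expr0n mulr0 add0r big_ord_recr /= subnn mul0r addr0.
  by apply: ler_sum => i _.
rewrite big_ord_recl /= expr0n add0r; apply: (le_trans (lerD (lexx _) hs)).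
rewrite -big_split/=; apply: ler_sum => i _; rewrite /bump /=.
by rewrite -[X in X + _]mul1r -mulrDl ler_wpM2r ?sqr_ge0// nat1r ler_nat; have := ltn_ord i; lia.
Qed.

Definition ric_lim i j : R := limn (fun n => ricn n i j).

(** The forms increase and are bounded, so they converge at each vector; polarization carries the
    convergence over to the entries. *)
Lemma ricn_entry_cvg i j : (i < d)%N -> (j < d)%N ->
  (fun n => ricn n i j) @ \oo --> ric_lim i j.
Proof.
move=> id jd; apply/cvg_ex.
have qc x : cvgn (fun n => qf d (ricn n) x).
  apply: nondecreasing_is_cvgn; first exact: ricn_mono.
  have [K K0 hK] := ricn_bounded.
  by exists (K * \sum_(i < d) x i ^+ 2) => _ [n _ <-]; exact: hK.
have -> : (fun n => ricn n i j) = (fun n =>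
    (qf d (ricn n) (fun l => basis_vec R i l + basis_vec R j l)
      - qf d (ricn n) (basis_vec R i) - qf d (ricn n) (basis_vec R j)) / 2).
  by apply/funext => n; rewrite qf_basis_vec// !qf_basis_vec1// (ricn_sym n j i); field.
by apply/cvg_ex; apply: is_cvgM; [apply: is_cvgB; [apply: is_cvgB|]|exact: is_cvg_cst].
Qed.

Lemma qf_ricn_cvg x : (fun n => qf d (ricn n) x) @ \oo --> qf d ric_lim x.
Proof.
rewrite /qf; apply: cvg_sumr => i; apply: cvg_sumr => j.
by apply: cvgMr_tmp; apply: cvgMr_tmp; apply: ricn_entry_cvg.
Qed.

Lemma ricn_le_lim n x : qf d (ricn n) x <= qf d ric_lim x.
Proof.
rewrite -(cvg_lim (@norm_hausdorff _ _) (@qf_ricn_cvg x)).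
apply: nondecreasing_cvgn_le; first exact: ricn_mono.
by apply/cvg_ex; exists (qf d ric_lim x); exact: qf_ricn_cvg.
Qed.

Lemma ric_lim_nonneg : nonneg_form ric_lim.
Proof. by move=> x; apply: le_trans (ricn_le_lim 0 x); exact: ricn_nonneg. Qed.

Lemma ric_lim_sym : symm ric_lim.
Proof.
move=> i j; rewrite /ric_lim; congr (limn _); apply/funext => n; exact: ricn_sym.
Qed.

Lemma stage_form_cvg i j :
  (fun n => stage_form (ricn n) i j) @ \oo --> stage_form ric_lim i j.
Proof.
rewrite /stage_form; apply: cvgD; first exact: cvg_cst.
case: ifPn => [/andP[id jd]|_]; [exact: ricn_entry_cvg|exact: cvg_cst].
Qed.

Lemma gain_cvg : (fun n => gain (ricn n)) @ \oo --> gain ric_lim.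
Proof. exact: stage_form_cvg. Qed.

(** Both sides are limits of the shifted iterates. Division by the gain passes to the limit because
    the limiting gain is at least [mu]. *)
Lemma ric_fixpoint x : qf d (ric ric_lim) x = qf d ric_lim x.
Proof.
have h1 : (fun n => qf d (ricn n.+1) x) @ \oo --> qf d ric_lim x.
  by rewrite (cvg_shiftS (fun n => qf d (ricn n) x)); exact: qf_ricn_cvg.
have h2 : (fun n => qf d (ricn n.+1) x) @ \oo --> qf d (ric ric_lim) x.
  rewrite /qf; apply: cvg_sumr => i; apply: cvg_sumr => j.
  apply: cvgMr_tmp; apply: cvgMr_tmp; apply: cvgB; first exact: stage_form_cvg.
  apply: cvgM; first by apply: cvgM; exact: stage_form_cvg.
  apply: cvgV; last exact: gain_cvg.
  by rewrite gt_eqF// gain_gt0//; exact: ric_lim_nonneg.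
by rewrite -(cvg_lim (@norm_hausdorff _ _) h1) -(cvg_lim (@norm_hausdorff _ _) h2).
Qed.

Lemma ric_lim_square y x :
  qf d.+1 H (push y x) + qf d ric_lim (push y x) =
  qf d ric_lim x + gain ric_lim * (y + drift ric_lim x) ^+ 2.
Proof.
rewrite ric_square ?ric_fixpoint//; first exact: ric_lim_sym.
by rewrite gt_eqF// gain_gt0//; exact: ric_lim_nonneg.
Qed.

End Riccati.

(** * Iterated integrals *)

Section Integral.
Context d (T : measurableType d) (R : realType) (mu : {measure set T -> \bar R}).
Import HBNNSimple.
Local Open Scope ereal_scope.

(** The inner integrals of an iterated integral are functions of unknown measurability. Monotonicity
    and scaling survive without it, since the integral of a nonnegative function is a supremum over
    the simple functions below it; additivity does not, and it is used only for explicit measurable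
    integrands. *)
Lemma integral_le (D : set T) (f g : T -> \bar R) :
  (forall x, D x -> 0 <= f x) -> (forall x, D x -> f x <= g x) ->
  \int[mu]_(x in D) f x <= \int[mu]_(x in D) g x.
Proof.
move=> f0 fg; rewrite ge0_integralE// ge0_integralE; last first.
  by move=> x Dx; exact: le_trans (f0 _ Dx) (fg _ Dx).
apply: le_ereal_sup => _ [h /= hf <-]; exists h => //= x.
apply: le_trans (hf x) _; rewrite /patch; case: ifPn => // /set_mem; exact: fg.
Qed.

Lemma integral_scale_le (D : set T) (f : T -> \bar R) (k : R) : (0 < k)%R ->
  (forall x, D x -> 0 <= f x) ->
  \int[mu]_(x in D) (k%:E * f x) <= k%:E * \int[mu]_(x in D) f x.
Proof.
move=> k0 f0; rewrite [leLHS]ge0_integralE; last first.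
  by move=> x Dx; rewrite mule_ge0 ?f0// lee_fin ltW.
apply: ge_ereal_sup => _ [h /= hf <-].
have k0' : (0 <= k^-1)%R by rewrite invr_ge0 ltW.
rewrite -lee_pdivrMl// -(sintegralrM mu (k^-1)%R h) ge0_integralE//.
apply: ereal_sup_ubound; exists (scale_nnsfun h k0').
  move=> x /=; have := hf x; rewrite /patch; case: ifPn => _ hx.
    by rewrite EFinM lee_pdivrMl.
  by rewrite EFinM lee_pdivrMl// mule0.
by apply: eq_sintegral => x.
Qed.

(** The reverse inequality is [integral_scale_le] for the factor [k^-1]. *)
Lemma integral_scale (D : set T) (f : T -> \bar R) (k : R) : (0 < k)%R ->
  (forall x, D x -> 0 <= f x) ->
  \int[mu]_(x in D) (k%:E * f x) = k%:E * \int[mu]_(x in D) f x.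
Proof.
move=> k0 f0; apply/eqP; rewrite eq_le integral_scale_le//=.
rewrite -lee_pdivlMl//.
have h (x : T) : f x = (k^-1)%:E * (k%:E * f x).
  by rewrite muleA -EFinM mulVf ?mul1e// gt_eqF.
rewrite [leLHS](_ : _ = \int[mu]_(x in D) ((k^-1)%:E * (k%:E * f x))); last first.
  by apply: eq_integral => x _.
apply: integral_scale_le; first by rewrite invr_gt0.
by move=> x Dx; rewrite mule_ge0 ?f0// lee_fin ltW.
Qed.

End Integral.

Section IteratedIntegral.
Variable R : realType.
Local Open Scope ereal_scope.
Implicit Types (F G : seq R -> \bar R).

(** The integrand is a function of lists, which lets it be cut and extended without dependent tuple
    types. *)
Definition int_seq n F : \bar R := integral_pos (fun t : n.-tuple R => F t).

Lemma int_seqS n F : int_seq n.+1 F =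
  \int[@lebesgue_measure R]_(x in `]0%R, +oo[) int_seq n (fun l => F (x :: l)).
Proof. by []. Qed.

Definition pos_seq n (l : seq R) := size l = n /\ all (fun x => 0 < x)%R l.

Lemma pos_seq_cons n x l : (0 < x)%R -> pos_seq n l -> pos_seq n.+1 (x :: l).
Proof. by move=> x0 [<- al]; split => //=; rewrite x0. Qed.

Lemma itv_oy (x : R) : `]0%R, +oo[%classic x -> (0 < x)%R.
Proof. by rewrite /= in_itv/= andbT. Qed.

Lemma int_seq_ge0 n F : (forall l, pos_seq n l -> 0 <= F l) -> 0 <= int_seq n F.
Proof.
elim: n F => [|n IH] F F0; first by apply: F0.
rewrite int_seqS; apply: integral_ge0 => x /itv_oy x0.
by apply: IH => l pl; apply: F0; exact: pos_seq_cons.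
Qed.

Lemma int_seq_le n F G : (forall l, pos_seq n l -> 0 <= F l) ->
  (forall l, pos_seq n l -> F l <= G l) -> int_seq n F <= int_seq n G.
Proof.
elim: n F G => [|n IH] F G F0 FG; first by apply: FG.
rewrite !int_seqS; apply: integral_le => x /itv_oy x0.
  by apply: int_seq_ge0 => l pl; apply: F0; exact: pos_seq_cons.
by apply: IH => l pl; [apply: F0|apply: FG]; exact: pos_seq_cons.
Qed.

Lemma eq_int_seq n F G : (forall l, pos_seq n l -> F l = G l) -> int_seq n F = int_seq n G.
Proof.
elim: n F G => [|n IH] F G FG; first by apply: FG.
rewrite !int_seqS; apply: eq_integral => x /set_mem/itv_oy x0.
by apply: IH => l pl; apply: FG; exact: pos_seq_cons.
Qed.

Lemma int_seq_scale n F (k : R) : (0 < k)%R -> (forall l, pos_seq n l -> 0 <= F l) ->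
  int_seq n (fun l => k%:E * F l) = k%:E * int_seq n F.
Proof.
move=> k0; elim: n F => [//|n IH] F F0.
rewrite !int_seqS -integral_scale//; last first.
  move=> x /itv_oy x0; apply: int_seq_ge0 => l pl; apply: F0; exact: pos_seq_cons.
apply: eq_integral => x /set_mem/itv_oy x0.
by apply: IH => l pl; apply: F0; exact: pos_seq_cons.
Qed.

Lemma int_seq_cat n k (G H : seq R -> R) (h : R) : (0 < h)%R ->
  int_seq k (fun l => (H l)%:E) <= h%:E ->
  (forall l, 0 <= G l)%R -> (forall l, 0 <= H l)%R ->
  int_seq (n + k) (fun l => (G (take n l) * H (drop n l))%:E) <=
  h%:E * int_seq n (fun l => (G l)%:E).
Proof.
move=> h0 Hh G0 H0; elim: n G G0 => [|n IH] G G0.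
  (* Scaling requires a positive factor, so the case [G [::] = 0] is treated apart. *)
  rewrite add0n; have := G0 [::]; rewrite le_eqVlt => /predU1P[g0|g0].
    rewrite (_ : int_seq 0 _ = (G [::])%:E)// -g0 mule0.
    rewrite -(mul0e 1) (_ : 0%E = int_seq k (fun=> 0%E)).
      by rewrite mule1; apply: int_seq_le => l _; rewrite ?take0 -?g0 ?mul0r.
    by elim: k {Hh} => // k ih; rewrite int_seqS -ih integral0.
  rewrite (eq_int_seq (G := fun l => (G [::])%:E * (H l)%:E)); last first.
    by move=> l _; rewrite take0 drop0 EFinM.
  rewrite int_seq_scale//; last by move=> l _; rewrite lee_fin.
  by rewrite (_ : int_seq 0 _ = (G [::])%:E)// [leRHS]muleC lee_pmul2l.
rewrite addSn !int_seqS -integral_scale//; last by move=> x _; apply: int_seq_ge0 => *; rewrite lee_fin.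
apply: integral_le => x _; last exact: (IH (fun l => G (x :: l))).
by apply: int_seq_ge0 => l _; rewrite lee_fin mulr_ge0.
Qed.

End IteratedIntegral.

(** * Transfer operators: bounds from super- and subsolutions *)

Section TransferUpper.
Variables (R : realType) (S : Type) (wg : S -> R -> R) (sg : S -> R -> S)
  (wb : R -> R) (s0 : S) (u : S -> R) (lam : R).
Hypothesis wg_ge0 : forall s y, 0 <= wg s y.
Hypothesis wb_ge0 : forall y, 0 <= wb y.
Hypothesis lam_gt0 : 0 < lam.
Hypothesis u_ge1 : forall s, 1 <= u s.
Hypothesis mwg : forall s, measurable_fun setT (fun y => wg s y * u (sg s y)).
Hypothesis mwb : measurable_fun setT wb.
Hypothesis one_step : forall s,
  (\int[@lebesgue_measure R]_(y in `]0%R, +oo[)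
     (wg s y * u (sg s y) + wb y * u s0)%:E <= (lam * u s)%:E)%E.

(* Each step is either good, with a weight that depends on the state, or bad,
   which resets the state. *)
Fixpoint good_bad_sum (s : S) (l : seq R) : R :=
  if l is y :: l' then wg s y * good_bad_sum (sg s y) l' + wb y * good_bad_sum s0 l'
  else 1.

Let u_ge0 s : 0 <= u s. Proof. exact: le_trans (u_ge1 s). Qed.

Lemma good_bad_sum_ge0 s l : 0 <= good_bad_sum s l.
Proof. by elim: l s => [|y l IH] s //=; rewrite addr_ge0// mulr_ge0. Qed.

Let sum_ge0 (c : seq (R * S)) (F : R * S -> R) : all (fun q => 0 <= q.1) c ->
  (forall q, 0 <= q.1 -> 0 <= F q) -> 0 <= \sum_(q <- c) F q.
Proof.
move=> + F0; elim: c => [|q c IH /= /andP[q0 /IH h]]; first by rewrite big_nil.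
by rewrite big_cons addr_ge0// F0.
Qed.

(* Stated for finite combinations of states so that the induction never has to
   integrate a sum of functions of unknown measurability. *)
Lemma int_good_bad_comb n (c : seq (R * S)) : all (fun q => 0 <= q.1) c ->
  (int_seq n (fun l => (\sum_(q <- c) q.1 * good_bad_sum q.2 l)%:E) <=
   (lam ^+ n * \sum_(q <- c) q.1 * u q.2)%:E)%E.
Proof.
elim: n c => [|n IH] c c0.
  rewrite expr0 mul1r lee_fin; elim: c c0 => [_|q c ih /= /andP[q0 /ih h]]; rewrite ?big_nil// !big_cons.
  by rewrite lerD// ler_wpM2l.
rewrite int_seqS.
have cst0 s y : 0 <= wg s y * u (sg s y) + wb y * u s0.
  by rewrite addr_ge0// mulr_ge0.
apply: (@le_trans _ _ (\int[@lebesgue_measure R]_(y in `]0%R, +oo[)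
    ((lam ^+ n)%:E * \sum_(q <- c) (q.1 * (wg q.2 y * u (sg q.2 y) + wb y * u s0))%:E))%E).
  apply: integral_le => y _.
    apply: int_seq_ge0 => l _; rewrite lee_fin; apply: sum_ge0 => // q q0.
    by rewrite mulr_ge0 ?good_bad_sum_ge0.
  pose c' := [seq (q.1 * wg q.2 y, sg q.2 y) | q <- c] ++ [seq (q.1 * wb y, s0) | q <- c].
  have c'0 : all (fun q => 0 <= q.1) c'.
    rewrite all_cat !all_map; apply/andP; split; apply: sub_all c0 => q q0 /=;
      by rewrite mulr_ge0.
  have split_sum (g : S -> R) : \sum_(q <- c') q.1 * g q.2 =
      \sum_(q <- c) q.1 * (wg q.2 y * g (sg q.2 y) + wb y * g s0).
    rewrite big_cat /= !big_map -big_split/=; apply: eq_bigr => q _.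
    by rewrite mulrDr !mulrA.
  have := IH c' c'0; rewrite split_sum sumEFin -EFinM; apply: le_trans.
  rewrite (eq_int_seq (G := fun l => (\sum_(q <- c') q.1 * good_bad_sum q.2 l)%:E)) // => l _.
  by rewrite (split_sum (fun s => good_bad_sum s l)).
rewrite integral_scale ?exprn_gt0//; last first.
  by move=> y _; rewrite sumEFin lee_fin; apply: sum_ge0 => // q q0; rewrite mulr_ge0.
rewrite exprSr -mulrA EFinM lee_pmul2l ?lte_fin ?exprn_gt0//.
have mq r : @measurable_fun _ _ R R `]0%R, +oo[
    (fun y : R => r.1 * (wg r.2 y * u (sg r.2 y) + wb y * u s0)).
  apply: measurable_funM; first exact: measurable_cst.
  apply: measurable_funTS; apply: measurable_funD; first exact: mwg.
  by apply: measurable_funM; [exact: mwb|exact: measurable_cst].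
elim: c c0 => [_|q c ih /= /andP[q0 c0]].
  by under eq_integral do rewrite big_nil; rewrite integral0 big_nil mulr0.
under eq_integral do rewrite big_cons.
rewrite ge0_integralD//; last 4 first.
- by move=> y _; rewrite lee_fin mulr_ge0.
- by apply/measurable_EFinP; exact: (mq q).
- by move=> y _; rewrite sumEFin lee_fin; apply: sum_ge0 => // r r0; rewrite mulr_ge0.
- under [X in measurable_fun _ X]eq_fun do rewrite sumEFin; apply/measurable_EFinP.
  by apply: measurable_sum => r; exact: (mq r).
rewrite big_cons mulrDr EFinD leeD ?ih//.
have [->|q_neq0] := eqVneq q.1 0.
  by under eq_integral do rewrite mul0r; rewrite integral0 mul0r mulr0.
under eq_integral do rewrite EFinM.
have qgt0 : 0 < q.1 by rewrite lt_neqAle eq_sym q_neq0.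
rewrite integral_scale//; last by move=> y _; rewrite lee_fin.
by rewrite [X in (_ <= X%:E)%E]mulrCA EFinM lee_pmul2l ?lte_fin.
Qed.

Lemma int_good_bad_le n s :
  (int_seq n (fun l => (good_bad_sum s l)%:E) <= (lam ^+ n * u s)%:E)%E.
Proof.
have := @int_good_bad_comb n [:: (1, s)]; rewrite /= ler01 big_seq1/= mul1r => /(_ erefl).
by apply: le_trans; apply: int_seq_le => l _; rewrite ?lee_fin ?good_bad_sum_ge0// big_seq1 mul1r.
Qed.

End TransferUpper.

Section TransferLower.
Variables (R : realType) (S : Type) (w : S -> R -> R) (sg : S -> R -> S)
  (D : S -> R -> bool) (I : S -> Prop) (u : S -> R) (lam : R).
Hypothesis w_gt0 : forall s y, 0 < w s y.
Hypothesis lam_gt0 : 0 < lam.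
Hypothesis u_ge0 : forall s, 0 <= u s.
Hypothesis u_le1 : forall s, u s <= 1.
Hypothesis I_step : forall s y, I s -> D s y -> I (sg s y).
Hypothesis one_step : forall s, I s -> ((lam * u s)%:E <=
  \int[@lebesgue_measure R]_(y in `]0%R, +oo[)
     (if D s y then w s y * u (sg s y) else 0)%:E)%E.

Fixpoint path_weight (s : S) (l : seq R) : R :=
  if l is y :: l' then if D s y then w s y * path_weight (sg s y) l' else 0
  else 1.

Lemma path_weight_ge0 s l : 0 <= path_weight s l.
Proof. by elim: l s => [|y l IH] s //=; case: ifP => // _; rewrite mulr_ge0// ltW. Qed.

(** [u] is a subsolution on the invariant set [I]. As [u <= 1], it lies below the weight of the
    empty path, and each integration contributes a factor [lam]. *)
Lemma int_path_weight_ge n s : I s ->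
  ((lam ^+ n * u s)%:E <= int_seq n (fun l => (path_weight s l)%:E))%E.
Proof.
elim: n s => [|n IH] s Is; first by rewrite expr0 mul1r lee_fin u_le1.
rewrite int_seqS exprSr -mulrA EFinM.
apply: le_trans (lee_wpmul2l _ (one_step Is)) _; first by rewrite lee_fin exprn_ge0// ltW.
rewrite -integral_scale ?exprn_gt0//; last first.
  by move=> y _; rewrite lee_fin; case: ifP => // _; rewrite mulr_ge0// ltW.
apply: integral_le => y _.
  by rewrite lee_fin mulr_ge0// ?exprn_ge0 ?(ltW lam_gt0)//; case: ifP => _ //; rewrite mulr_ge0// ltW.
case: ifP => [Dy|_]; last first.
  by rewrite mule0; apply: int_seq_ge0 => l _; rewrite lee_fin path_weight_ge0.
rewrite (eq_int_seq (G := fun l => (w s y)%:E * (path_weight (sg s y) l)%:E))%E; last first.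
  by move=> l _; rewrite /= Dy EFinM.
rewrite EFinM muleCA.
rewrite int_seq_scale//; last by move=> l _; rewrite lee_fin path_weight_ge0.
by rewrite lee_pmul2l ?lte_fin// -EFinM; apply: IH; exact: I_step Dy.
Qed.

End TransferLower.

(** * One-dimensional Gaussian integrals *)

Section Gaussian.
Variable R : realType.
Local Notation leb := (@lebesgue_measure R).

Lemma measurable_gauss (k l : R) :
  measurable_fun setT (fun y : R => expR (- (k / 2 * (y + l) ^+ 2))).
Proof.
apply: measurableT_comp => //; apply: measurableT_comp => //.
apply: measurable_funM; first exact: measurable_cst.
by apply: measurable_funX; apply: measurable_funD => //; exact: measurable_cst.
Qed.

Lemma integral_gauss (k l : R) : 0 < k ->
  (\int[leb]_y (expR (- (k / 2 * (y + l) ^+ 2)))%:E)%E = (Num.sqrt (2 * pi / k))%:E.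
Proof.
move=> k0; pose s := Num.sqrt k^-1.
have s2 : s ^+ 2 = k^-1 by rewrite sqr_sqrtr// invr_ge0 ltW.
have s0 : s != 0 by rewrite gt_eqF// sqrtr_gt0 invr_gt0.
have q : s ^+ 2 * pi *+ 2 = 2 * pi / k by rewrite s2 -mulr_natr; ring.
have q0 : 0 < Num.sqrt (2 * pi / k) by rewrite sqrtr_gt0 divr_gt0// mulr_gt0// pi_gt0.
have E y : expR (- (k / 2 * (y + l) ^+ 2)) = Num.sqrt (2 * pi / k) * normal_pdf (- l) s y.
  rewrite /normal_pdf (negbTE s0) /= /normal_peak q mulVKf ?gt_eqF//.
  rewrite /normal_fun opprK s2; congr expR.
  by rewrite -[k^-1 *+ 2]mulr_natr; field; rewrite gt_eqF.
under eq_integral do rewrite E EFinM.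
rewrite integral_scale//; last by move=> y _; rewrite lee_fin normal_pdf_ge0.
by rewrite integral_normal_pdf mule1.
Qed.

Lemma integral_gauss_pos_le (k l : R) : 0 < k ->
  (\int[leb]_(y in `]0%R, +oo[) (expR (- (k / 2 * (y + l) ^+ 2)))%:E <=
   (Num.sqrt (2 * pi / k))%:E)%E.
Proof.
move=> k0; rewrite -(integral_gauss l k0); apply: ge0_subset_integral => //.
by apply/measurable_EFinP; exact: measurable_gauss.
Qed.

(* Outside [|y + l| <= r] the density is at most [exp (- k r^2 / 4)] times the
   density with [k / 2] in place of [k]. *)
Lemma integral_gauss_ball_ge (k l r : R) : 0 < k -> 0 <= r ->
  ((Num.sqrt (2 * pi / k) * (1 - 2 * expR (- (k * r ^+ 2 / 4))))%:E <=
   \int[leb]_y (if `|y + l| <= r then expR (- (k / 2 * (y + l) ^+ 2)) else 0)%:E)%E.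
Proof.
move=> k0 r0; set e := expR (- (k * r ^+ 2 / 4)).
have k20 : 0 < k / 2 by rewrite divr_gt0.
pose g y := expR (- (k / 2 * (y + l) ^+ 2)).
pose h y := e * expR (- ((k / 2) / 2 * (y + l) ^+ 2)).
pose f y := if `|y + l| <= r then g y else 0.
have mf : measurable_fun setT f.
  apply: measurable_fun_ifT; [|exact: measurable_gauss|exact: measurable_cst].
  apply: measurable_fun_ler; last exact: measurable_cst.
  by apply: measurableT_comp => //; apply: measurable_funD => //; exact: measurable_cst.
have mh : measurable_fun setT h.
  by apply: measurable_funM; [exact: measurable_cst|exact: measurable_gauss].
have f0 y : 0 <= f y by rewrite /f; case: ifP => // _; exact: expR_ge0.
have h0 y : 0 <= h y by rewrite mulr_ge0// expR_ge0.
have gfh y : g y <= f y + h y.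
  rewrite /f; case: ifPn => [_|]; first by rewrite lerDl.
  rewrite add0r -ltNge => ry; rewrite /g /h /e -expRD ler_expR.
  have : r ^+ 2 <= (y + l) ^+ 2.
    by rewrite -[leRHS]real_normK ?num_real// ler_sqr ?nnegrE// ltW.
  by move=> r2; nra.
have int_h : (\int[leb]_y (h y)%:E)%E = (e * Num.sqrt (2 * pi / (k / 2)))%:E.
  under eq_integral do rewrite EFinM.
  by rewrite integral_scale ?expR_gt0 ?integral_gauss// => y _; rewrite lee_fin expR_ge0.
have : ((Num.sqrt (2 * pi / k))%:E <= \int[leb]_y (f y)%:E + \int[leb]_y (h y)%:E)%E.
  rewrite -(integral_gauss l k0) -ge0_integralD//.
  - apply: integral_le => y _; first by rewrite lee_fin expR_ge0.
  by have := gfh y; rewrite -lee_fin EFinD.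
  - by move=> y _; rewrite lee_fin.
  - exact/measurable_EFinP.
  - by move=> y _; rewrite lee_fin.
  - exact/measurable_EFinP.
rewrite int_h -leeBlDr// => H; apply: le_trans H.
rewrite -EFinB lee_fin mulrBr mulr1 lerD2l lerN2 mulrCA [leRHS]mulrA.
rewrite [_ * e]mulrC -mulrA ler_wpM2l ?expR_ge0//.
have q0 : 0 <= 2 * pi / k :> R by rewrite divr_ge0// ?mulr_ge0// ?pi_ge0// ltW.
(* Halving [k] multiplies the Gaussian constant by the square root of 2, which is rounded up to
   2. *)
rewrite [X in Num.sqrt X](_ : _ = 2 * (2 * pi / k)); last by field; rewrite gt_eqF.
rewrite sqrtrM// ler_wpM2r ?sqrtr_ge0// -[leRHS]ger0_norm// -sqrtr_sqr ler_sqrt//.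
by rewrite expr2 ler_peMl// ler1n.
Qed.

End Gaussian.

(** * Gaussian chains *)

Section GaussianChain.
Variables (R : realType) (d : nat) (H : nat -> nat -> R) (mu : R).
Hypothesis Hsym : forall i j, H i j = H j i.
Hypothesis mu_gt0 : 0 < mu.
Hypothesis H_ge : forall w, mu * w 0%N ^+ 2 <= qf d.+1 H w.
Variable a : R.

Local Notation leb := (@lebesgue_measure R).
Local Notation ricn := (ricn d H).
Local Notation gain := (gain d H).
Local Notation gainoo := (gain (ric_lim d H)).

Lemma measurable_qf_push n (A : nat -> nat -> R) x :
  measurable_fun setT (fun y : R => qf n A (push (y - a) x)).
Proof.
have mp i : measurable_fun setT (fun y : R => push (y - a) x i).
  case: i => [|i] /=; last exact: measurable_cst.
  by apply: measurable_funB => //; exact: measurable_cst.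
apply: measurable_sum => i; apply: measurable_sum => j.
apply: measurable_funM => //; apply: measurable_funM => //; exact: measurable_cst.
Qed.

(** A state is the number of good steps since the last reset together with the history; only that
    many entries of the history record actual deviations, the others are 0. *)
Definition reset_state : nat * (nat -> R) := (0%N, fun=> 0).

Definition extend_state (s : nat * (nat -> R)) (y : R) := (s.1.+1, push (y - a) s.2).

(* Before [d] good steps have been seen since the last reset, only the lower
   bound [mu * y^2] of the stage cost is available. *)
Definition stage_cost (s : nat * (nat -> R)) (y : R) : R :=
  if (d <= s.1)%N then qf d.+1 H (push (y - a) s.2) else mu * (y - a) ^+ 2.

Section Upper.
Variables (b : R) (wb : R -> R) (W G : R) (J : nat).
Hypothesis b_gt0 : 0 < b.
Hypothesis wb_ge0 : forall y, 0 <= wb y.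
Hypothesis mwb : measurable_fun setT wb.
Hypothesis W_ge0 : 0 <= W.
Hypothesis int_wb : (\int[leb]_(y in `]0%R, +oo[) (wb y)%:E <= W%:E)%E.
Hypothesis G_ge1 : 1 <= G.

Let wg s y := expR (- (b / 2 * stage_cost s y)).
Let E j x := expR (- (b / 2 * qf d (ricn j) x)).
Let geo := \sum_(j < J.+1) G ^+ j.
(** A good step turns [E j] into at most [sig (gain (ricn j))] times [E j.+1]. The weights [G ^+ j]
    reduce the cost of passing from j to j.+1 to at most [sig mu / G]; only the last summand pays
    its own constant, which tends to the limiting one as J grows. The summand [E 0 = 1] bounds the
    sum from below. In [u], the d steps after a reset also gain one factor [G] each. *)
Let uJ x := \sum_(j < J.+1) G ^+ j * E j x.
Let u (s : nat * (nat -> R)) := if (d <= s.1)%N then uJ s.2 else G ^+ (d - s.1) * geo.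
Let sig c := Num.sqrt (2 * pi / (b * c)).

Let G_ge0 : 0 <= G. Proof. exact: le_trans G_ge1. Qed.
Let Gn_ge1 n : 1 <= G ^+ n. Proof. exact: exprn_ege1. Qed.
Let Gn_ge0 n : 0 <= G ^+ n. Proof. exact: exprn_ge0. Qed.

Let E_le1 j x : E j x <= 1.
Proof.
rewrite /E -expR0 ler_expR oppr_le0 mulr_ge0//; last exact: ricn_nonneg Hsym mu_gt0 H_ge j x.
by rewrite divr_ge0// ltW.
Qed.

Let uJ_le x : uJ x <= geo.
Proof. by apply: ler_sum => j _; rewrite ler_piMr// E_le1. Qed.

Let uJ_ge1 x : 1 <= uJ x.
Proof.
rewrite /uJ big_ord_recl expr0 mul1r {1}/E [X in expR X](_ : _ = 0) ?expR0.
  by rewrite lerDl sumr_ge0// => i _; rewrite mulr_ge0 ?expR_ge0.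
rewrite /qf [X in b / 2 * X]big1 ?mulr0 ?oppr0// => i _.
by rewrite big1// => j _; rewrite !mul0r.
Qed.

Let geo_ge1 : 1 <= geo. Proof. exact: le_trans (uJ_ge1 (fun=> 0)) (uJ_le _). Qed.

Let u_ge1 s : 1 <= u s.
Proof. by rewrite /u; case: ifP => _; rewrite ?uJ_ge1// mulr_ege1. Qed.

Let u_le s : u s <= G ^+ (d - s.1) * geo.
Proof.
rewrite /u; case: ifP => _ //; apply: le_trans (uJ_le _) _.
by rewrite ler_peMl// (le_trans _ geo_ge1).
Qed.

(** The three terms pay for the last summand of [uJ], for the other summands and the start-up steps,
    and for a bad step, after which [u] is at most [G ^+ d * geo]. *)
Definition upper_rate : R :=
  sig (gain (ricn J)) + sig mu / G + W * (G ^+ d * geo).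
Let lam := upper_rate.

Let sig_mono c1 c2 : 0 < c1 -> c1 <= c2 -> sig c2 <= sig c1.
Proof.
move=> c1_gt0 c12; have c2_gt0 := lt_le_trans c1_gt0 c12.
have pi2 : 0 < 2 * pi :> R by rewrite mulr_gt0 ?pi_gt0.
rewrite /sig ler_sqrt; last by rewrite ltW// divr_gt0// mulr_gt0.
by rewrite ler_wpM2l ?(ltW pi2)// lef_pV2 ?posrE ?mulr_gt0// ler_wpM2l// ltW.
Qed.

Let gain_gt0' j : 0 < gain (ricn j).
Proof. exact/(gain_gt0 mu_gt0 H_ge)/(ricn_nonneg Hsym mu_gt0 H_ge). Qed.

Let sig_ge0 c : 0 <= sig c. Proof. exact: sqrtr_ge0. Qed.

Let lam_gt0 : 0 < lam.
Proof.
rewrite /lam /upper_rate -addrA ltr_wpDr//; last first.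
  by rewrite sqrtr_gt0 divr_gt0 ?mulr_gt0 ?pi_gt0.
by rewrite addr_ge0 ?divr_ge0 ?mulr_ge0// (le_trans _ geo_ge1).
Qed.

Let mwg s : measurable_fun setT (fun y => wg s y * u (extend_state s y)).
Proof.
apply: measurable_funM.
  apply: measurableT_comp => //; apply: measurableT_comp => //.
  apply: measurable_funM; first exact: measurable_cst.
  have -> : stage_cost s = if (d <= s.1)%N then fun y => qf d.+1 H (push (y - a) s.2)
      else fun y => mu * (y - a) ^+ 2.
    by apply/funext => y; rewrite /stage_cost; case: ifP.
  case: ifP => _; first exact: measurable_qf_push.
  apply: measurable_funM; first exact: measurable_cst.
  by apply: measurable_funX; apply: measurable_funB => //; exact: measurable_cst.
have -> : (fun y => u (extend_state s y)) = if (d <= s.1.+1)%N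
    then fun y => uJ (push (y - a) s.2) else fun=> G ^+ (d - s.1.+1) * geo.
  by apply/funext => y; rewrite /u /=; case: ifP.
case: ifP => _; last exact: measurable_cst.
apply: measurable_sum => j; apply: measurable_funM; first exact: measurable_cst.
apply: measurableT_comp => //; apply: measurableT_comp => //.
by apply: measurable_funM; [exact: measurable_cst|exact: measurable_qf_push].
Qed.

Let good_step s :
  (\int[leb]_(y in `]0%R, +oo[) (wg s y * u (extend_state s y))%:E <=
   ((sig (gain (ricn J)) + sig mu / G) * u s)%:E)%E.
Proof.
have G_gt0 : 0 < G := lt_le_trans ltr01 G_ge1.
have [dk|kd] := leqP d s.1.
  pose g j y := G ^+ j * E j.+1 s.2 *
     expR (- ((b * gain (ricn j)) / 2 * (y + (drift d H (ricn j) s.2 - a)) ^+ 2)).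
  have -> : (fun y => (wg s y * u (extend_state s y))%:E) =
      (fun y => \sum_(j < J.+1) (g j y)%:E)%E.
    apply/funext => y; rewrite sumEFin /u /= leqW// /uJ mulr_sumr; congr EFin.
    apply: eq_bigr => j _; rewrite /g /wg /stage_cost dk mulrCA -!mulrA; congr (_ * _).
    rewrite /E -!expRD; congr expR.
    have := ric_square Hsym (y - a) s.2 (@ricn_sym _ d H Hsym j) (lt0r_neq0 (gain_gt0' j)).
    rewrite -/(ricn j.+1) => /(canRL (addrK _)) ->.
    rewrite (_ : y + (drift d H (ricn j) s.2 - a) = y - a + drift d H (ricn j) s.2); last by ring.
    by rewrite /=; ring.
  have mg j : measurable_fun setT (fun y : R => (g j y)%:E).
    apply/measurable_EFinP; apply: measurable_funM; first exact: measurable_cst.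
    exact: measurable_gauss.
  have g0 j y : 0 <= g j y by rewrite !mulr_ge0 ?expR_ge0.
  rewrite ge0_integral_sum//; last first.
  - by move=> j y _; rewrite lee_fin.
  - by move=> j; exact: measurable_funTS (mg j).
  have gint j : (\int[leb]_(y in `]0%R, +oo[) (g j y)%:E <=
      (G ^+ j * E j.+1 s.2 * sig (gain (ricn j)))%:E)%E.
    have GE0 : 0 < G ^+ j * E j.+1 s.2 by rewrite mulr_gt0 ?exprn_gt0 ?expR_gt0.
    under eq_integral do rewrite EFinM.
    rewrite integral_scale//.
    rewrite [X in (_ <= X)%E]EFinM lee_pmul2l ?lte_fin//.
    by apply: integral_gauss_pos_le; rewrite mulr_gt0.
  apply: (@le_trans _ _ (\sum_(j < J.+1) (G ^+ j * E j.+1 s.2 * sig (gain (ricn j)))%:E)%E).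
    by apply: lee_sum => j _; exact: gint.
  (* The summand J is moved to J.+1, which is not in the sum; it is brought back by [E J.+1 <= E J],
     as the iterates increase. *)
  rewrite sumEFin lee_fin big_ord_recr /= addrC /u dk mulrDl; apply: lerD.
    rewrite mulrC ler_wpM2l//.
    apply: (@le_trans _ _ (G ^+ J * E J s.2)).
      rewrite ler_wpM2l// ler_expR lerN2 ler_wpM2l ?divr_ge0 ?(ltW b_gt0)//.
      exact: (ricn_le_succ Hsym mu_gt0 H_ge).
    by rewrite /uJ big_ord_recr/= lerDr sumr_ge0// => j _; rewrite mulr_ge0 ?expR_ge0.
  (* Summand j on the left is compared with summand j.+1 on the right, where [E 0] is dropped. *)
  rewrite /uJ big_ord_recl mulrDr -[leLHS]add0r lerD//.
    by rewrite !mulr_ge0 ?expR_ge0 ?invr_ge0// ltW.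
  rewrite mulr_sumr; apply: ler_sum => j _ /=; rewrite /bump /= add1n.
  rewrite (_ : sig mu / G * _ = G ^+ j * E j.+1 s.2 * sig mu); last first.
    by rewrite exprS; field; rewrite gt_eqF.
  rewrite ler_wpM2l ?mulr_ge0 ?expR_ge0//; apply: sig_mono => //.
  exact/(gain_ge H_ge)/(ricn_nonneg Hsym mu_gt0 H_ge).
(* During start-up only the curvature [mu] is known; the factor [G] that [u] loses in the step turns
   [sig mu] into the rate [sig mu / G]. *)
have Gd : G ^+ (d - s.1) = G * G ^+ (d - s.1.+1).
  by rewrite -exprS; congr (_ ^+ _); lia.
have Gg0 : 0 < G ^+ (d - s.1.+1) * geo.
  by rewrite mulr_gt0 ?exprn_gt0// (lt_le_trans _ geo_ge1).
apply: (@le_trans _ _ (\int[leb]_(y in `]0%R, +oo[)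
   ((G ^+ (d - s.1.+1) * geo)%:E * (expR (- ((b * mu) / 2 * (y + - a) ^+ 2)))%:E))%E).
  apply: integral_le => y _.
    by rewrite lee_fin mulr_ge0 ?expR_ge0// (le_trans _ (u_ge1 _)).
  rewrite -EFinM lee_fin mulrC; apply: ler_pM; rewrite ?expR_ge0//.
  - by rewrite (le_trans _ (u_ge1 _)).
  - by rewrite ler_expR /stage_cost leqNgt kd /=; nra.
rewrite integral_scale//.
apply: (@le_trans _ _ ((G ^+ (d - s.1.+1) * geo)%:E * (sig mu)%:E)%E).
  rewrite lee_pmul2l ?lte_fin//; apply: integral_gauss_pos_le; exact: mulr_gt0.
rewrite -EFinM lee_fin /u leqNgt kd /= Gd.
rewrite mulrDl -[leLHS]add0r lerD ?mulr_ge0 ?(le_trans _ geo_ge1)//.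
by rewrite le_eqVlt; apply/orP; left; apply/eqP; field; rewrite gt_eqF.
Qed.

Let one_step s :
  (\int[leb]_(y in `]0%R, +oo[)
     (wg s y * u (extend_state s y) + wb y * u reset_state)%:E <= (lam * u s)%:E)%E.
Proof.
have u0 t : 0 < u t := lt_le_trans ltr01 (u_ge1 t).
under eq_integral do rewrite EFinD.
rewrite ge0_integralD//; last 4 first.
- by move=> y _; rewrite lee_fin mulr_ge0 ?expR_ge0// ltW.
- by apply: measurable_funTS; apply/measurable_EFinP; exact: mwg.
- by move=> y _; rewrite lee_fin mulr_ge0// ltW.
- apply: measurable_funTS; apply/measurable_EFinP.
  by apply: measurable_funM; [exact: mwb|exact: measurable_cst].
rewrite /lam /upper_rate mulrDl EFinD; apply: leeD; first exact: good_step.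
under eq_integral do rewrite mulrC EFinM.
rewrite integral_scale//; last by move=> y _; rewrite lee_fin.
apply: (@le_trans _ _ ((u reset_state)%:E * W%:E)%E); first by rewrite lee_pmul2l ?lte_fin.
rewrite -EFinM lee_fin mulrC -mulrA ler_wpM2l//.
have := u_le reset_state; rewrite subn0 => h; apply: (le_trans h).
by rewrite ler_peMr// mulr_ge0// (le_trans _ geo_ge1).
Qed.

Lemma int_good_bad_gauss_le : exists2 M, 0 < M & forall n,
  (int_seq n (fun l => (good_bad_sum wg extend_state wb reset_state reset_state l)%:E)
    <= (upper_rate ^+ n * M)%:E)%E.
Proof.
exists (u reset_state); first exact: lt_le_trans (u_ge1 _).
by move=> n; apply: int_good_bad_le => // s y; exact: expR_ge0.
Qed.

End Upper.

Section Lower.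
Hypothesis d_gt0 : (0 < d)%N.
Variable delta : R.
Hypothesis delta_gt0 : 0 < delta.
Hypothesis delta_lt : delta < a.

Fixpoint stage_sum (x : nat -> R) (l : seq R) : R :=
  if l is y :: l' then qf d.+1 H (push (y - a) x) + stage_sum (push (y - a) x) l' else 0.

(** Under a push the weighted squares lose [mu / d] times the sum of squares and gain [mu * y ^+ 2]
    from the new entry. The value [ric_lim] falls by the stage cost, which is at least
    [mu * y ^+ 2], and so pays for this gain. The function therefore contracts up to the innovation,
    and it controls the newest deviation. *)
Definition lyapunov (x : nat -> R) : R :=
  qf d (ric_lim d H) x + mu / d%:R * \sum_(i < d) (d - i)%:R * x i ^+ 2.

Let A_nonneg : nonneg_form d (ric_lim d H).
Proof. exact: (ric_lim_nonneg Hsym mu_gt0 H_ge). Qed.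

Let c_gt0 : 0 < gainoo.
Proof. exact/(gain_gt0 mu_gt0 H_ge). Qed.

Let dR_gt0 : 0 < d%:R :> R. Proof. by rewrite ltr0n. Qed.

Lemma lyapunov_le : exists2 K, 0 < K &
  forall x, lyapunov x <= K * \sum_(i < d) x i ^+ 2.
Proof.
pose B := \sum_(i < d) \sum_(j < d) `|ric_lim d H i j|.
have B0 : 0 <= B by rewrite sumr_ge0// => ? _; rewrite sumr_ge0.
exists (d%:R * B + mu); first by rewrite ltr_wpDl// mulr_ge0.
move=> x; rewrite mulrDl lerD//.
  apply: qf_le_sq => i j hi hj.
  rewrite /B (bigD1 (Ordinal hi))//= (bigD1 (Ordinal hj))//= -addrA lerDl.
  by rewrite addr_ge0// sumr_ge0// => ? _; rewrite sumr_ge0.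
rewrite -mulrA ler_wpM2l ?(ltW mu_gt0)// ler_pdivrMl// mulr_sumr.
by apply: ler_sum => i _; rewrite ler_wpM2r ?sqr_ge0// ler_nat leq_subr.
Qed.

Lemma lyapunov_push y x : lyapunov (push y x) <=
  lyapunov x + gainoo * (y + drift d H (ric_lim d H) x) ^+ 2
  - mu / d%:R * \sum_(i < d) x i ^+ 2.
Proof.
have e := ric_lim_square Hsym mu_gt0 H_ge y x.
have h := H_ge (push y x); rewrite /= in h.
have s : \sum_(i < d) (d - i)%:R * push y x i ^+ 2 =
    d%:R * y ^+ 2 + \sum_(i < d) (d - i)%:R * x i ^+ 2 - \sum_(i < d) x i ^+ 2.
  rewrite -addrA -sumrB; case: d d_gt0 => // k _.
  rewrite big_ord_recl subn0 /=; congr (_ + _).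
  rewrite [RHS]big_ord_recr /= subSnn mul1r subrr addr0.
  apply: eq_bigr => i _; rewrite /bump /= add1n subSS.
  by rewrite (subSn (ltnW (ltn_ord i))) -natr1; ring.
rewrite /lyapunov s.
have -> : mu / d%:R * (d%:R * y ^+ 2 + \sum_(i < d) (d - i)%:R * x i ^+ 2 - \sum_(i < d) x i ^+ 2)
   = mu * y ^+ 2 + mu / d%:R * (\sum_(i < d) (d - i)%:R * x i ^+ 2)
     - mu / d%:R * \sum_(i < d) x i ^+ 2 by field; rewrite gt_eqF.
lra.
Qed.

Lemma lyapunov_ge y x : mu * y ^+ 2 <= lyapunov (push y x).
Proof.
rewrite /lyapunov -[leLHS]add0r lerD//; case: d d_gt0 (dR_gt0) => // k _ k0.
rewrite big_ord_recl subn0 /= mulrDr mulrA divfK ?gt_eqF// lerDl mulr_ge0//.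
  by rewrite divr_ge0// ltW.
by apply: sumr_ge0 => i _; rewrite mulr_ge0// sqr_ge0.
Qed.

Let w b x y := expR (- (b / 2 * qf d.+1 H (push (y - a) x))).
Let D rho x y : bool := `|y - a + drift d H (ric_lim d H) x| <= rho.
Let I x := lyapunov x <= mu * delta ^+ 2.
Let u b x := expR (- (b / 2 * qf d (ric_lim d H) x)).

Let noise_radius_ex : exists2 rho, 0 < rho & forall x y, I x -> D rho x y -> I (push (y - a) x).
Proof.
have [K K0 hK] := lyapunov_le.
have dK : 0 < d%:R * K + mu by rewrite addr_gt0// mulr_gt0.
(* [q] is the contraction rate; the summand [mu] in the denominator keeps it at most 1. The radius
   below lets the innovation use up the fraction [q] of the level that the contraction frees. *)
pose q := mu / (d%:R * K + mu).
have q0 : 0 < q by rewrite divr_gt0.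
have md0 : 0 < mu * delta ^+ 2 by rewrite mulr_gt0// exprn_gt0.
exists (Num.sqrt (q * (mu * delta ^+ 2) / gainoo)).
  by rewrite sqrtr_gt0 divr_gt0// mulr_gt0.
move=> x y Ix Dxy; rewrite /I; apply: le_trans (lyapunov_push _ _) _.
set t := y - a + _ in Dxy *.
have t2 : gainoo * t ^+ 2 <= q * (mu * delta ^+ 2).
  move: Dxy; rewrite /D -/t -(ler_sqr) ?nnegrE ?sqrtr_ge0// sqr_sqrtr; last first.
    by rewrite ltW// divr_gt0// mulr_gt0.
  by rewrite real_normK ?num_real// ler_pdivlMr// mulrC.
have hq : q * lyapunov x <= mu / d%:R * \sum_(i < d) x i ^+ 2.
  have S0 : 0 <= \sum_(i < d) x i ^+ 2 by apply: sumr_ge0 => *; exact: sqr_ge0.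
  apply: le_trans (ler_wpM2l (ltW q0) (hK x)) _; rewrite mulrA ler_wpM2r//.
  rewrite /q mulrAC ler_pdivrMr// -mulrA ler_wpM2l ?(ltW mu_gt0)//.
  by rewrite mulrDr mulrA mulVf ?gt_eqF// mul1r lerDl mulr_ge0 ?invr_ge0// ltW.
have q1 : q <= 1 by rewrite /q ler_pdivrMr// mul1r lerDr mulr_ge0 ?ltW.
have := @mulr_ge0 _ (1 - q) (mu * delta ^+ 2 - lyapunov x).
rewrite !subr_ge0 => /(_ q1 Ix); move: t2 hq; set S := \sum_(i < d) _.
move: (mu / d%:R * S) (lyapunov x) (gainoo * _) (mu * delta ^+ 2) => B L A M.
rewrite mulrBl mul1r mulrBr => ? ? ?; lra.
Qed.

(** Innovations restricted to a ball of radius [rho], which does not depend on [b], keep the whole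
    path within [delta] of [a] and lose only an exponentially small part of each Gaussian. The
    weight [u] built on the fixed point reproduces itself exactly, so the limiting gain appears in
    the rate. *)
Lemma int_gauss_chain_ge : exists2 rho, 0 < rho & forall b, 0 < b ->
  exists P : seq R -> R,
  [/\ forall l, 0 <= P l,
      forall l, P l != 0 -> P l = expR (- (b / 2 * stage_sum (fun=> 0) l)) /\
         all (fun y => `|y - a| <= delta) l
    & 0 < 1 - 2 * expR (- (b * gainoo * rho ^+ 2 / 4)) -> forall n,
      (((Num.sqrt (2 * pi / (b * gainoo)) *
        (1 - 2 * expR (- (b * gainoo * rho ^+ 2 / 4)))) ^+ n)%:E <=
      int_seq n (fun l => (P l)%:E))%E].
Proof.
have [rho rho0 inv] := noise_radius_ex; exists rho => // b b_gt0.
pose sg (x : nat -> R) y := push (y - a) x.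
have I0 : I (fun=> 0).
  rewrite /I /lyapunov qf0 add0r big1 ?mulr0 ?mulr_ge0 ?sqr_ge0 ?ltW//.
  by move=> i _; rewrite expr0n mulr0.
have near_a x y : I (sg x y) -> `|y - a| <= delta.
  move=> Iy; have := le_trans (lyapunov_ge (y - a) x) Iy.
  by rewrite ler_pM2l// -[leLHS]real_normK ?num_real// ler_sqr ?nnegrE ?(ltW delta_gt0).
exists (path_weight (w b) sg (D rho) (fun=> 0)); split.
- by move=> l; apply: path_weight_ge0 => s y; exact: expR_gt0.
- move=> l; move: (fun=> 0) I0 => x Ix; elim: l x Ix => [|y l IH] x Ix /=.
    by rewrite mulr0 oppr0 expR0.
  case: ifPn; last by rewrite eqxx.
  move=> Dxy; have Iy := inv _ _ Ix Dxy.
  rewrite mulf_eq0 negb_or => /andP[_ /(IH _ Iy)[-> ->]].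
  by rewrite (near_a x y Iy); split => //; rewrite /w -expRD mulrDr opprD.
- move=> lam0 n; have bc0 : 0 < b * gainoo by rewrite mulr_gt0.
  set lam := _ * _.
  have lam_gt0 : 0 < lam by rewrite mulr_gt0// sqrtr_gt0 divr_gt0 ?mulr_gt0 ?pi_gt0.
  have := @int_path_weight_ge _ _ (w b) sg (D rho) I (u b) lam _ lam_gt0.
  have -> : lam ^+ n = lam ^+ n * u b (fun=> 0) by rewrite /u qf0 mulr0 oppr0 expR0 mulr1.
  apply => //.
  + by move=> s y; exact: expR_gt0.
  + by move=> s; exact: expR_ge0.
  + move=> s; rewrite -expR0 ler_expR oppr_le0 mulr_ge0//.
    by rewrite divr_ge0// ltW.
  move=> x Ix; set l := drift d H (ric_lim d H) x - a.
  have yl y : y - a + drift d H (ric_lim d H) x = y + l by rewrite /l addrAC addrA.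
  pose f y := if D rho x y then w b x y * u b (sg x y) else 0.
  have fE y : f y = u b x * (if `|y + l| <= rho then
      expR (- (b * gainoo / 2 * (y + l) ^+ 2)) else 0).
    rewrite /f /D yl; case: ifP => _; last by rewrite mulr0.
    rewrite /w /u -!expRD -!opprD -!mulrDr.
    have := ric_lim_square Hsym mu_gt0 H_ge (y - a) x; rewrite /sg yl => ->.
    by congr expR; ring.
  (* The admissible [y] are positive because [delta < a], so the half-line may be replaced by the
     whole line. *)
  rewrite (_ : integral _ _ _ = \int[leb]_y (f y)%:E)%E; last first.
    rewrite integral_mkcond; apply: eq_integral => y _; rewrite /patch.
    case: ifPn => // /negP ny; rewrite /f; case: ifP => // Dy; exfalso; apply: ny.
    apply/mem_set; rewrite /= in_itv/= andbT.
    have := near_a x y (inv _ _ Ix Dy); rewrite ler_norml => /andP[h _].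
    by have := delta_lt; lra.
  under eq_integral do rewrite fE EFinM.
  rewrite integral_scale ?expR_gt0//; last first.
    by move=> y _; rewrite lee_fin; case: ifP => // _; exact: expR_ge0.
  rewrite mulrC EFinM lee_pmul2l ?lte_fin ?expR_gt0//.
  exact: (integral_gauss_ball_ge l bc0 (ltW rho0)).
Qed.

End Lower.

End GaussianChain.

(** * Sums over windows of a history *)

Section Windows.
Variable R : realType.

(** [c.-1 - j] counts the later windows of length c that will still contain entry j. Replacing a
    window sum by c times its newest term thus costs a difference of potentials, which telescopes
    along the chain. *)
Definition potential (T : Type) (g : T -> R) c (x : nat -> T) : R :=
  \sum_(j < c) (c.-1 - j)%:R * g (x j).

Lemma sum_window (T : Type) (g : T -> R) c y (x : nat -> T) :
  \sum_(j < c) g (push y x j) =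
  c%:R * g y + potential g c x - potential g c (push y x).
Proof.
case: c => [|c]; first by rewrite /potential !big_ord0 mul0r; ring.
have key : \sum_(j < c) g (x j) =
    \sum_(j < c) (c - j)%:R * g (x j) - \sum_(j < c) (c - j.+1)%:R * g (x j).
  rewrite -sumrB; apply: eq_bigr => j _.
  by rewrite -(subnSK (ltn_ord j)) -natr1; ring.
rewrite /potential big_ord_recl key /= [\sum_(j < c.+1) (c - j)%:R * g (x j)]big_ord_recr /=.
rewrite [\sum_(j < c.+1) (c - j)%:R * g (push y x j)]big_ord_recl /= subnn subn0 -natr1.
by ring.
Qed.

Lemma potential_const (T : Type) (g : T -> R) c x0 : g x0 = 0 ->
  potential g c (fun=> x0) = 0.
Proof. by move=> g0; rewrite /potential big1// => j _; rewrite g0 mulr0. Qed.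

Lemma potential_le0 (T : Type) (g : T -> R) c (x : nat -> T) :
  (forall j, (j < c)%N -> g (x j) <= 0) -> potential g c x <= 0.
Proof. by move=> g0; apply: sumr_le0 => j _; rewrite mulr_ge0_le0// g0. Qed.

(** Half the sum of all [(w i - w j) ^+ 2]: the quadratic term in Jensen's inequality for c
    spacings. *)
Definition deficit c (w : nat -> R) : R :=
  c%:R * \sum_(i < c) w i ^+ 2 - (\sum_(i < c) w i) ^+ 2.

Lemma deficit_ge0 c w : 0 <= deficit c w.
Proof.
have e : \sum_(i < c) \sum_(j < c) (w i - w j) ^+ 2 = 2 * deficit c w.
  rewrite /deficit; set S := \sum_(i < c) w i ^+ 2; set L := \sum_(i < c) w i.
  rewrite (eq_bigr (fun i : 'I_c => c%:R * w i ^+ 2 + S - 2 * L * w i)); last first.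
    move=> i _; rewrite (eq_bigr (fun j : 'I_c => w i ^+ 2 + w j ^+ 2 - 2 * w i * w j)); last first.
      by move=> j _; ring.
    rewrite sumrB big_split/= sumr_const card_ord -mulr_sumr mulr_natl -/S -/L.
    by congr (_ - _); ring.
  rewrite sumrB big_split/= sumr_const card_ord -!mulr_sumr -/S -/L -[S *+ c]mulr_natl.
  by ring.
have : 0 <= \sum_(i < c) \sum_(j < c) (w i - w j) ^+ 2.
  by apply: sumr_ge0 => i _; apply: sumr_ge0 => j _; exact: sqr_ge0.
by rewrite e pmulr_rge0.
Qed.

Variables (phi : nat -> R) (mu : R) (m : nat).

(** The matrix of [mu * w 0 ^+ 2] minus the sum of [phi c * deficit c w]. A window contributes
    [phi c] times its squared sum, that is [phi c] times c times its sum of squares minus its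
    deficit. The sums of squares telescope to [c ^+ 2] times the newest square, and these make up
    [mu]; the deficits can only help since [phi c <= 0]. *)
Definition stage_matrix i j : R :=
  (if (i == 0)%N && (j == 0)%N then mu else 0) -
  \sum_(2 <= c < m.+1) phi c *
    ((if (i == j) && (i < c)%N then c%:R else 0) - (if (i < c)%N && (j < c)%N then 1 else 0)).

Lemma stage_matrix_sym i j : stage_matrix i j = stage_matrix j i.
Proof.
rewrite /stage_matrix andbC; congr (_ - _); apply: eq_bigr => c _.
rewrite [(i < c)%N && (j < c)%N]andbC [i == j]eq_sym.
by case: eqVneq => // ->.
Qed.

Lemma sum_lt_widen c (F : nat -> R) : (c <= m)%N ->
  \sum_(i < m) (if (i < c)%N then F i else 0) = \sum_(i < c) F i.
Proof. by move=> cm; rewrite [RHS](big_ord_widen m)// -big_mkcond. Qed.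

Lemma stage_matrixE w : (0 < m)%N -> qf m stage_matrix w =
  mu * w 0%N ^+ 2 - \sum_(2 <= c < m.+1) phi c * deficit c w.
Proof.
move=> m0; rewrite /qf.
rewrite (eq_bigr (fun i : 'I_m => \sum_(j < m)
  ((if (i == 0 :> nat) && (j == 0 :> nat) then mu else 0) * w i * w j) -
  \sum_(j < m) \sum_(2 <= c < m.+1) phi c *
    ((if (i == j :> nat) && (i < c)%N then c%:R else 0) - (if (i < c)%N && (j < c)%N then 1 else 0))
      * w i * w j)); last first.
  move=> i _; rewrite -sumrB; apply: eq_bigr => j _.
  by rewrite /stage_matrix !mulrBl !mulr_suml.
rewrite sumrB; congr (_ - _).
  rewrite (bigD1 (Ordinal m0))//= (bigD1 (Ordinal m0))//= !big1 ?addr0; first by ring.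
  - move=> i; rewrite -val_eqE /= => /negbTE i0; rewrite big1// => j _.
    by rewrite i0 /= !mul0r.
  - by move=> j; rewrite -val_eqE /= => /negbTE j0; rewrite j0 !mul0r.
under eq_bigr do rewrite exchange_big/=.
rewrite exchange_big/= big_nat_cond [RHS]big_nat_cond; apply: eq_bigr => c /andP[/andP[_ cm] _].
rewrite /deficit mulrBr.
have inner i (im : (i < m)%N) : \sum_(j < m) phi c *
    ((if (i == j) && (i < c)%N then c%:R else 0) - (if (i < c)%N && (j < c)%N then 1 else 0))
      * w i * w j =
    if (i < c)%N then phi c * (c%:R * w i ^+ 2) - phi c * (w i * \sum_(j < c) w j) else 0.
  case: ifP => ic; last first.
    by rewrite big1// => j _; rewrite andbF subrr mulr0 !mul0r.
  rewrite -(sum_lt_widen w cm) mulr_sumr mulr_sumr.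
  rewrite (_ : c%:R * w i ^+ 2 = \sum_(j < m) (if j == i :> nat then c%:R * w i ^+ 2 else 0)); last first.
    rewrite (bigD1 (Ordinal im))//= eqxx big1 ?addr0// => j.
    by rewrite -val_eqE /= => /negbTE ->.
  rewrite mulr_sumr -sumrB; apply: eq_bigr => j _.
  rewrite andbT [i == _]eq_sym; case: eqVneq => [->|_]; rewrite ?ic /=; first by ring.
  by case: ifP => _; ring.
rewrite (eq_bigr (fun i : 'I_m => if (i < c)%N then
   phi c * (c%:R * w i ^+ 2) - phi c * (w i * \sum_(j < c) w j) else 0)); last first.
  by move=> i _; exact: inner.
rewrite (sum_lt_widen (fun i => phi c * (c%:R * w i ^+ 2) - phi c * (w i * \sum_(j < c) w j)) cm).
by rewrite sumrB -!mulr_sumr -mulr_suml expr2.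
Qed.

Lemma stage_matrix_ge w : (0 < m)%N -> (forall c, (2 <= c <= m)%N -> phi c <= 0) ->
  mu * w 0%N ^+ 2 <= qf m stage_matrix w.
Proof.
move=> m0 phi0; rewrite stage_matrixE// lerBrDl -lerBrDr subrr.
rewrite big_nat_cond; apply: sumr_le0 => c; rewrite andbT ltnS => /phi0 pc.
by rewrite mulr_le0_ge0// deficit_ge0.
Qed.

End Windows.

(** * Removing particles from crowded configurations *)

Section Chain.
Variables (R : realType) (f : R -> R) (m : nat).

Definition pos (z : nat -> R) k : R := \sum_(i < k) z i.

Lemma posS z k : pos z k.+1 = pos z k + z k.
Proof. by rewrite /pos big_ord_recr. Qed.

(** The range refers to the original labels, so deleting a particle removes its own pairs and
    creates no new ones. *)
Definition pair_energy z i j : R :=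
  if (j - i <= m)%N then f (pos z j - pos z i) else 0.

(* The list of the particles that are present is kept in decreasing order. *)
Fixpoint list_energy z (K : seq nat) : R :=
  if K is k :: K' then \sum_(i <- K') pair_energy z i k + list_energy z K' else 0.

Definition particles n : seq nat := rev (iota 0 n.+1).

Lemma particlesS n : particles n.+1 = n.+1 :: particles n.
Proof. by rewrite /particles -addn1 iotaD rev_cat /= add0n. Qed.

Lemma list_energy_cat z A k L : list_energy z (A ++ k :: L) =
  list_energy z (A ++ L) + \sum_(q <- A) pair_energy z k q + \sum_(q <- L) pair_energy z q k.
Proof.
elim: A => [|x A IH] /=; first by rewrite big_nil; ring.
by rewrite IH !big_cat !big_cons /=; ring.
Qed.

(* Neighbours in the list that still interact are at distance at least [r]. *)
Definition spaced z (r : R) : rel nat := fun x y =>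
  (y < x)%N && ((x - y <= m)%N ==> (r <= pos z x - pos z y)).

Lemma spaced_mono z r r' : r' <= r -> subrel (spaced z r) (spaced z r').
Proof.
move=> rr x y /andP[yx /implyP h]; rewrite /spaced yx /=; apply/implyP => /h.
exact: le_trans.
Qed.

(** Deletion takes place at the smallest interacting gap: on either side the j-th interacting
    neighbour is then at least j such gaps away, which controls all other terms. *)
Lemma min_gap z r K : sorted (fun x y => y < x)%N K ->
  sorted (spaced z r) K \/
  exists A k s B, [/\ K = A ++ k :: s :: B, (k - s <= m)%N, pos z k - pos z s < r
    & sorted (spaced z (pos z k - pos z s)) K].
Proof.
elim: K => [|x [|y K] IH] /=; [by left|by left|].
move=> /andP[yx sK]; have {IH} := IH sK; rewrite -/(sorted _ (y :: K)).
have [xm|xm] := leqP (x - y) m; last first.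
  case=> [h|[A [k [s [B [e h1 h2 h3]]]]]].
    by left; rewrite h /spaced yx leqNgt xm.
  right; exists (x :: A), k, s, B; rewrite e; split=> //; rewrite -?e /=; move: h3 => /= h3.
  by rewrite h3 /spaced yx leqNgt xm.
have [gr|gr] := ltP (pos z x - pos z y) r; last first.
  case=> [h|[A [k [s [B [e h1 h2 h3]]]]]].
    by left; rewrite h /spaced yx gr implybT.
  right; exists (x :: A), k, s, B; rewrite e; split=> //; rewrite -?e /=; move: h3 => /= h3.
  by rewrite h3 /spaced yx (le_trans (ltW h2) gr) implybT.
case=> [h|[A [k [s [B [e h1 h2 h3]]]]]].
  right; exists [::], x, y, K; split=> //=.
  rewrite /spaced yx lexx implybT /=.
  exact: sub_path (spaced_mono (ltW gr)) _ _ h.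
have [h|h] := leP (pos z k - pos z s) (pos z x - pos z y).
  right; exists (x :: A), k, s, B; rewrite e; split=> //; rewrite -?e /=; move: h3 => /= h3.
  by rewrite h3 /spaced yx h implybT.
right; exists [::], x, y, K; split=> //=.
rewrite /spaced yx lexx implybT /=.
exact: sub_path (spaced_mono (ltW h)) _ _ h3.
Qed.

Lemma spaced_outward_left z r k s B : (s < k)%N -> path (spaced z r) s B ->
  path (fun x y => (k - y <= m)%N ==>
    ((k - x <= m)%N && (pos z k - pos z x + r <= pos z k - pos z y))) s B.
Proof.
elim: B s => //= q B IH s sk /andP[/andP[qs hq] pB].
rewrite IH// ?andbT; last exact: ltn_trans sk.
apply/implyP => kq; have kq' : (k - s <= m)%N by lia.
rewrite kq' /=; have /(implyP hq) : (s - q <= m)%N by lia.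
by move=> ?; lra.
Qed.

Lemma spaced_outward_right z r k s B : (k < s)%N ->
  path (fun x y => spaced z r y x) s B ->
  path (fun x y => (y - k <= m)%N ==>
    ((x - k <= m)%N && (pos z x - pos z k + r <= pos z y - pos z k))) s B.
Proof.
elim: B s => //= q B IH s ks /andP[/andP[sq hq] pB].
rewrite IH// ?andbT; last exact: ltn_trans sq.
apply/implyP => kq; have kq' : (s - k <= m)%N by lia.
rewrite kq' /=; have /(implyP hq) : (q - s <= m)%N by lia.
by move=> ?; lra.
Qed.

Variables (lb : R -> R) (vmin rhc zmin : R).
Hypothesis lb_ge0 : forall x, 0 < x -> 0 <= lb x.
Hypothesis lb_anti : forall x y, 0 < x -> x <= y -> lb y <= lb x.
Hypothesis rhc_ge0 : 0 <= rhc.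
Hypothesis f_ge_lb : forall x, rhc < x -> - lb x <= f x.
Hypothesis f_ge_vmin : forall x, rhc < x -> vmin <= f x.
Hypothesis vmin_le0 : vmin <= 0.
Hypothesis f_repulsive : forall r M, rhc < r -> r < zmin ->
  0 <= f r + vmin - 2 * \sum_(i < M) lb ((i + 2)%:R * r).

(** Distances grow by at least [r] per particle, so each further particle is compared with the next
    multiple of [r] through the antitone bound [lb]. Particles out of range contribute 0, which is
    above [- lb]. *)
Lemma outward_sum_ge (D : nat -> R) (near : pred nat) r cur L j : 0 < r ->
  (near cur -> j%:R * r <= D cur) ->
  path (fun x y => near y ==> [&& near x & D x + r <= D y]) cur L ->
  (forall q, q \in L -> rhc < D q) ->
  - \sum_(i < size L) lb ((i + j.+1)%:R * r) <=
  \sum_(q <- L) (if near q then f (D q) else 0).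
Proof.
move=> r0; elim: L cur j => [|q L IH] cur j hcur /=.
  by rewrite big_nil big_ord0 oppr0.
move=> /andP[hq hp] hD; rewrite big_cons big_ord_recl opprD add0n.
have hjq : near q -> j.+1%:R * r <= D q.
  move=> nq; move: hq; rewrite nq /= => /andP[nc]; apply: le_trans.
  by rewrite -natr1 mulrDl mul1r lerD2r hcur.
apply: lerD.
  case: ifP => nq; last by rewrite oppr_le0 lb_ge0// mulr_gt0.
  have Dq : rhc < D q by apply: hD; rewrite mem_head.
  apply: le_trans (f_ge_lb Dq); rewrite lerN2; apply: lb_anti; last exact: hjq.
  by rewrite mulr_gt0.
have := IH q j.+1 hjq hp (fun x xL => hD x (mem_behead (s := q :: L) xL)).
apply: le_trans; rewrite lerN2; apply: ler_sum => i _.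
by rewrite /bump /= -addSnnS.
Qed.

Section Config.
Variables (z : nat -> R) (n : nat).
Hypothesis z_gt : forall i, (i < n)%N -> rhc < z i.

Lemma pos_gt i j : (i < j)%N -> (j <= n)%N -> rhc < pos z j - pos z i.
Proof.
elim: j => // j IH; rewrite ltnS leq_eqVlt => /predU1P[->|ij] jn.
  by rewrite posS addrAC subrr add0r z_gt.
have := IH ij (ltnW jn); have := z_gt jn; have := rhc_ge0.
by rewrite posS => ? ? ?; lra.
Qed.

Lemma lb_sum_mono r M1 M2 : 0 < r -> (M1 <= M2)%N ->
  \sum_(i < M1) lb ((i + 2)%:R * r) <= \sum_(i < M2) lb ((i + 2)%:R * r).
Proof.
move=> r0 M12; rewrite (big_ord_widen M2 (fun i => lb ((i + 2)%:R * r)) M12).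
rewrite big_mkcond; apply: ler_sum => i _; case: ifP => // _.
by rewrite lb_ge0// mulr_gt0// ltr0n addn_gt0 orbT.
Qed.

(** The terms of particle [k] are nonnegative in total: the short gap gives [f r], the nearest
    neighbour on the other side at least [vmin], and the remaining ones on each side at least minus
    the sum of [lb] over the multiples of [r] from [2 * r] on. *)
Lemma remove_le A k s B : let r := pos z k - pos z s in
  sorted (spaced z r) (A ++ k :: s :: B) -> all (fun q => q <= n)%N (A ++ k :: s :: B) ->
  (k - s <= m)%N -> r < zmin ->
  list_energy z (A ++ s :: B) <= list_energy z (A ++ k :: s :: B).
Proof.
move=> r so al ksm rz; rewrite (list_energy_cat z A k) -addrA lerDl.
have trans : transitive (fun x y => y < x)%N by move=> ? ? ? h1 h2; exact: ltn_trans h2 h1.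
have kn : (k <= n)%N by move: al; rewrite all_cat /= => /and3P[].
have soB : path (spaced z r) k (s :: B).
  by move: so => /cat_sorted2[].
have [sk pB] : (s < k)%N /\ path (spaced z r) s B by move: soB => /= /andP[/andP[]].
have r0 : rhc < r := pos_gt sk kn.
have r_gt0 : 0 < r := le_lt_trans rhc_ge0 r0.
have ltB : all (fun q => q < k)%N (s :: B).
  apply: (order_path_min trans); apply: sub_path soB.
  by move=> x y /andP[].
have left_ge : - \sum_(i < size B) lb ((i + 2)%:R * r) + f r <=
    \sum_(q <- s :: B) pair_energy z q k.
  rewrite big_cons addrC lerD//; first by rewrite /pair_energy ksm.
  apply: (@outward_sum_ge (fun q => pos z k - pos z q) (fun q => k - q <= m)%N r s B 1) => //.
  - by move=> _; rewrite mul1r.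
  - exact: spaced_outward_left.
  - move=> q qB; apply: pos_gt => //; move/allP: ltB => /(_ q); apply.
    by rewrite inE qB orbT.
have right_ge : vmin - \sum_(i < size A) lb ((i + 2)%:R * r) <=
    \sum_(q <- A) pair_energy z k q.
  have : sorted (spaced z r) (rcons A k).
    by move: so; rewrite -cat_rcons => /cat_sorted2[].
  have alA : all (fun q => q <= n)%N A by move: al; rewrite all_cat => /andP[].
  (* If no particle lies beyond [k], the bound [vmin] still holds because it is nonpositive. *)
  case/lastP: A alA {so al} => [|A k'].
    by move=> _ _; rewrite big_nil big_ord0 subr0.
  rewrite all_rcons => /andP[k'n alA] soA.
  have {}soA : path (fun x y => spaced z r y x) k (k' :: rev A).
    by move: soA; rewrite -rev_sorted !rev_rcons.
  have gtA : all (fun q => k < q)%N (k' :: rev A).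
    apply: (order_path_min ltn_trans).
    by apply: sub_path soA => x y /andP[].
  have kk' : (k < k')%N by move: gtA => /= /andP[].
  rewrite (perm_big (k' :: rev A)); last first.
    by rewrite perm_rcons perm_cons perm_sym perm_rev.
  rewrite big_cons; apply: lerD.
    rewrite /pair_energy; case: ifP => _; last exact: vmin_le0.
    by apply: f_ge_vmin; exact: pos_gt.
  apply: (@le_trans _ _ (- \sum_(i < size (rev A)) lb ((i + 2)%:R * r))).
    rewrite lerN2 size_rev size_rcons; exact: lb_sum_mono.
  apply: (@outward_sum_ge (fun q => pos z q - pos z k) (fun q => q - k <= m)%N r k' (rev A) 1) => //.
  - rewrite mul1r => nk; move: soA => /= /andP[/andP[_ /implyP]] h _; exact: h.
  - by apply: spaced_outward_right => //; move: soA => /= /andP[].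
  - move=> q qA; apply: pos_gt; first by move/allP: gtA => /(_ q); apply; rewrite inE qA orbT.
    by move/allP: alA => /(_ q); rewrite -mem_rev; apply.
have := f_repulsive (maxn (size A) (size B)) r0 rz.
have := lb_sum_mono r_gt0 (leq_maxl (size A) (size B)).
have := lb_sum_mono r_gt0 (leq_maxr (size A) (size B)).
move: left_ge right_ge; clear.
move: (\sum_(q <- s :: B) _) (\sum_(q <- A) _) (\sum_(i < size A) _)
  (\sum_(i < size B) _) (\sum_(i < maxn _ _) _) => ? ? ? ? ?; lra.
Qed.

(** Each deletion takes the upper particle of the close pair, so particle 0, the last of the list,
    survives. *)
Lemma prune K : sorted (fun x y => y < x)%N K -> all (fun q => q <= n)%N K -> last 1%N K = 0%N ->
  exists K', [/\ sorted (spaced z zmin) K', all (fun q => q <= n)%N K', last 1%N K' = 0%N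
    & list_energy z K' <= list_energy z K].
Proof.
have [N] := ubnP (size K); elim: N K => // N IH K; rewrite ltnS => KN so al la.
have [h|[A [k [s [B [e ksm gz so']]]]]] := min_gap z zmin so.
  by exists K; split.
rewrite e in so' al la so KN *.
have sub : subseq (A ++ s :: B) (A ++ k :: s :: B).
  by rewrite subseq_cat2l subseq_cons.
have [||||K' [h1 h2 h3 h4]] := IH (A ++ s :: B).
- by move: KN; rewrite !size_cat /= !addnS.
- apply: (subseq_sorted _ sub so) => ? ? ? h1 h2; exact: ltn_trans h2 h1.
- apply/allP => q /(mem_subseq sub) qK; exact: (allP al).
- by move: la; rewrite !last_cat.
exists K'; split=> //; apply: le_trans h4 _; exact: remove_le.
Qed.

End Config.
End Chain.

(** * Lower bound on the energy *)

Section EnergyLower.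
Variables (R : realType) (f : R -> R) (d : nat).
Local Notation m := d.+1.
Variables (p a e0 zmin delta kap p' th mu : R) (phi : nat -> R).

Definition energy_per (y : R) : R := p * y + \sum_(1 <= c < m.+1) f (c%:R * y).

Hypothesis f_le0 : forall c y, (2 <= c <= m)%N -> zmin <= y -> f (c%:R * y) <= 0.
Hypothesis f_jensen : forall c (y : nat -> R), (2 <= c <= m)%N ->
  (forall j, (j < c)%N -> zmin <= y j) ->
  c%:R^-1 * \sum_(j < c) f (c%:R * y j) <= f (\sum_(j < c) y j).
Hypothesis f_jensen_near : forall c (w : nat -> R), (2 <= c <= m)%N ->
  (forall j, (j < c)%N -> `|w j| <= delta) ->
  c%:R^-1 * \sum_(j < c) f (c%:R * (w j + a)) + (1 - th) / 2 * (- phi c * deficit c w)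
    <= f (\sum_(j < c) (w j + a)).
Hypothesis per_near : forall y, `|y - a| <= delta ->
  e0 + (1 - th) / 2 * (mu * (y - a) ^+ 2) <= energy_per y.
Hypothesis per_far : forall y, zmin <= y -> delta < `|y - a| ->
  e0 + kap + p' * y <= energy_per y.
Hypothesis per_two : forall y, zmin <= y -> 2 * (e0 + kap) + p' * y <= energy_per y.
Hypothesis e0_kap : e0 + kap <= 0.
Hypothesis p'_le : p' <= p.

Variable z : nat -> R.

Fixpoint chain_state (B : nat -> bool) k :=
  if k is k'.+1 then
    if B k' then reset_state R else extend_state a (chain_state B k') (z k')
  else reset_state R.

Lemma eq_chain_state B B' k : (forall i, (i < k)%N -> B i = B' i) ->
  chain_state B k = chain_state B' k.
Proof.
elim: k => //= k IH h; rewrite h// IH// => i ik.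
by apply: h; exact: ltn_trans ik _.
Qed.

(** A bad spacing pays the energy gap [kap] and keeps a part [p' * z i] of the pressure term, which
    makes its Boltzmann weight integrable. *)
Definition spacing_bound (B : nat -> bool) i : R :=
  if B i then kap + p' * z i
  else (1 - th) / 2 * stage_cost d (stage_matrix phi mu m) mu a (chain_state B i) (z i).

(* Neighbours that are too far apart in the list do not interact: their gap is
   flagged [false] and contributes nothing. *)
Fixpoint gaps (K : seq nat) : nat -> R * bool :=
  if K is k :: K' then
    if K' is s :: _ then push (pos z k - pos z s, (k - s <= m)%N) (gaps K')
    else fun=> (0, false)
  else fun=> (0, false).

Definition share c (q : R * bool) : R := if q.2 then f (c%:R * q.1) else 0.

Lemma gaps_sum k K c : (c <= size K)%N ->
  \sum_(j < c) (gaps (k :: K) j).1 = pos z k - pos z (nth 0%N (k :: K) c).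
Proof.
elim: K k c => [|s K IH] k [|c] //; rewrite ?big_ord0 ?subrr// ltnS => cK.
by rewrite big_ord_recl /= IH//=; ring.
Qed.

Lemma gaps_ge K j : sorted (spaced m z zmin) K -> (gaps K j).2 -> zmin <= (gaps K j).1.
Proof.
elim: K j => [|k [|s K] IH] j //= /andP[/andP[_ /implyP h] hp].
by case: j => [|j] //=; exact: IH.
Qed.

Lemma pos_sub s k : (s <= k)%N -> pos z k - pos z s = \sum_(s <= i < k) z i.
Proof.
elim: k => [|k IH]; first by rewrite leqn0 => /eqP ->; rewrite subrr big_geq.
rewrite leq_eqVlt => /predU1P[->|sk]; first by rewrite subrr big_geq.
by rewrite big_nat_recr//= -IH// posS addrAC.
Qed.

Lemma sorted_desc K : sorted (spaced m z zmin) K -> sorted (fun x y => y < x)%N K.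
Proof. by apply: sub_sorted => x y /andP[]. Qed.

Lemma nth_desc k K c : sorted (fun x y => y < x)%N (k :: K) -> (c <= size K)%N ->
  (nth 0 (k :: K) c + c <= k)%N.
Proof.
elim: K k c => [|s K IH] k [|c] //=; rewrite ?addn0// ltnS => /andP[sk pK] cK.
by have := IH s c pK cK; rewrite /=; lia.
Qed.

Lemma gaps_flag k K c j : sorted (fun x y => y < x)%N (k :: K) -> (c <= size K)%N ->
  (k - nth 0 (k :: K) c <= m)%N -> (j < c)%N -> (gaps (k :: K) j).2.
Proof.
elim: K k c j => [|s K IH] k [|c] j //=; rewrite ltnS => /andP[sk pK] cK km jc.
have := nth_desc pK cK; case: j jc => [|j] jc /= h; first lia.
by apply: (IH s c) => //; lia.
Qed.

Lemma sum_ord_widen (F : nat -> R) n N : (n <= N)%N ->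
  (forall j, (n <= j)%N -> F j = 0) -> \sum_(j < n) F j = \sum_(j < N) F j.
Proof.
move=> nN F0; rewrite (big_ord_widen N F nN) big_mkcond; apply: eq_bigr => j _.
by case: ltnP => // /F0.
Qed.

(** The c-th predecessor in the list has a label smaller by at least c, so only the first m of them
    can interact with [k]. *)
Lemma new_particle_ge k K (r : nat -> R) : sorted (fun x y => y < x)%N (k :: K) ->
  (forall c, (1 <= c <= m)%N ->
     r c <= if (c <= size K)%N && (k - nth 0 (k :: K) c <= m)%N
            then f (pos z k - pos z (nth 0%N (k :: K) c)) else 0) ->
  \sum_(1 <= c < m.+1) r c <= \sum_(i <- K) pair_energy f m z i k.
Proof.
move=> sK hr.
pose F j := if (j < size K)%N then pair_energy f m z (nth 0%N K j) k else 0.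
have -> : \sum_(i <- K) pair_energy f m z i k = \sum_(j < m) F j.
  rewrite (big_nth 0%N) big_mkord.
  rewrite (eq_bigr (fun j : 'I_(size K) => F j)); last by move=> j _; rewrite /F ltn_ord.
  rewrite (sum_ord_widen (F := F) (leq_maxl (size K) m)) => [|j]; last by rewrite leqNgt /F => /negbTE ->.
  rewrite -(sum_ord_widen (F := F) (leq_maxr (size K) m))// => j mj; rewrite /F /pair_energy.
  case: ltnP => // jK; have /= := nth_desc (c := j.+1) sK jK.
  by move=> h; rewrite ifN// -ltnNge; lia.
rewrite big_add1 big_mkord; apply: ler_sum => j _; apply: le_trans (hr j.+1 _) _.
  by rewrite /= ltn_ord.
by rewrite /F /pair_energy /=; case: ltnP => // _; case: ifP.
Qed.

(** Particles are added from the bottom. Besides the bound, the induction carries that a run of good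
    steps contains no deleted labels and that its gaps are exactly the recorded deviations;
    otherwise the near form of Jensen's inequality could not be applied to the recorded history. *)
Lemma list_energy_ge k K : sorted (spaced m z zmin) (k :: K) -> last 1%N (k :: K) = 0%N ->
  (forall i, (i < k)%N -> 0 < z i) ->
  exists B, let s := chain_state B k in
  [/\ \sum_(i < k) (e0 + spacing_bound B i) <=
        list_energy f m z (k :: K) + p * pos z k
        + \sum_(2 <= c < m.+1) c%:R^-1 * potential (share c) c (gaps (k :: K)),
      forall j, (j <= s.1)%N -> [/\ (j <= size K)%N, (j <= k)%N & nth 0%N (k :: K) j = (k - j)%N]
    & forall j, (j < s.1)%N -> gaps (k :: K) j = (s.2 j + a, true) /\ `|s.2 j| <= delta].
Proof.
elim: K k => [|s K IH] k so la zpos.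
  exists (fun=> true); move: la zpos => /= -> _; split=> //.
  - rewrite big_ord0 /pos big_nil big_ord0 mulr0 !add0r big1// => c _.
    by rewrite potential_const ?mulr0.
  - by move=> j; rewrite leqn0 => /eqP ->.
have [sk hgap soK] : [/\ (s < k)%N, (k - s <= m)%N ==> (zmin <= pos z k - pos z s)
    & sorted (spaced m z zmin) (s :: K)].
  by move: so => /= /andP[/andP[]].
have [B [hE hN hG]] := IH s soK la (fun i ik => zpos i (ltn_trans ik sk)).
have dK := sorted_desc so.
set y := pos z k - pos z s in hgap.
set X := gaps (s :: K) in hE hG *; set X' := gaps (k :: s :: K).
have X'E : X' = push (y, (k - s <= m)%N) X by [].
set S := chain_state B s in hN hG *.
(* A gap across deleted particles is never good, so a good run consists of true spacings. *)
pose good := (k == s.+1) && (`|z s - a| <= delta).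
pose w := push (y - a) S.2.
(* The gain in Jensen's inequality needs all m spacings of the window near [a], that is d earlier
   good steps. *)
pose J c := if good && (d <= S.1)%N then (1 - th) / 2 * (- phi c * deficit c w) else 0.
have y_good : good -> [/\ k = s.+1, y = z s & `|y - a| <= delta].
  case/andP => /eqP ks h; have -> : y = z s by rewrite /y ks posS addrAC subrr add0r.
  by [].
have share_le0 c j : (2 <= c <= m)%N -> share c (X' j) <= 0.
  move=> cm; rewrite /share; case: ifP => // h.
  by apply: f_le0 => //; exact: gaps_ge h.
have cost : \sum_(1 <= c < m.+1) (if c == 1%N then share 1 (X' 0%N)
      else c%:R^-1 * \sum_(j < c) share c (X' j) + J c)
    <= \sum_(i <- s :: K) pair_energy f m z i k.
  apply: new_particle_ge => // c /andP[c0 cm].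
  have [->|c1] := eqVneq c 1%N.
    by rewrite X'E /= /share /=; case: ifP => //; rewrite mul1r.
  have c2 : (2 <= c <= m)%N by rewrite cm andbT; move: c0 c1; case: c {cm} => [|[]].
  case: ifPn => [/andP[cK near]|far].
    have flag j : (j < c)%N -> (X' j).2 := gaps_flag dK cK near.
    rewrite -gaps_sum// -/X'.
    rewrite (eq_bigr (fun j : 'I_c => f (c%:R * (X' j).1))); last first.
      by move=> j _; rewrite /share flag.
    rewrite /J; case: ifPn => [/andP[gd dS]|_]; last first.
      rewrite addr0; apply: (f_jensen c2 (y := fun j => (X' j).1)) => j jc.
      by apply: gaps_ge => //; exact: flag.
    have wE j : (j < c)%N -> (X' j).1 = w j + a /\ `|w j| <= delta.
      have [_ _ yd] := y_good gd.
      case: j => [|j] jc; first by rewrite X'E /= subrK.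
      have jS : (j < S.1)%N.
        by move: c2 jc dS => /andP[_]; clear; lia.
      by have [Xj ?] := hG j jS; rewrite X'E /= Xj.
    rewrite (eq_bigr (fun j : 'I_c => f (c%:R * (w j + a)))); last first.
      by move=> j _; have [-> _] := wE j (ltn_ord j).
    rewrite [X in _ <= f X](eq_bigr (fun j : 'I_c => w j + a)); last first.
      by move=> j _; have [-> _] := wE j (ltn_ord j).
    by apply: f_jensen_near => // j jc; have [] := wE j jc.
  rewrite /J ifN ?addr0.
    by rewrite mulr_ge0_le0 ?invr_ge0//; apply: sumr_le0 => j _; exact: share_le0.
  (* After d good steps the c-th predecessor exists and has label [k - c], so it is in range. *)
  apply: contra far => /andP[/y_good[ks _ _] dS].
  case: c c0 cm {c1 c2} => // c _ cm /=.
  have [h1 h2 ->] := hN c (leq_trans (cm : (c <= d)%N) dS).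
  by rewrite ltnS h1 /= ks; move: cm h2; clear; lia.
pose gd y := p * y + share 1 (y, (k - s <= m)%N) + \sum_(2 <= c < m.+1) share c (y, (k - s <= m)%N).
(* [sum_window] charges all shares of the gap [y] to the present step: up to telescoping potentials,
   the energy of the step depends on [y] alone. *)
have step : list_energy f m z (s :: K) + p * pos z s
      + \sum_(2 <= c < m.+1) c%:R^-1 * potential (share c) c X
      + (gd y + \sum_(2 <= c < m.+1) J c)
    <= list_energy f m z (k :: s :: K) + p * pos z k
      + \sum_(2 <= c < m.+1) c%:R^-1 * potential (share c) c X'.
  have -> : \sum_(2 <= c < m.+1) c%:R^-1 * potential (share c) c X' =
    \sum_(2 <= c < m.+1) c%:R^-1 * potential (share c) c X
    + \sum_(2 <= c < m.+1) share c (y, (k - s <= m)%N)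
    - \sum_(2 <= c < m.+1) c%:R^-1 * \sum_(j < c) share c (X' j).
    rewrite -big_split -sumrB /= big_nat_cond [RHS]big_nat_cond.
    apply: eq_bigr => c /andP[/andP[c2 _] _]; rewrite X'E sum_window.
    by field; rewrite pnatr_eq0; case: c c2.
  have := cost; rewrite big_nat_recl//= X'E /= -X'E.
  rewrite (_ : \sum_(1 <= i < m) _ = \sum_(2 <= c < m.+1)
      (c%:R^-1 * \sum_(j < c) share c (X' j) + J c)); last first.
    by rewrite [RHS]big_add1 /=; apply: eq_big_nat => -[|i].
  rewrite big_split /= /gd.
  have -> : p * pos z k = p * pos z s + p * y by rewrite /y; ring.
  move: (\sum_(i <- s :: K) _) (list_energy f m z (s :: K)) => c1 c2.
  move: (share 1 _) => c3.
  move: (\sum_(2 <= c < m.+1) c%:R^-1 * potential (share c) c X) => c4.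
  move: (\sum_(2 <= c < m.+1) c%:R^-1 * \sum_(j < c) share c (X' j)) => c5.
  move: (\sum_(2 <= c < m.+1) J c) (\sum_(2 <= c < m.+1) share c _) => c6 c7; lra.
have gdE : (k - s <= m)%N -> gd y = energy_per y.
  move=> h; rewrite /gd /energy_per [in RHS]big_ltn// /share /= h addrA.
  by congr (_ + _).
(* All spacings inside a gap that is not good become bad together. *)
pose B' i := if (i < s)%N then B i else ~~ good.
have BB' i : (i < s)%N -> B' i = B i by rewrite /B' => ->.
have SE : chain_state B' s = S by apply: eq_chain_state => i /BB' ->.
have lowE : \sum_(i < s) (e0 + spacing_bound B' i) = \sum_(i < s) (e0 + spacing_bound B i).
  apply: eq_bigr => i _; rewrite /spacing_bound BB'// (eq_chain_state (B' := B))// => j ji.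
  by apply: BB'; exact: ltn_trans ji _.
exists B' => /=.
have [gd_t|gd_f] := boolP good.
  have [ks yz yd] := y_good gd_t.
  have ks1 : (k - s <= m)%N by rewrite ks subSnn.
  have B's : B' s = false by rewrite /B' ltnn gd_t.
  have S'E : chain_state B' k = extend_state a S (z s) by rewrite ks /= B's SE.
  rewrite S'E; split.
  - apply: le_trans step; rewrite ks big_ord_recr /= lowE lerD// gdE//.
    rewrite /spacing_bound B's SE /stage_cost -yz.
    apply: le_trans (lerD (per_near yd) (lexx (\sum_(2 <= c < m.+1) J c))).
    rewrite -(addrA e0) lerD2l /J gd_t.
    case: ifPn => dS /=; last by rewrite big1 ?addr0.
    rewrite stage_matrixE// -/w.
    rewrite (_ : \sum_(2 <= c < m.+1) (1 - th) / 2 * (- phi c * deficit c w) =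
        - ((1 - th) / 2 * \sum_(2 <= c < m.+1) phi c * deficit c w)) ?mulrBr//.
    by rewrite mulr_sumr -sumrN; apply: eq_bigr => c _; rewrite mulNr mulrN.
  - move=> [|j] /=; first by rewrite subn0.
    rewrite ltnS => /hN[h1 h2 ->]; rewrite !ltnS ks; split=> //.
  - move=> [|j]; rewrite -/X' X'E ks1 /=; first by rewrite -yz subrK.
    by rewrite ltnS => /hG.
have S'E : chain_state B' k = reset_state R.
  have [k' ke] : exists k', k = k'.+1 by exists k.-1; rewrite prednK// (leq_trans _ sk).
  rewrite {1}ke /=; suff -> : B' k' = true by [].
  by rewrite /B' ifN ?gd_f// -leqNgt -ltnS -ke.
rewrite S'E; split=> //; last by move=> j; rewrite leqn0 => /eqP ->; rewrite subn0.
apply: le_trans step.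
rewrite -(big_mkord xpredT (fun i => e0 + spacing_bound B' i)) (big_cat_nat (n := s))//=; last exact: ltnW.
rewrite big_mkord lowE lerD//.
rewrite (eq_big_nat _ _ (F2 := fun i => e0 + kap + p' * z i)); last first.
  by move=> i /andP[si _]; rewrite /spacing_bound /B' ltnNge si /= gd_f addrA.
rewrite big_split /= sumr_const_nat -mulr_sumr.
rewrite -pos_sub ?(ltnW sk)// -/y.
have J0 : \sum_(2 <= c < m.+1) J c = 0 by rewrite big1// => c _; rewrite /J (negbTE gd_f).
rewrite J0 addr0.
have y_gt0 : 0 <= y.
  rewrite /y pos_sub ?(ltnW sk)// big_nat_cond sumr_ge0// => i /andP[/andP[_ ik] _].
  by rewrite ltW// zpos.
(* Since [e0 + kap <= 0], what pays for one spacing pays for any larger number of them. *)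
have mulk n : (1 <= n)%N -> (e0 + kap) *+ n <= e0 + kap.
  by case: n => // n _; rewrite mulrS gerDl mulrn_wle0.
have [near|far] := leqP (k - s) m; last first.
  rewrite /gd leqNgt far /share /= big1// !addr0.
  have := ler_wpM2r y_gt0 p'_le; have := @mulrn_wle0 _ (e0 + kap) (k - s) e0_kap; lra.
have yz : zmin <= y := implyP hgap near.
rewrite gdE//; have [ks|ks] := eqVneq k s.+1.
  have yE : y = z s by rewrite /y ks posS addrAC subrr add0r.
  rewrite (_ : (k - s)%N = 1%N) ?ks ?subSnn// mulr1n; apply: per_far => //.
  by move: gd_f; rewrite /good ks eqxx /= -ltNge yE.
(* At least two spacings are merged: [per_two] pays for two of them, the others cost nothing. *)
apply: le_trans (per_two yz); rewrite lerD2r.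
have [n ->] : exists n, (k - s)%N = n.+2.
  by exists (k - s).-2; move: ks sk => /eqP; clear; lia.
by rewrite mulrSr mulrSr mulr_natl mulr2n -[leRHS]add0r -addrA lerD// mulrn_wle0.
Qed.

Variables (lb : R -> R) (vmin rhc : R).
Hypothesis lb_ge0 : forall x, 0 < x -> 0 <= lb x.
Hypothesis lb_anti : forall x y, 0 < x -> x <= y -> lb y <= lb x.
Hypothesis rhc_ge0 : 0 <= rhc.
Hypothesis f_ge_lb : forall x, rhc < x -> - lb x <= f x.
Hypothesis f_ge_vmin : forall x, rhc < x -> vmin <= f x.
Hypothesis vmin_le0 : vmin <= 0.
Hypothesis f_repulsive : forall r M, rhc < r -> r < zmin ->
  0 <= f r + vmin - 2 * \sum_(i < M) lb ((i + 2)%:R * r).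

Lemma chain_energy_lower n : (forall i, (i < n)%N -> rhc < z i) ->
  exists B, \sum_(i < n) (e0 + spacing_bound B i) <=
    list_energy f m z (particles n) + p * pos z n.
Proof.
move=> z_gt.
have [|||[|k K] [soK alK laK EK]] := @prune _ _ m _ _ _ _ lb_ge0 lb_anti rhc_ge0 f_ge_lb
   f_ge_vmin vmin_le0 f_repulsive _ _ z_gt (particles n) => //.
- by rewrite rev_sorted; exact: iota_ltn_sorted.
- by apply/allP => q; rewrite mem_rev mem_iota add0n ltnS.
- by rewrite /particles /= rev_cons last_rcons.
have kn : (k <= n)%N by move: alK => /= /andP[].
have z_pos i : (i < n)%N -> 0 < z i by move=> /z_gt; exact: le_lt_trans.
have [B [hE _ _]] := list_energy_ge soK laK (fun i ik => z_pos i (leq_trans ik kn)).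
(* The spacings above the last surviving particle are counted as bad; pressure alone pays for
   them. *)
exists (fun i => if (i < k)%N then B i else true).
apply: (@le_trans _ _ (\sum_(i < k) (e0 + spacing_bound B i) + p * (pos z n - pos z k))).
  rewrite -(big_mkord xpredT (fun i => e0 + spacing_bound _ i)) (big_cat_nat (n := k))//=.
  rewrite big_mkord lerD//.
    rewrite le_eqVlt; apply/orP; left; apply/eqP; apply: eq_bigr => i _.
    rewrite /spacing_bound ltn_ord (eq_chain_state (B' := B))// => j ji.
    by rewrite (ltn_trans ji).
  rewrite pos_sub// mulr_sumr big_nat_cond [leRHS]big_nat_cond.
  apply: ler_sum => i /andP[/andP[ki i_n] _]; rewrite /spacing_bound ltnNge ki /= addrA.
  have := e0_kap; have := ler_wpM2r (ltW (z_pos i i_n)) p'_le; lra.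
(* The telescoped potential at the top end has the favourable sign, because bonds over at least two
   gaps are nonpositive. *)
have pot_le0 : \sum_(2 <= c < m.+1) c%:R^-1 * potential (share c) c (gaps (k :: K)) <= 0.
  rewrite big_nat_cond; apply: sumr_le0 => c /andP[cm _].
  rewrite mulr_ge0_le0 ?invr_ge0//; apply: potential_le0 => j _.
  by rewrite /share; case: ifP => // h; apply: f_le0 => //; exact: gaps_ge h.
by rewrite mulrBr; lra.
Qed.

End EnergyLower.

(** * Second-order estimates *)

Section SecondOrder.
Variable R : realType.

Lemma mean_value (g g' : R -> R) (lo hi x y : R) :
  (forall t, lo <= t <= hi -> is_derive t 1 g (g' t)) ->
  lo <= x <= hi -> lo <= y <= hi ->
  exists c, [/\ lo <= c <= hi, g y - g x = g' c * (y - x) & 0 <= (c - x) * (y - x)].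
Proof.
move=> dg /andP[lx xh] /andP[ly yh].
have cont u w : lo <= u -> w <= hi -> {within `[u, w], continuous g}.
  move=> lu wh; apply: derivable_within_continuous => t; rewrite in_itv/= => /andP[ut tw].
  by have [] := dg t; rewrite ?(le_trans lu ut) ?(le_trans tw wh).
have inside u w t : lo <= u -> w <= hi -> t \in `]u, w[ -> lo <= t <= hi.
  move=> lu wh; rewrite in_itv/= => /andP[ut tw].
  by rewrite (ltW (le_lt_trans lu ut)) (ltW (lt_le_trans tw wh)).
have [xy|yx|<-] := ltgtP x y.
- have [c cxy e] := MVT xy (fun t tI => dg t (inside _ _ _ lx yh tI)) (cont _ _ lx yh).
  exists c; split=> //; first exact: inside cxy.
  by move: cxy; rewrite in_itv/= => /andP[xc cy]; rewrite mulr_ge0// subr_ge0 ltW.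
- have [c cxy e] := MVT yx (fun t tI => dg t (inside _ _ _ ly xh tI)) (cont _ _ ly xh).
  exists c; split; first exact: inside cxy.
    by rewrite -[LHS]opprB e -mulrN opprB.
  by move: cxy; rewrite in_itv/= => /andP[xc cy]; rewrite mulr_le0// subr_le0 ltW.
- by exists x; rewrite lx xh !subrr !mulr0; split.
Qed.

Variables (g g' g'' : R -> R) (lo hi : R).
Hypothesis dg : forall t, lo <= t <= hi -> is_derive t 1 g (g' t).
Hypothesis dg' : forall t, lo <= t <= hi -> is_derive t 1 g' (g'' t).

(** The mean value theorem, applied twice to the difference between a parabola and [g]. With the
    remainder in the form [(M - g'' c) * r], [r >= 0], either sign of the bound follows. *)
Lemma second_order (x y : R) : lo <= x <= hi -> lo <= y <= hi ->
  forall M : R, exists2 c, lo <= c <= hi & exists2 r, 0 <= r &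
    g x + g' x * (y - x) + M / 2 * (y - x) ^+ 2 - g y = (M - g'' c) * r.
Proof.
move=> xI yI M.
pose h t := g x + g' x * (t - x) + M / 2 * (t - x) ^+ 2 - g t.
pose h' t := g' x + M * (t - x) - g' t.
have dh t : lo <= t <= hi -> is_derive t 1 h (h' t).
  move=> /dg dgt; apply: is_derive_eq.
  rewrite /h' /= -![_ *: _]/(_ * _) /=.
  rewrite !(mulr1, mulr0, addr0, subr0, add0r, scale0r, scaler0).
  by rewrite mul1r; field.
have [c [cI hc hs]] := mean_value dh xI yI.
have dh' t : lo <= t <= hi -> is_derive t 1 h' (M - g'' t).
  move=> /dg' dgt; apply: is_derive_eq.
  rewrite -![_ *: _]/(_ * _) /=.
  rewrite !(mulr1, mulr0, addr0, subr0, add0r, scale0r, scaler0); ring.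
have [e [eI he es]] := mean_value dh' xI cI.
exists e => //; exists ((c - x) * (y - x)) => //.
have hx : h x = 0 by rewrite /h subrr expr0n !mulr0 !addr0 subrr.
have h'x : h' x = 0 by rewrite /h' subrr mulr0 addr0 subrr.
by move: hc he; rewrite hx h'x !subr0 => hc he; rewrite -/(h y) hc he mulrA.
Qed.

Lemma second_order_le (M x y : R) : (forall t, lo <= t <= hi -> g'' t <= M) ->
  lo <= x <= hi -> lo <= y <= hi ->
  g y <= g x + g' x * (y - x) + M / 2 * (y - x) ^+ 2.
Proof.
move=> gM xI yI; have [c cI [r r0 e]] := second_order xI yI M.
by rewrite -subr_ge0 e mulr_ge0// subr_ge0 gM.
Qed.

Lemma second_order_ge (M x y : R) : (forall t, lo <= t <= hi -> M <= g'' t) ->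
  lo <= x <= hi -> lo <= y <= hi ->
  g x + g' x * (y - x) + M / 2 * (y - x) ^+ 2 <= g y.
Proof.
move=> gM xI yI; have [c cI [r r0 e]] := second_order xI yI M.
by rewrite -subr_le0 e mulr_le0_ge0// subr_le0 gM.
Qed.

(** Expansion at the mean [S] of the numbers [c * y j]: linear terms cancel, and the squares of
    [c * y j - S] add up to c times the deficit. *)
Lemma jensen_gap c (y : nat -> R) (M : R) : (0 < c)%N ->
  (forall t, lo <= t <= hi -> g'' t <= M) ->
  (forall j, (j < c)%N -> lo <= c%:R * y j <= hi) ->
  c%:R^-1 * \sum_(j < c) g (c%:R * y j) <= g (\sum_(j < c) y j) + M / 2 * deficit c y.
Proof.
move=> c0 gM yI; set S := \sum_(j < c) y j.
have cR : 0 < c%:R :> R by rewrite ltr0n.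
have cS : c%:R * S = \sum_(j < c) c%:R * y j by rewrite mulr_sumr.
have SI : lo <= S <= hi.
  have lc (u : R) : c%:R * u = \sum_(j < c) u by rewrite sumr_const card_ord mulr_natl.
  apply/andP; split; rewrite -(ler_pM2l cR) cS lc; apply: ler_sum => j _;
    by have /andP[] := yI j (ltn_ord j).
rewrite mulrC ler_pdivrMr//.
apply: (@le_trans _ _ (\sum_(j < c) (g S + g' S * (c%:R * y j - S)
   + M / 2 * (c%:R * y j - S) ^+ 2))).
  by apply: ler_sum => j _; apply: second_order_le => //; exact: yI.
rewrite !big_split /= sumr_const card_ord -!mulr_sumr sumrB -cS sumr_const card_ord.
rewrite -[S *+ c]mulr_natl subrr mulr0 addr0 mulrDl -[g S *+ c]mulr_natr lerD2l.
rewrite le_eqVlt; apply/orP; left; apply/eqP; rewrite -!mulrA; congr (_ * (_ * _)).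
rewrite (eq_bigr (fun j : 'I_c => c%:R ^+ 2 * y j ^+ 2 - 2 * S * (c%:R * y j) + S ^+ 2)).
  rewrite big_split sumrB /= sumr_const card_ord -!mulr_sumr -/S -[S ^+ 2 *+ c]mulr_natl /deficit -/S.
  by ring.
by move=> j _; ring.
Qed.

End SecondOrder.

Lemma deficit_shift (R : realType) c (w : nat -> R) (a : R) :
  deficit c (fun j => w j + a) = deficit c w.
Proof.
rewrite /deficit big_split /= sumr_const card_ord.
rewrite (eq_bigr (fun i : 'I_c => w i ^+ 2 + 2 * a * w i + a ^+ 2)); last by move=> i _; ring.
by rewrite !big_split /= sumr_const card_ord -mulr_sumr -[a *+ c]mulr_natl -[a ^+ 2 *+ c]mulr_natl; ring.
Qed.

(** * The pair potential and the energy per particle *)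

Section Potential.
Variables (R : realType) (v : R -> \bar R) (rhc zmin zmax alpha1 alpha2 s : R).
Hypothesis hV : assumptionV v rhc zmin zmax alpha1 alpha2 s.
Variables (d : nat) (p : R).
Hypothesis p_gt0 : 0 < p.
Hypothesis p_lt : p < pstar v zmax.
Local Notation m := d.+1.
Local Notation f := (vreal v).
Local Notation f1 := ((vreal v)^`()%classic).
Local Notation f2 := (d2 v).

Lemma v_fin z : rhc < z -> v z = (f z)%:E.
Proof. by move=> hz; have [h _ _ _] := V_C2 hV hz; rewrite /vreal fineK. Qed.

Lemma f_derive z : rhc < z -> is_derive z 1 f (f1 z).
Proof.
by move=> hz; have [_ h _ _] := V_C2 hV hz; rewrite derive1E; exact: derivableP.
Qed.

Lemma f1_derive z : rhc < z -> is_derive z 1 f1 (f2 z).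
Proof.
move=> hz; have [_ _ h _] := V_C2 hV hz; rewrite /d2 /derive1n /= derive1E; exact: derivableP.
Qed.

Lemma f2_continuous z : rhc < z -> {for z, continuous f2}.
Proof. by move=> hz; have [_ _ _] := V_C2 hV hz. Qed.

Let rhc_ge0 : 0 <= rhc. Proof. exact: V_hc_ge0 hV. Qed.
Let rz : rhc < zmin. Proof. exact: V_zmin_gt hV. Qed.
Let zz : zmin < zmax. Proof. exact: V_zmin_zmax hV. Qed.
Let zmin_gt0 : 0 < zmin. Proof. exact: le_lt_trans rhc_ge0 rz. Qed.
Let rzmax : rhc < zmax. Proof. exact: lt_trans rz zz. Qed.
Let zmax_gt0 : 0 < zmax. Proof. exact: lt_trans zmin_gt0 zz. Qed.

Lemma f_min z : rhc < z -> f zmax <= f z.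
Proof.
move=> hz; have [->//|ne] := eqVneq z zmax.
have := V_minimizer hV (le_lt_trans rhc_ge0 hz) ne.
by rewrite !v_fin// lte_fin => /ltW.
Qed.

Lemma f_zmax_lt0 : f zmax < 0.
Proof. by have := V_min_lt0 hV; rewrite v_fin// lte_fin. Qed.

Lemma f_incr x y : zmax < x -> x <= y -> f x <= f y.
Proof.
move=> zx xy; have zy := lt_le_trans zx xy.
have := V_increasing hV (x := x) (y := y).
by rewrite !v_fin ?(lt_trans rzmax)// lee_fin; apply=> //; rewrite in_itv/= andbT.
Qed.

Lemma f_le0 z : zmax < z -> f z <= 0.
Proof. by move=> h; have := V_le0 hV h; rewrite v_fin ?lee_fin// (lt_trans rzmax). Qed.

Lemma two_zmin c y : (2 <= c)%N -> zmin <= y -> 2 * zmin <= c%:R * y.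
Proof. by move=> c2 zy; apply: ler_pM => //; [exact: ltW|rewrite ler_nat]. Qed.

Lemma two_zmin_zmax c y : (2 <= c)%N -> zmin <= y -> zmax < c%:R * y.
Proof. by move=> c2 zy; apply: lt_le_trans (V_zmax_lt hV) (two_zmin c2 zy). Qed.

Definition lower_tail (z : R) : R := alpha1 * z `^ (- s).

Lemma lower_tail_ge0 z : 0 <= lower_tail z.
Proof. by rewrite mulr_ge0 ?powR_ge0// ltW// (V_alpha1 hV). Qed.

Lemma lower_tail_anti x y : 0 < x -> x <= y -> lower_tail y <= lower_tail x.
Proof.
move=> x0 xy; rewrite ler_wpM2l ?(ltW (V_alpha1 hV))// !powRN.
have s0 : 0 <= s by apply: le_trans (ltW (V_s hV)).
have y0 := lt_le_trans x0 xy.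
by rewrite lef_pV2 ?posrE ?powR_gt0// ge0_ler_powR ?nnegrE// ltW.
Qed.

Lemma f_ge_tail z : rhc < z -> - lower_tail z <= f z.
Proof.
by move=> hz; have := V_lower hV (le_lt_trans rhc_ge0 hz); rewrite v_fin ?lee_fin.
Qed.

Lemma f_repulsive r M : rhc < r -> r < zmin ->
  0 <= f r + f zmax - 2 * \sum_(i < M) lower_tail ((i + 2)%:R * r).
Proof.
move=> hr rzm; have r0 := le_lt_trans rhc_ge0 hr.
have := V_repulsive hV r0 rzm; rewrite !v_fin// -lee_fin => /ltW h.
apply: (le_trans h).
rewrite EFinB -EFinD leeB// (_ : (2 * _)%:E = (2 * alpha1)%:E *
    \sum_(2 <= n < M + 2) ((n%:R * r) `^ (- s))%:E)%E.
  apply: lee_wpmul2l; first by rewrite lee_fin mulr_ge0// ltW// (V_alpha1 hV).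
  by apply: nneseries_lim_ge => n _ _; rewrite lee_fin powR_ge0.
rewrite sumEFin -EFinM -mulrA; congr EFin; congr (_ * _).
by rewrite mulr_sumr (big_addn 0 (M + 2) 2) addnK big_mkord.
Qed.

Lemma f2_decr x y : zmin <= x -> x <= y -> y <= zmax -> f2 y <= f2 x.
Proof.
move=> zx xy yz; apply: (V_d2_decreasing hV) => //; rewrite in_itv/=.
  by rewrite zx (le_trans xy).
by rewrite (le_trans zx).
Qed.

Lemma f2_incr x y : 2 * zmin <= x -> x <= y -> f2 x <= f2 y.
Proof.
move=> zx xy; apply: (V_d2_increasing hV) => //; rewrite in_itv/= andbT//.
exact: le_trans xy.
Qed.

Let sum1 (F : nat -> R) : \sum_(1 <= c < m.+1) F c = F 1%N + \sum_(2 <= c < m.+1) F c.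
Proof. by rewrite big_ltn. Qed.

Definition convexity : R := f2 zmax + \sum_(2 <= c < m.+1) c%:R ^+ 2 * f2 (c%:R * zmin).

(** Cutting the series of the assumption at m discards only nonpositive terms. *)
Lemma convexity_gt0 : 0 < convexity.
Proof.
have h := V_d2_convex hV; rewrite -lte_fin; apply: (lt_le_trans h).
rewrite EFinD leeD2l// -sumEFin.
have t0 n : (2 <= n)%N -> ((n%:R ^+ 2 * f2 (n%:R * zmin))%:E <= 0)%E.
  by move=> n2; rewrite lee_fin mulr_ge0_le0 ?sqr_ge0// (V_d2_le0 hV)// two_zmin.
apply: lime_le; first by apply: is_cvg_npeseries => n n2 _; exact: t0.
near=> n; have mn : (m.+1 <= n)%N by near: n; exists m.+1.
rewrite (big_cat_nat (n := m.+1))//= geeDl// big_nat_cond; apply: sume_le0 => i.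
by move=> /andP[/andP[h1 _] _]; apply: t0; apply: leq_trans h1.
Unshelve. all: by end_near. Qed.

Local Notation per := (energy_per f d p).

Definition per1 (y : R) : R := p + \sum_(1 <= c < m.+1) c%:R * f1 (c%:R * y).
Definition per2 (y : R) : R := \sum_(1 <= c < m.+1) c%:R ^+ 2 * f2 (c%:R * y).

Lemma ge_mul_nat c y : (1 <= c)%N -> rhc < y -> rhc < c%:R * y.
Proof.
move=> c1 ry; apply: (lt_le_trans ry); rewrite ler_peMl ?ler1n//.
by rewrite ltW// (le_lt_trans rhc_ge0 ry).
Qed.

Lemma is_derive_sum_nat (F : nat -> R -> R) (dF : nat -> R) a b (x : R) :
  (forall c, (a <= c < b)%N -> is_derive x 1 (F c) (dF c)) ->
  is_derive x 1 (fun y => \sum_(a <= c < b) F c y) (\sum_(a <= c < b) dF c).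
Proof.
elim: b => [|b IH] h.
  rewrite big_geq// (_ : (fun _ => _) = cst 0); first exact: is_derive_cst.
  by apply/funext => y; rewrite big_geq.
have [ab|ab] := leqP a b; last first.
  rewrite big_geq// (_ : (fun _ => _) = cst 0); first exact: is_derive_cst.
  by apply/funext => y; rewrite big_geq.
rewrite big_nat_recr//= (_ : (fun _ => _) = (fun y => \sum_(a <= c < b) F c y) \+ F b).
  apply: is_deriveD; last by apply: h; rewrite ab /=.
  by apply: IH => c /andP[ac cb]; apply: h; rewrite ac ltnW.
by apply/funext => y; rewrite big_nat_recr.
Qed.

Lemma is_derive_dilation (g : R -> R) (g' : R) (c y : R) :
  is_derive (c * y) 1 g g' -> is_derive y 1 (fun y => g (c * y)) (c * g').
Proof.
move=> dg; have dl : is_derive y 1 (fun y => c * y) c.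
  by apply: is_derive_eq; rewrite -![_ *: _]/(_ * _) /= mulr1 ?mul0r ?mulr0 ?addr0 ?add0r.
by rewrite mulrC; exact: (is_derive1_comp dg dl).
Qed.

Lemma per_derive y : rhc < y -> is_derive y 1 per (per1 y).
Proof.
move=> ry; rewrite (_ : per = (fun y => p * y) \+
    (fun y => \sum_(1 <= c < m.+1) f (c%:R * y))); last by apply/funext.
apply: is_deriveD.
  by apply: is_derive_eq; rewrite -![_ *: _]/(_ * _) /= mulr1 ?mul0r ?mulr0 ?addr0 ?add0r.
apply: (is_derive_sum_nat (F := fun c y => f (c%:R * y))) => c /andP[c1 _].
by apply: is_derive_dilation; apply: f_derive; exact: ge_mul_nat.
Qed.

Lemma per1_derive y : rhc < y -> is_derive y 1 per1 (per2 y).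
Proof.
move=> ry; rewrite (_ : per1 = cst p \+
    (fun y => \sum_(1 <= c < m.+1) c%:R * f1 (c%:R * y))); last by apply/funext.
rewrite -[per2 y]add0r; apply: is_deriveD.
apply: (is_derive_sum_nat (F := fun c y => c%:R * f1 (c%:R * y))) => c /andP[c1 _].
rewrite expr2 -mulrA; apply: is_deriveZ.
by apply: is_derive_dilation; apply: f1_derive; exact: ge_mul_nat.
Qed.

Lemma per2_ge y : zmin <= y <= zmax -> convexity <= per2 y.
Proof.
move=> /andP[zy yz]; rewrite /convexity /per2 sum1; apply: lerD; first by rewrite expr1n !mul1r f2_decr.
apply: ler_sum_nat => c /andP[c2 _].
apply: ler_wpM2l; first exact: sqr_ge0.
apply: f2_incr; first exact: two_zmin c2 (lexx _).
exact: ler_wpM2l (ler0n _ c) _ _ zy.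
Qed.

(** The repulsion of the nearest neighbour outweighs the lower tail bound for all longer bonds. *)
Lemma per_small y : rhc < y -> y <= zmin -> 0 < per y.
Proof.
move=> ry yz.
have y0 : 0 < y := le_lt_trans rhc_ge0 ry.
have fz : - f zmax + \sum_(2 <= c < m.+1) lower_tail (c%:R * y) <= f y.
  have rep r : rhc < r -> r < zmin ->
      - f zmax + \sum_(2 <= c < m.+1) lower_tail (c%:R * r) <= f r.
    move=> hr rzm; have := f_repulsive d hr rzm.
    have -> : \sum_(2 <= c < m.+1) lower_tail (c%:R * r) = \sum_(i < d) lower_tail ((i + 2)%:R * r).
      by rewrite (big_addn 0 _ 2) big_mkord subSS subn1.
    have : 0 <= \sum_(i < d) lower_tail ((i + 2)%:R * r).
      by apply: sumr_ge0 => *; exact: lower_tail_ge0.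
    lra.
  have [yz'|yz'] := ltP y zmin; first exact: rep.
  (* The repulsion assumption is strict in [zmin]; the endpoint is reached by continuity from the
     left. *)
  have -> : y = zmin by apply/le_anti/andP.
  have fc : f x @[x --> zmin^'-] --> f zmin.
    apply: cvg_at_left_filter; apply: differentiable_continuous.
    by apply/derivable1_diffP; have [] := f_derive rz.
  rewrite -(cvg_lim (@norm_hausdorff _ _) fc); apply: limr_ge.
    by apply/cvg_ex; exists (f zmin).
  near=> x; have xr : rhc < x by near: x; apply: nbhs_left_gt.
  have xz : x < zmin by near: x; exact: nbhs_left_lt.
  apply: le_trans (rep x xr xz); rewrite lerD2l; apply: ler_sum_nat => c /andP[c2 _]; apply: lower_tail_anti.
    by rewrite mulr_gt0 ?ltr0n ?(leq_trans _ c2)// (le_lt_trans rhc_ge0 xr).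
  by rewrite ler_wpM2l// ltW.
rewrite /energy_per sum1 mul1r.
have : - \sum_(2 <= c < m.+1) lower_tail (c%:R * y) <= \sum_(2 <= c < m.+1) f (c%:R * y).
  rewrite -sumrN; apply: ler_sum_nat => c /andP[c2 _].
  by apply: f_ge_tail; apply: ge_mul_nat => //; exact: ltnW.
have := f_zmax_lt0; have := mulr_gt0 p_gt0 y0; lra.
Unshelve. all: by end_near. Qed.

(** This is where the bound [p < pstar] enters: the pressure term at [zmax] is smaller than the
    depth of the well. *)
Lemma per_zmax_lt0 : per zmax < 0.
Proof.
have : \sum_(2 <= c < m.+1) f (c%:R * zmax) <= 0.
  rewrite big_nat_cond; apply: sumr_le0 => c /andP[/andP[c2 _] _].
  by apply: f_le0; apply: two_zmin_zmax => //; exact: ltW.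
have := p_lt; rewrite /pstar ltr_pdivlMr// -/(f zmax) ltr0_norm ?f_zmax_lt0//.
by rewrite /energy_per sum1 mul1r; lra.
Qed.

Lemma per_large y : zmax <= y -> per zmax + p * (y - zmax) <= per y.
Proof.
move=> zy; rewrite /energy_per mulrBr addrAC -addrA [leLHS]addrC -!addrA.
have h : \sum_(1 <= c < m.+1) f (c%:R * zmax) <= \sum_(1 <= c < m.+1) f (c%:R * y).
  apply: ler_sum_nat => c /andP[c1 _].
  have cy : c%:R * zmax <= c%:R * y by rewrite ler_wpM2l.
  have [<-|c2] := eqVneq 1%N c; first by rewrite !mul1r f_min// (lt_le_trans rzmax).
  have {}c2 : (2 <= c)%N by rewrite ltn_neqAle c2 c1.
  by apply: f_incr cy; apply: two_zmin_zmax c2 (ltW zz).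
lra.
Qed.

Lemma f1_zmax : f1 zmax = 0.
Proof.
have : is_derive zmax 1 f 0.
  apply: (derive1_at_min (a := rhc) (b := zmax + 1)).
  - by rewrite (le_trans (ltW rzmax))// lerDl.
  - by move=> t; rewrite in_itv/= => /andP[rt _]; have [] := f_derive rt.
  - by rewrite in_itv/= rzmax ltrDl /=.
  - by move=> t; rewrite in_itv/= => /andP[rt _]; exact: f_min.
by move=> [_ <-]; rewrite derive1E.
Qed.

(** The derivative of [f] vanishes at [zmax], so shortening by [e] costs order [e ^+ 2] in the
    nearest-neighbour bond but gains [p * e], while the longer bonds do not increase. *)
Lemma per_min_lt_zmax : exists2 r, zmin < r < zmax & per r < per zmax.
Proof.
pose K := 1 + `|f2 zmin|.
have K0 : 0 < K by rewrite ltr_pwDl.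
pose e := Num.min ((zmax - zmin) / 2) (p / K).
have e0 : 0 < e by rewrite lt_min !divr_gt0// subr_gt0.
have e1 : e <= (zmax - zmin) / 2 by rewrite ge_min lexx.
have e2 : e * K <= p by rewrite -ler_pdivlMr// ge_min lexx orbT.
exists (zmax - e); first by have := zz; lra.
have zr : zmin <= zmax - e by have := zz; lra.
have fr : f (zmax - e) <= f zmax + K / 2 * e ^+ 2.
  have := @second_order_le _ f f1 f2 zmin zmax _ _ K zmax (zmax - e).
  rewrite f1_zmax mul0r addr0 (_ : zmax - e - zmax = - e); last by ring.
  rewrite sqrrN; apply.
  - by move=> t /andP[zt _]; apply: f_derive; exact: lt_le_trans zt.
  - by move=> t /andP[zt _]; apply: f1_derive; exact: lt_le_trans zt.
  - move=> t /andP[zt tz]; apply: le_trans (f2_decr (lexx _) zt tz) _.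
    by rewrite /K; have := ler_norm (f2 zmin); lra.
  - by rewrite lexx ltW.
  - by rewrite zr; lra.
rewrite /energy_per !sum1 !mul1r.
have h : \sum_(2 <= c < m.+1) f (c%:R * (zmax - e)) <= \sum_(2 <= c < m.+1) f (c%:R * zmax).
  apply: ler_sum_nat => c /andP[c2 _].
  by apply: f_incr; [exact: two_zmin_zmax|rewrite ler_wpM2l//; lra].
have pe : K / 2 * e ^+ 2 < p * e.
  by have := ler_wpM2r (ltW e0) e2; have := mulr_gt0 p_gt0 e0; rewrite expr2; lra.
lra.
Qed.

Lemma per_convex_ge x y : zmin <= x <= zmax -> zmin <= y <= zmax ->
  per x + per1 x * (y - x) + convexity / 2 * (y - x) ^+ 2 <= per y.
Proof.
have d1 t : zmin <= t <= zmax -> is_derive t 1 per (per1 t).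
  by move=> /andP[zt _]; apply: per_derive; exact: lt_le_trans zt.
have d2' t : zmin <= t <= zmax -> is_derive t 1 per1 (per2 t).
  by move=> /andP[zt _]; apply: per1_derive; exact: lt_le_trans zt.
exact: (@second_order_ge _ per per1 per2 zmin zmax d1 d2' convexity x y per2_ge).
Qed.

(** The value is positive at [zmin], negative at [zmax], and still lower somewhere to the left of
    [zmax], so a minimum is interior and convexity gives the quadratic bound. *)
Lemma per_minimizer : exists a, [/\ zmin < a < zmax, per1 a = 0, per a < 0 &
  forall y, zmin <= y <= zmax -> per a + convexity / 2 * (y - a) ^+ 2 <= per y].
Proof.
have pc : {within `[zmin, zmax], continuous per}.
  apply: derivable_within_continuous => t; rewrite in_itv/= => /andP[zt _].
  by have [] := per_derive (lt_le_trans rz zt).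
have [a aI amin] := EVT_min (ltW zz) pc.
move: aI; rewrite in_itv/= => /andP[za az].
have amin' t : zmin <= t <= zmax -> per a <= per t.
  by move=> tI; apply: amin; rewrite in_itv.
have a0 : per a < 0 by apply: le_lt_trans per_zmax_lt0; rewrite amin'// lexx ltW.
have za' : zmin < a.
  rewrite lt_neqAle za andbT; apply/eqP => e.
  by have := per_small rz (lexx _); rewrite e ltNge (ltW a0).
have az' : a < zmax.
  rewrite lt_neqAle az andbT; apply/eqP => e.
  have [r /andP[r1 r2] r3] := per_min_lt_zmax.
  by have := amin' r; rewrite e (ltW r1) (ltW r2) leNgt r3 => /(_ erefl).
have p0 : per1 a = 0.
  have da := per_derive (lt_trans rz za').
  have : is_derive a 1 per 0.
    apply: (derive1_at_min (a := zmin) (b := zmax)); first exact: ltW.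
    - by move=> t; rewrite in_itv/= => /andP[zt _]; have [] := per_derive (lt_trans rz zt).
    - by rewrite in_itv/= za' az'.
    - by move=> t; rewrite in_itv/= => /andP[zt tz]; apply: amin'; rewrite !ltW.
  by move=> [_ <-]; case: da.
exists a; split=> //; first by rewrite za' az'.
move=> y yI; have := @per_convex_ge a y; rewrite p0 mul0r addr0; apply=> //.
by rewrite za az.
Qed.

End Potential.

(** * Constants near the minimizer and the energy lower bound for [v] *)

Lemma common_radius (R : realType) (k : nat) (P : nat -> R -> Prop) (b : R) : 0 < b ->
  (forall c, (c <= k)%N -> exists2 e, 0 < e & forall e', e' <= e -> P c e') ->
  exists2 e, 0 < e <= b & forall c, (c <= k)%N -> P c e.
Proof.
move=> b0 h; suff [e eb he] : exists2 e, 0 < e <= b & forall c, (c <= k)%N ->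
    forall e', e' <= e -> P c e' by exists e => // c ck; exact: he.
elim: k h => [|k IH] h.
  have [e e0 he] := h 0%N isT; exists (Num.min e b).
    by rewrite lt_min e0 b0 ge_min lexx orbT.
  by move=> c; rewrite leqn0 => /eqP -> e' e'e; apply: he; apply: le_trans e'e _; rewrite ge_min lexx.
have [e /andP[e0 eb] he] := IH (fun c ck => h c (leqW ck)).
have [f f0 hf] := h k.+1 (leqnn _); exists (Num.min e f).
  by rewrite lt_min e0 f0 ge_min eb.
move=> c; rewrite leq_eqVlt => /predU1P[->|ck] e' h'.
  by apply: hf; apply: le_trans h' _; rewrite ge_min lexx orbT.
by apply: he => //; apply: le_trans h' _; rewrite ge_min lexx.
Qed.

Section AtMinimizer.
Variables (R : realType) (v : R -> \bar R) (rhc zmin zmax alpha1 alpha2 s : R).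
Hypothesis hV : assumptionV v rhc zmin zmax alpha1 alpha2 s.
Variables (d : nat) (p a : R).
Hypothesis p_gt0 : 0 < p.
Local Notation m := d.+1.
Local Notation f := (vreal v).
Local Notation f1 := ((vreal v)^`()%classic).
Local Notation f2 := (d2 v).
Local Notation per := (energy_per f d p).
Hypothesis zmin_a : zmin < a.
Hypothesis a_zmax : a < zmax.
Hypothesis per1_a : per1 v d p a = 0.
Hypothesis per_a_lt0 : per a < 0.
Hypothesis per_a_min : forall y, zmin <= y <= zmax ->
  per a + convexity v zmin zmax d / 2 * (y - a) ^+ 2 <= per y.

Definition stiff c : R := f2 (c%:R * a).
Local Notation mu := (per2 v d a).

Let rz : rhc < zmin. Proof. exact: V_zmin_gt hV. Qed.
Let ra : rhc < a. Proof. exact: lt_trans zmin_a. Qed.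
Let zmin_gt0 : 0 < zmin. Proof. exact: le_lt_trans (V_hc_ge0 hV) rz. Qed.
Let a_gt0 : 0 < a. Proof. exact: lt_trans zmin_a. Qed.
Let zmax_gt0 : 0 < zmax. Proof. exact: lt_trans a_zmax. Qed.
Let conv_gt0 : 0 < convexity v zmin zmax d. Proof. exact: convexity_gt0 hV d. Qed.

Lemma stiff_le0 c : (2 <= c <= m)%N -> stiff c <= 0.
Proof.
by move=> /andP[c2 _]; apply: (V_d2_le0 hV); apply: (two_zmin hV c2); exact: ltW.
Qed.

Lemma mu_gt0 : 0 < mu.
Proof.
apply: lt_le_trans conv_gt0 _; apply: (per2_ge hV); by rewrite !ltW.
Qed.

Definition sum_sq : R := \sum_(1 <= c < m.+1) c%:R ^+ 2.

Lemma sum_sq_gt0 : 0 < sum_sq.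
Proof.
rewrite /sum_sq big_ltn// ltr_pwDl ?expr1n//.
by rewrite big_nat_cond sumr_ge0// => c _; exact: sqr_ge0.
Qed.

(** For c at least 2 the bound on [f2] is multiplicative, so that the deficits lose only the factor
    [1 - th]. *)
Lemma near_radius th eta b : 0 < th -> 0 < eta -> 0 < b ->
  exists2 del, 0 < del <= b & forall c t, (1 <= c <= m)%N -> `|t - c%:R * a| <= c%:R * del ->
    `|f2 t - stiff c| <= eta /\ ((2 <= c)%N -> f2 t <= (1 - th) * stiff c).
Proof.
move=> th0 eta0 b0.
pose Q c t := `|f2 t - stiff c| <= eta /\ ((2 <= c)%N -> f2 t <= (1 - th) * stiff c).
suff [e e1 he] : exists2 e, 0 < e <= b & forall c, (c <= m)%N -> (1 <= c)%N ->
    forall t, `|t - c%:R * a| <= c%:R * e -> Q c t.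
  by exists e => // c t /andP[c1 cm]; apply: he.
apply: (common_radius (P := fun c e => (1 <= c)%N -> forall t, `|t - c%:R * a| <= c%:R * e -> Q c t)) => //.
move=> c cm; have [->|c1] := posnP c; first by exists 1.
have cR : 0 < c%:R :> R by rewrite ltr0n.
have rca : rhc < c%:R * a by apply: (ge_mul_nat hV).
have fc := f2_continuous hV rca.
have near2 : \forall t \near c%:R * a, (2 <= c)%N -> f2 t <= (1 - th) * stiff c.
  have [c2|c2] := leqP 2 c; last by near=> t.
  have sle : stiff c <= 0 by apply: stiff_le0; rewrite c2 cm.
  (* If [stiff c = 0] there is no strict inequality to propagate by continuity; instead [f2 <= 0]
     near [c * a], which lies beyond [2 * zmin]. *)
  have [s0|sn] := eqVneq (stiff c) 0.
    near=> t; move=> _; rewrite s0 mulr0; apply: (V_d2_le0 hV); apply: ltW; near: t.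
    apply: (cvgr_gt (c%:R * a)); first exact: cvg_id.
    by apply: le_lt_trans (two_zmin hV c2 (lexx zmin)) _; rewrite ltr_pM2l.
  have s0 : stiff c < 0 by rewrite lt_neqAle sn.
  near=> t; move=> _; apply: ltW; near: t; apply: (cvgr_lt (stiff c) fc).
  by rewrite mulrBl mul1r ltrDl oppr_gt0 pmulr_rlt0.
have : \forall t \near c%:R * a, Q c t.
  near=> t; split; last by near: t.
  by rewrite distrC; near: t; move/cvgrPdist_le : fc; exact.
case/nbhs_ballP => e /= e0 he; exists (e / (2 * c%:R)).
  by rewrite divr_gt0// mulr_gt0.
move=> e' e'e _ t ht; apply: he; rewrite /ball /= distrC.
apply: le_lt_trans ht _; apply: le_lt_trans (ler_wpM2l (ltW cR) e'e) _.
rewrite (_ : c%:R * _ = e / 2); last by field; rewrite gt_eqF.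
by rewrite ltr_pdivrMr// ltr_pMr// ltr1n.
Unshelve. all: by end_near. Qed.

Let in_window c y del : (1 <= c)%N -> `|y - a| <= del ->
  `|c%:R * y - c%:R * a| <= c%:R * del.
Proof.
move=> c1 h; rewrite -mulrBr normrM ger0_norm ?ler0n//.
exact: ler_wpM2l (ler0n _ c) _ _ h.
Qed.

Lemma chain_energy_ge th : 0 < th -> th < 1 -> exists kap p', [/\ 0 < kap, 0 < p' &
  forall n z, (forall i, (i < n)%N -> rhc < z i) ->
  exists B, \sum_(i < n) (per a + spacing_bound d a kap p' th mu stiff z B i) <=
    list_energy f m z (particles n) + p * pos z n].
Proof.
move=> th0 th1.
pose b := Num.min (a - zmin) (zmax - a).
have b0 : 0 < b by rewrite lt_min !subr_gt0 zmin_a.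
(* With this tolerance on each [f2], the weights [c ^+ 2] let [per2] drop by at most [th * mu]. *)
have eta0 : 0 < th * mu / sum_sq by rewrite divr_gt0 ?mulr_gt0 ?mu_gt0 ?sum_sq_gt0.
have [del /andP[del0 delb] near] := near_radius th0 eta0 b0.
have del1 : del <= a - zmin by apply: le_trans delb _; rewrite ge_min lexx.
have del2 : del <= zmax - a by apply: le_trans delb _; rewrite ge_min lexx orbT.
have C0 := conv_gt0; have amin := per_a_min.
set C := convexity v zmin zmax d in C0 amin.
(* Outside the ball of radius [del] the excess energy is at least [C / 2 * del ^+ 2]: half of it is
   kept for [kap], half for [p' * y]. The second bound gives [3 * kap <= - per a], as merged
   spacings require. *)
pose kap := Num.min (C * del ^+ 2 / 4) (- per a / 4).
have kap0 : 0 < kap.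
  by rewrite lt_min !divr_gt0 ?mulr_gt0 ?exprn_gt0 ?oppr_gt0.
have kap1 : kap <= C * del ^+ 2 / 4 by rewrite ge_min lexx.
have kap2 : kap <= - per a / 4 by rewrite ge_min lexx orbT.
pose p' := Num.min p (kap / zmax).
have p'0 : 0 < p' by rewrite lt_min p_gt0 divr_gt0.
have p'p : p' <= p by rewrite ge_min lexx.
have p'k : p' * zmax <= kap by rewrite -ler_pdivlMr// ge_min lexx orbT.
have wide y : `|y - a| <= del -> zmin <= y <= zmax.
  by rewrite ler_norml => /andP[h1 h2]; apply/andP; split; lra.
have large y : zmax <= y -> per a + C / 2 * del ^+ 2 + p * (y - zmax) <= per y.
  move=> zy; apply: le_trans (per_large hV d p zy); rewrite lerD2r.
  have zI : zmin <= zmax <= zmax by rewrite lexx ltW// (lt_trans zmin_a).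
  apply: le_trans (amin _ zI).
  rewrite lerD2l ler_wpM2l ?divr_ge0 ?(ltW C0)// ler_sqr ?nnegrE ?(ltW del0)//.
  by rewrite subr_ge0 ltW.
exists kap, p'; split=> // n z z_gt.
apply: (chain_energy_lower (delta := del) _ _ _ _ _ _ _ p'p
   (fun x _ => lower_tail_ge0 hV x) (lower_tail_anti hV) (V_hc_ge0 hV) (f_ge_tail hV)
   (f_min hV) (ltW (f_zmax_lt0 hV)) (f_repulsive hV) z_gt).
- by move=> c y /andP[c2 _] zy; apply: (f_le0 hV); exact: (two_zmin_zmax hV c2 zy).
- move=> c y /andP[c2 _] zy.
  pose hi := \sum_(j < c) `|c%:R * y j|.
  have c0 : (0 < c)%N by exact: ltnW.
  have D1 t : 2 * zmin <= t <= hi -> rhc < t.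
    move=> /andP[h _]; apply: lt_le_trans h; apply: (lt_trans rz).
    by have := zmin_gt0; lra.
  have := @jensen_gap _ f f1 f2 (2 * zmin) hi (fun t h => f_derive hV (D1 t h))
     (fun t h => f1_derive hV (D1 t h)) c y 0 c0.
  rewrite !mul0r addr0; apply.
    by move=> t /andP[h _]; exact: (V_d2_le0 hV).
  move=> j jc; rewrite (two_zmin hV c2 (zy j jc)) /hi (bigD1 (Ordinal jc))//=.
  by apply: le_trans (ler_norm _) _; rewrite lerDl sumr_ge0.
- move=> c w /andP[c2 cm] wd.
  have c0 : (0 < c)%N by exact: ltnW.
  have D0 t : c%:R * (a - del) <= t <= c%:R * (a + del) -> `|t - c%:R * a| <= c%:R * del.
    by rewrite mulrBr mulrDr ler_norml => /andP[h1 h2]; apply/andP; split; lra.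
  have D1 t : c%:R * (a - del) <= t <= c%:R * (a + del) -> rhc < t.
    move=> /andP[h _]; apply: lt_le_trans h; apply: (ge_mul_nat hV) => //.
    by apply: (lt_le_trans rz); lra.
  have := @jensen_gap _ f f1 f2 _ _ (fun t h => f_derive hV (D1 t h))
     (fun t h => f1_derive hV (D1 t h)) c (fun j => w j + a) ((1 - th) * stiff c) c0.
  rewrite deficit_shift => J.
  have {}J : c%:R^-1 * \sum_(j < c) f (c%:R * (w j + a)) <=
      f (\sum_(j < c) (w j + a)) + (1 - th) * stiff c / 2 * deficit c w.
    apply: J => [t tI|j jc].
      by have [|_ h] := near c t _ (D0 t tI); [rewrite c0 cm|exact: h].
    have := wd j jc; rewrite ler_norml => /andP[h1 h2].
    by apply/andP; split; apply: ler_wpM2l; rewrite ?ler0n//; lra.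
  rewrite -lerBrDr; apply: le_trans J _; rewrite lerD2l le_eqVlt; apply/orP; left.
  by apply/eqP; field.
- move=> y ya.
  have D1 t : a - del <= t <= a + del -> rhc < t.
    by move=> /andP[h _]; apply: lt_le_trans h; apply: (lt_le_trans rz); lra.
  have := @second_order_ge _ per (per1 v d p) (per2 v d) _ _
    (fun t h => per_derive hV d p (D1 t h)) (fun t h => per1_derive hV d p (D1 t h))
    ((1 - th) * mu) a y.
  rewrite per1_a mul0r addr0 (_ : (1 - th) * mu / 2 * _ = (1 - th) / 2 * (mu * (y - a) ^+ 2)).
    apply.
    + move=> t /andP[t1 t2].
      have ta : `|t - a| <= del by rewrite ler_norml; apply/andP; split; lra.
      suff : mu - th * mu <= per2 v d t by rewrite mulrBl mul1r.
      rewrite (_ : th * mu = \sum_(1 <= c < m.+1) c%:R ^+ 2 * (th * mu / sum_sq)).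
        rewrite -sumrB; apply: ler_sum_nat => c /andP[c1 cm]; rewrite -mulrBr.
        apply: ler_wpM2l; first exact: sqr_ge0.
        have [|h _] := near c (c%:R * t) _ (in_window c1 ta); first by rewrite c1.
        by move: h; rewrite ler_norml -/(stiff c) => /andP[h _]; lra.
      by rewrite -mulr_suml -/sum_sq [RHS]mulrC divfK// gt_eqF// sum_sq_gt0.
    + by apply/andP; split; lra.
    + by move: ya; rewrite ler_norml => /andP[h1 h2]; apply/andP; split; lra.
  by field.
- move=> y zy ya; have [yz|yz] := leP y zmax; last first.
    apply: le_trans (large y (ltW yz)); rewrite -!addrA lerD2l.
    have := ler_wpM2r (_ : 0 <= y - zmax) p'p; rewrite subr_ge0 (ltW yz) => /(_ erefl).
    by move: p'k kap1; rewrite !mulrBr; lra.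
  have yI : zmin <= y <= zmax by rewrite zy.
  apply: le_trans (amin _ yI); rewrite -addrA lerD2l.
  have d2 : del ^+ 2 <= (y - a) ^+ 2.
    by rewrite -[leRHS]real_normK ?num_real// ler_sqr ?nnegrE ?(ltW del0)// ltW.
  have := ler_wpM2l (ltW C0) d2; have := ler_wpM2l (ltW p'0) yz.
  by move: p'k kap1; lra.
- move=> y zy; have [yz|yz] := leP y zmax; last first.
    apply: le_trans (large y (ltW yz)).
    have := ler_wpM2r (_ : 0 <= y - zmax) p'p; rewrite subr_ge0 (ltW yz) => /(_ erefl).
    have := mulr_ge0 (ltW C0) (sqr_ge0 del).
    have := per_a_lt0.
    by move: p'k kap2; rewrite !mulrBr; lra.
  have yI : zmin <= y <= zmax by rewrite zy.
  apply: le_trans (amin _ yI).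
  have := mulr_ge0 (ltW C0) (sqr_ge0 (y - a)); have := ler_wpM2l (ltW p'0) yz.
  have := per_a_lt0; by move: p'k kap2; lra.
- by have := per_a_lt0; move: kap2; lra.
Qed.

End AtMinimizer.

(** * Upper bound on the energy near the ground state *)

Fixpoint history (R : realType) (a : R) (x z : nat -> R) k : nat -> R :=
  if k is k'.+1 then push (z k' - a) (history a x z k') else x.

Lemma stage_sumE (R : realType) d (H : nat -> nat -> R) (a : R) x l :
  stage_sum d H a x l =
  \sum_(i < size l) qf d.+1 H (history a x (nth 0 l) i.+1).
Proof.
elim: l x => [|y l IH] x /=; first by rewrite big_ord0.
rewrite big_ord_recl IH; congr (_ + _); apply: eq_bigr => i _; congr qf.
have h k : history a (push (y - a) x) (nth 0 l) k = history a x (nth 0 (y :: l)) k.+1.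
  by elim: k => //= k ->.
exact: (h i.+1).
Qed.

Section Histories.
Variables (R : realType) (a : R) (z : nat -> R).
Local Notation hist := (history a (fun=> 0) z).

Lemma history_sum k c : (c <= k)%N ->
  \sum_(j < c) (hist k j + a) = pos z k - pos z (k - c).
Proof.
elim: k c => [|k IH] [|c] //; rewrite ?big_ord0 ?subn0 ?subrr// ltnS => ck.
by rewrite big_ord_recl /= IH//= posS subSS; ring.
Qed.

Lemma new_particleE (f : R -> R) (m i : nat) : (0 < m)%N ->
  \sum_(q <- particles i) pair_energy f m z q i.+1 =
  \sum_(1 <= c < m.+1) (if (c <= i.+1)%N then f (\sum_(j < c) (hist i.+1 j + a)) else 0).
Proof.
move=> m0; rewrite (perm_big (iota 0 i.+1)); last by rewrite perm_rev.
rewrite -[iota 0 i.+1]/(index_iota 0 i.+1) big_nat_rev /= add0n.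
pose F q := if (q < m)%N && (q < i.+1)%N then f (\sum_(j < q.+1) (hist i.+1 j + a)) else 0.
rewrite (eq_big_nat _ _ (F2 := F)); last first.
  move=> q /andP[_ qi]; rewrite subSS /pair_energy /F qi andbT subSn ?leq_subr// subKn//.
  by case: ifP => // _; rewrite history_sum// subSS.
rewrite [RHS]big_add1 !big_mkord /=.
rewrite (sum_ord_widen (F := F) (leq_maxl i.+1 m)); last first.
  by move=> j ij; rewrite /F [(j < i.+1)%N]ltnNge ij andbF.
rewrite -(sum_ord_widen (F := F) (leq_maxr i.+1 m)); last first.
  by move=> j mj; rewrite /F ltnNge mj.
by apply: eq_bigr => q _; rewrite /F ltn_ord.
Qed.

Lemma history_bound (del : R) n : 0 <= del -> (forall i, (i < n)%N -> `|z i - a| <= del) ->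
  forall k j, (k <= n)%N -> `|hist k j| <= del.
Proof.
move=> del0 za; elim=> [|k IH] [|j] kn /=; rewrite ?normr0//; first exact: za.
by apply: IH; exact: ltnW.
Qed.

End Histories.

Lemma sum_deficit (R : realType) (phi w : nat -> R) m : (0 < m)%N ->
  \sum_(1 <= c < m.+1) phi c * deficit c w = \sum_(2 <= c < m.+1) phi c * deficit c w.
Proof.
by move=> m0; rewrite big_ltn// {1}/deficit !big_ord1 mul1r subrr mulr0 add0r.
Qed.

Section EnergyUpper.
Variables (R : realType) (v : R -> \bar R) (rhc zmin zmax alpha1 alpha2 s : R).
Hypothesis hV : assumptionV v rhc zmin zmax alpha1 alpha2 s.
Variables (d : nat) (p a : R).
Local Notation m := d.+1.
Local Notation f := (vreal v).
Local Notation f1 := ((vreal v)^`()%classic).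
Local Notation f2 := (d2 v).
Local Notation per := (energy_per f d p).
Hypothesis zmin_a : zmin < a.
Hypothesis a_zmax : a < zmax.
Hypothesis per1_a : per1 v d p a = 0.
Local Notation stiff := (stiff v a).
Local Notation mu := (per2 v d a).
Local Notation H := (stage_matrix stiff mu m).

Let rz : rhc < zmin. Proof. exact: V_zmin_gt hV. Qed.

Lemma abs_sum_le c (w : nat -> R) : (forall j, (j < c)%N -> `|w j| <= 1) ->
  `|\sum_(j < c) w j| <= c%:R.
Proof.
move=> w1; apply: le_trans (ler_norm_sum _ _ _) _.
rewrite -[c in c%:R]card_ord -sum1_card natr_sum; apply: ler_sum => j _.
exact: w1.
Qed.

Let sq (x : R) := x ^+ 2.

(* The linear terms cancel up to a telescoping potential because the pressure
   balances the forces at [a]. *)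
Lemma window_sumE eta y (x : nat -> R) :
  let w := push y x in
  let T x := \sum_(1 <= c < m.+1) (f1 (c%:R * a) * potential id c x
     + (stiff c + eta) / 2 * c%:R * potential sq c x) in
  p * y + \sum_(1 <= c < m.+1) (f1 (c%:R * a) * (\sum_(j < c) w j)
     + (stiff c + eta) / 2 * (c%:R * \sum_(j < c) w j ^+ 2)) =
  (mu + eta * sum_sq R d) / 2 * y ^+ 2 + T x - T w.
Proof.
move=> w T; rewrite /T -addrA -sumrB.
have -> : p * y = - \sum_(1 <= c < m.+1) c%:R * f1 (c%:R * a) * y.
  by rewrite -mulr_suml -mulNr; congr (_ * y); move: per1_a; rewrite /per1; lra.
rewrite /per2 /sum_sq mulr_sumr -big_split /= mulr_suml mulr_suml -sumrN -!big_split /=.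
apply: eq_bigr => c _.
have -> : \sum_(j < c) w j = c%:R * y + potential id c x - potential id c w.
  exact: (sum_window id).
have -> : \sum_(j < c) w j ^+ 2 = c%:R * y ^+ 2 + potential sq c x - potential sq c w.
  exact: (sum_window sq).
by rewrite -/(stiff c) /sq; field.
Qed.

(** A Taylor expansion of each bond with slightly raised stiffness. The constant [K] absorbs the
    first d steps, whose windows reach beyond the end of the chain, and the final value of the
    telescoping potential. *)
Lemma chain_energy_le eps b : 0 < eps -> 0 < b ->
  exists del K, [/\ 0 < del, del <= b &
  forall n z, (forall i, (i < n)%N -> `|z i - a| <= del) ->
    list_energy f m z (particles n) + p * pos z n <=
    n%:R * per a + K + (1 + eps) / 2 *
      \sum_(i < n) qf m H (history a (fun=> 0) z i.+1)].
Proof.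
move=> eps0 b0.
have mu0 := mu_gt0 hV d zmin_a a_zmax; have ss0 := sum_sq_gt0 R d.
(* Then the raised stiffnesses add [eta * sum_sq = eps * mu] to [mu]. *)
pose eta := eps * mu / sum_sq R d.
have eta0 : 0 < eta by rewrite divr_gt0// mulr_gt0.
have b0' : 0 < Num.min (Num.min b 1) (a - zmin) by rewrite !lt_min b0 ltr01 subr_gt0.
have half : (0 : R) < 1 / 2 by [].
have [del /andP[del0]] := near_radius hV d zmin_a half eta0 b0'.
rewrite !le_min => /andP[/andP[delb del1] dela] near.
(* The squared sum is split into c times the sum of squares minus the deficit, and [eta] is charged
   to the former only, since it is the part that telescopes. *)
pose X c (w : nat -> R) := f (c%:R * a) + (f1 (c%:R * a) * (\sum_(j < c) w j)
  + ((stiff c + eta) / 2 * (c%:R * \sum_(j < c) w j ^+ 2) - stiff c / 2 * deficit c w)).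
pose T (x : nat -> R) := \sum_(1 <= c < m.+1) (f1 (c%:R * a) * potential id c x
     + (stiff c + eta) / 2 * c%:R * potential sq c x).
have f_le c w : (1 <= c <= m)%N -> (forall j, (j < c)%N -> `|w j| <= del) ->
    f (\sum_(j < c) (w j + a)) <= X c w.
  move=> /andP[c1 cm] wd.
  have D0 t : c%:R * (a - del) <= t <= c%:R * (a + del) -> `|t - c%:R * a| <= c%:R * del.
    by rewrite mulrBr mulrDr ler_norml => /andP[h1 h2]; apply/andP; split; lra.
  have D1 t : c%:R * (a - del) <= t <= c%:R * (a + del) -> rhc < t.
    move=> /andP[h _]; apply: lt_le_trans h; apply: (ge_mul_nat hV) => //.
    by apply: (lt_le_trans rz); lra.
  have := @second_order_le _ f f1 f2 _ _ (fun t h => f_derive hV (D1 t h))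
     (fun t h => f1_derive hV (D1 t h)) (stiff c + eta) (c%:R * a) (\sum_(j < c) (w j + a)).
  have -> : \sum_(j < c) (w j + a) = \sum_(j < c) w j + c%:R * a.
    by rewrite big_split /= sumr_const card_ord mulr_natl.
  rewrite addrK => h.
  have {}h : f (\sum_(j < c) w j + c%:R * a) <= f (c%:R * a) + f1 (c%:R * a) * (\sum_(j < c) w j)
      + (stiff c + eta) / 2 * (\sum_(j < c) w j) ^+ 2.
    apply: h.
    - move=> t tI; have [|h _] := near c t _ (D0 t tI); first by rewrite c1.
      by move: h; rewrite ler_norml => /andP[_ h]; lra.
    - by apply/andP; split; apply: ler_wpM2l; rewrite ?ler0n//; lra.
    - have : `|\sum_(j < c) w j| <= c%:R * del.
        apply: le_trans (ler_norm_sum _ _ _) _.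
        rewrite mulr_natl -[c in _ *+ c]card_ord -sumr_const.
        by apply: ler_sum => j _; exact: wd.
      by rewrite ler_norml mulrBr mulrDr => /andP[h1 h2]; apply/andP; split; lra.
  apply: (le_trans h); rewrite /X -!addrA !lerD2l.
  have dg : 0 <= eta * deficit c w by rewrite mulr_ge0 ?deficit_ge0// ltW.
  have -> : (\sum_(j < c) w j) ^+ 2 = c%:R * (\sum_(j < c) w j ^+ 2) - deficit c w.
    by rewrite /deficit; ring.
  by rewrite mulrBr; lra.
pose KX c := `|f (c%:R * a)| + `|f1 (c%:R * a)| * c%:R
   + (`|stiff c| + eta) * c%:R ^+ 2 + `|stiff c| * c%:R ^+ 2.
pose K1 := \sum_(1 <= c < m.+1) KX c.
have le1 (x : R) : `|x| <= del -> `|x| <= 1 by move=> h; exact: le_trans h _.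
have sqsum c (w : nat -> R) : (forall j, (j < c)%N -> `|w j| <= 1) ->
    0 <= \sum_(j < c) w j ^+ 2 <= c%:R.
  move=> w1; rewrite sumr_ge0/= => [|j _]; last exact: sqr_ge0.
  rewrite -[c in c%:R]card_ord -sum1_card natr_sum; apply: ler_sum => j _.
  by rewrite -real_normK ?num_real// expr_le1// w1.
have X_ge c w : (forall j, (j < c)%N -> `|w j| <= 1) -> - KX c <= X c w.
  move=> w1; have h1 := abs_sum_le w1; have /andP[h2 h3] := sqsum c w w1.
  have h4 := deficit_ge0 c w.
  have h5 : deficit c w <= c%:R ^+ 2.
    rewrite /deficit expr2; apply: le_trans (_ : c%:R * (\sum_(i < c) w i ^+ 2) <= _).
      by rewrite lerBlDr lerDl sqr_ge0.
    exact: ler_wpM2l.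
  have h6 : c%:R * (\sum_(i < c) w i ^+ 2) <= c%:R ^+ 2.
    by rewrite expr2; exact: ler_wpM2l.
  have h7 : 0 <= c%:R * (\sum_(i < c) w i ^+ 2) by exact: mulr_ge0.
  have a1 : - `|f (c%:R * a)| <= f (c%:R * a) by rewrite lerNl ler_normr lexx orbT.
  have a2 : - (`|f1 (c%:R * a)| * c%:R) <= f1 (c%:R * a) * (\sum_(j < c) w j).
    have : `|f1 (c%:R * a) * (\sum_(j < c) w j)| <= `|f1 (c%:R * a)| * c%:R.
      by rewrite normrM ler_wpM2l.
    by rewrite ler_norml => /andP[].
  have a3 : - ((`|stiff c| + eta) * c%:R ^+ 2) <=
      (stiff c + eta) / 2 * (c%:R * \sum_(j < c) w j ^+ 2).
    move: h6 h7; set Y := c%:R * \sum_(j < c) w j ^+ 2; set Z := c%:R ^+ 2 => h6 h7.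
    have n1 : - `|stiff c| <= stiff c by rewrite lerNl ler_normr lexx orbT.
    have n0 := normr_ge0 (stiff c).
    have := mulr_ge0 (_ : 0 <= `|stiff c| + stiff c) h7.
    have := mulr_ge0 (ltW eta0) h7; have := mulr_ge0 (ltW eta0) (le_trans h7 h6).
    have := mulr_ge0 n0 (_ : 0 <= Z - Y); have := mulr_ge0 n0 h7.
    rewrite subr_ge0 h6 -lerBlDl sub0r n1 => q1 /(_ erefl) q2 q3 q4 /(_ erefl) q5.
    by move: q1 q2 q3 q4 q5; move: `|stiff c| (stiff c) => A B; lra.
  have a4 : - (`|stiff c| * c%:R ^+ 2) <= - (stiff c / 2 * deficit c w).
    rewrite lerN2 -mulrA; apply: le_trans (_ : `|stiff c| * (2^-1 * deficit c w) <= _).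
      by rewrite ler_wpM2r ?ler_norm// mulr_ge0// invr_ge0.
    by apply: ler_wpM2l => //; lra.
  rewrite /X /KX; lra.
have T_ge w : (forall j, `|w j| <= del) -> - (\sum_(1 <= c < m.+1) (`|f1 (c%:R * a)|
    + (`|stiff c| + eta) / 2 * c%:R) * c%:R ^+ 2) <= T w.
  move=> wd; rewrite -sumrN; apply: ler_sum_nat => c _.
  have pb (g : R -> R) : (forall j, `|g (w j)| <= 1) -> `|potential g c w| <= c%:R ^+ 2.
    move=> g1; apply: le_trans (ler_norm_sum _ _ _) _.
    rewrite expr2 mulr_natl -[c in _ *+ c]card_ord -sumr_const; apply: ler_sum => j _.
    rewrite normrM ger0_norm// -[leRHS]mulr1 ler_pM// ler_nat.
    exact: leq_trans (leq_subr _ _) (leq_pred c).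
  have p1 : `|potential id c w| <= c%:R ^+ 2 by apply: pb => j; exact: le1 (wd j).
  have p2 : `|potential sq c w| <= c%:R ^+ 2.
    by apply: pb => j; rewrite /sq normrX expr_le1// le1.
  rewrite mulrDl opprD; apply: lerD.
    have : `|f1 (c%:R * a) * potential id c w| <= `|f1 (c%:R * a)| * c%:R ^+ 2.
      by rewrite normrM ler_wpM2l.
    by rewrite ler_norml => /andP[].
  have : `|(stiff c + eta) / 2 * c%:R * potential sq c w| <=
      (`|stiff c| + eta) / 2 * c%:R * c%:R ^+ 2.
    rewrite normrM ler_pM// !normrM (ger0_norm (ler0n _ c)) ler_wpM2r//.
    rewrite [`|2^-1|]ger0_norm ?invr_ge0// ler_wpM2r ?invr_ge0//.
    by apply: le_trans (ler_normD _ _) _; rewrite lerD2l ger0_norm// ltW.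
  by rewrite ler_norml => /andP[].
set K2 := \sum_(1 <= c < m.+1) _ in T_ge.
exists del, (d%:R * K1 + K2); split=> // n z za.
have K1_ge0 : 0 <= K1.
  rewrite /K1 big_nat_cond; apply: sumr_ge0 => c _.
  by rewrite /KX !addr_ge0 ?mulr_ge0 ?addr_ge0 ?sqr_ge0// ltW.
have hb k j : (k <= n)%N -> `|history a (fun=> 0) z k j| <= del.
  by move=> kn; apply: (history_bound (ltW del0) za).
suff main k : (k <= n)%N -> list_energy f m z (particles k) + p * pos z k
    + T (history a (fun=> 0) z k) <=
  k%:R * per a + (minn k d)%:R * K1 + (1 + eps) / 2 *
    \sum_(i < k) qf m H (history a (fun=> 0) z i.+1).
  have := main n (leqnn n); have := T_ge _ (fun j => hb n j (leqnn n)).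
  have : (minn n d)%:R * K1 <= d%:R * K1 by rewrite ler_wpM2r// ler_nat geq_minr.
  lra.
elim: k => [_|k IH kn].
  rewrite /particles /= big_nil big_ord0 /pos big_ord0 /T big1 => [|c _].
    by rewrite !(mulr0, mul0r, addr0, min0n).
  by rewrite !potential_const ?mulr0 ?addr0// /sq expr0n.
move: (IH (ltnW kn)) => {}IH; rewrite particlesS /=.
rewrite (new_particleE a)// posS (mulrDr p).
set x := history a _ z k; set y := z k - a; set w := push y x.
have wd j : `|w j| <= del by exact: (hb k.+1).
have cost_le : \sum_(1 <= c < m.+1) (if (c <= k.+1)%N then
     f (\sum_(j < c) (history a (fun=> 0) z k.+1 j + a)) else 0) <=
   \sum_(1 <= c < m.+1) X c w + (minn k.+1 d)%:R * K1 - (minn k d)%:R * K1.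
  have [kd|dk] := ltnP k d.
    rewrite (minn_idPl kd) -natr1 mulrDl mul1r.
    apply: (@le_trans _ _ (\sum_(1 <= c < m.+1) X c w + K1)); last by lra.
    (* Bonds that do not fit into the chain yet count 0 on the left, and [X] may be negative there;
       [KX c] makes up for it. *)
    rewrite /K1 -big_split /=; apply: ler_sum_nat => c cm.
    case: ifP => _.
      apply: le_trans (f_le c w cm (fun j _ => wd j)) _.
      by rewrite lerDl /KX !addr_ge0 ?mulr_ge0 ?addr_ge0 ?sqr_ge0// ltW.
    by have := X_ge c w (fun j _ => le1 _ (wd j)); lra.
  rewrite (minn_idPr (leqW dk)) addrK.
  apply: ler_sum_nat => c cm; rewrite ifT; last by move: cm dk; clear; lia.
  exact: f_le c w cm (fun j _ => wd j).
rewrite [\sum_(i < k.+1) _]big_ord_recr /= -/x -/w -natr1 (mulrDl k%:R) mul1r (mulrDr ((1 + eps) / 2)).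
have wE := window_sumE eta y x; rewrite /= -/w -/(T x) -/(T w) in wE.
have qE : qf m H w = mu * y ^+ 2 - \sum_(1 <= c < m.+1) stiff c * deficit c w.
  by rewrite stage_matrixE// (sum_deficit stiff w).
have XE : \sum_(1 <= c < m.+1) X c w = \sum_(1 <= c < m.+1) f (c%:R * a)
   + \sum_(1 <= c < m.+1) (f1 (c%:R * a) * (\sum_(j < c) w j)
     + (stiff c + eta) / 2 * (c%:R * \sum_(j < c) w j ^+ 2))
   - (\sum_(1 <= c < m.+1) stiff c * deficit c w) / 2.
  rewrite mulr_suml -big_split -sumrB /=; apply: eq_bigr => c _.
  by rewrite /X; field.
(* The deficit part is nonnegative in [H], so the factor [1 + eps] may be put on it as well. *)
have def0 : \sum_(1 <= c < m.+1) stiff c * deficit c w <= 0.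
  rewrite (sum_deficit stiff w)//.
  rewrite big_nat_cond; apply: sumr_le0 => c /andP[cm _].
  apply: mulr_le0_ge0; last exact: deficit_ge0.
  by apply: (stiff_le0 (d := d) hV zmin_a); rewrite -ltnS.
have etaE : eta * sum_sq R d = eps * mu by rewrite /eta (divfK (lt0r_neq0 ss0)).
have perE : per a = p * a + \sum_(1 <= c < m.+1) f (c%:R * a) by [].
have zk : p * z k = p * y + p * a by rewrite /y; ring.
move: IH cost_le; rewrite zk XE perE qE; move: wE; rewrite etaE; move: def0.
have := mulr_ge0 (ltW eps0) (mulr_ge0 (ltW mu0) (sqr_ge0 y)).
set S1 := \sum_(1 <= c < m.+1) stiff c * _; set S2 := \sum_(1 <= c < m.+1) (_ + _).
move=> _ def0 wE IH cost_le.
have := ler_wpM2l (ltW eps0) def0; rewrite mulr0.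
have -> : (1 + eps) / 2 * (mu * y ^+ 2 - S1) =
  (mu + eps * mu) / 2 * y ^+ 2 - S1 / 2 - eps * S1 / 2 by field.
move: wE cost_le IH; lra.
Qed.

End EnergyUpper.

(** * The partition function *)

Lemma sum_particles (R : realType) (G : nat -> R) n :
  \sum_(q <- particles n) G q = \sum_(q < n.+1) G q.
Proof.
rewrite (perm_big (iota 0 n.+1)); last by rewrite perm_rev.
by rewrite -[iota 0 n.+1]/(index_iota 0 n.+1) big_mkord.
Qed.

Lemma list_energyE (R : realType) (f : R -> R) m z n :
  list_energy f m z (particles n) =
  \sum_(i < n.+1) \sum_(j < n.+1 | (i < j)%N && (j - i <= m)%N) f (pos z j - pos z i).
Proof.
transitivity (\sum_(j < n.+1) \sum_(i < j) pair_energy f m z i j).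
  elim: n => [|n IH]; first by rewrite /particles /= big_nil big_ord1 big_ord0 addr0.
  by rewrite particlesS /= IH sum_particles [RHS]big_ord_recr /= addrC.
under [RHS]eq_bigr do rewrite big_mkcond /=.
rewrite [RHS]exchange_big /=; apply: eq_bigr => j _.
rewrite (big_ord_widen n.+1 (fun i => pair_energy f m z i j) (ltnW (ltn_ord j))).
rewrite big_mkcond /=; apply: eq_bigr => i _.
by rewrite /pair_energy; case: ltnP => //= _.
Qed.

Section Partition.
Variables (R : realType) (v : R -> \bar R) (rhc zmin zmax alpha1 alpha2 s : R).
Hypothesis hV : assumptionV v rhc zmin zmax alpha1 alpha2 s.
Variables (d : nat) (p : R).
Local Notation m := d.+1.
Local Notation f := (vreal v).

Definition chain_energy n (l : seq R) : R :=
  list_energy f m (nth 0 l) (particles n) + p * pos (nth 0 l) n.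

Definition boltzmann n beta (l : seq R) : R :=
  if all (fun y => rhc < y) l then expR (- (beta * chain_energy n l)) else 0.

Lemma boltzmann_ge0 n beta l : 0 <= boltzmann n beta l.
Proof. by rewrite /boltzmann; case: ifP => // _; exact: expR_ge0. Qed.

Let v_ninfty z : 0 < z -> v z != -oo%E.
Proof. by move=> z0; have := V_lower hV z0; case: (v z). Qed.

(** A spacing in the hard core makes the energy infinite and the weight 0. No pair term is [-oo], so
    the single term [+oo] decides the sum. *)
Lemma expeR_energy n beta (t : n.-tuple R) : 0 < beta -> all (fun y => 0 < y) t ->
  expeR (- (beta%:E * energy v m p (N := n.+1) t)) = (boltzmann n beta t)%:E.
Proof.
move=> beta0 t0; rewrite /energy /boltzmann.
set P : \bar R := (p * _)%:E.
have t_gt0 k : (k < n)%N -> 0 < t`_k by move=> kn; apply: (all_nthP 0 t0); rewrite size_tuple.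
case: ifPn => [trhc|].
  have t_gt k : (k < n)%N -> rhc < t`_k.
    by move=> kn; apply: (all_nthP 0 trhc); rewrite size_tuple.
  rewrite (_ : (_ + P)%E = (chain_energy n t)%:E).
    by rewrite -EFinM.
  rewrite /chain_energy list_energyE EFinD /P; congr (_ + (p * _)%:E)%E.
  rewrite -sumEFin; apply: eq_bigr => i _; rewrite -sumEFin; apply: eq_bigr => j /andP[ij _].
  rewrite -(pos_sub (nth 0 t) (ltnW ij)) (v_fin hV)//.
  by apply: (pos_gt (V_hc_ge0 hV) t_gt ij); rewrite -ltnS.
rewrite -has_predC => /hasP[y yt /=]; rewrite -leNgt => yr.
have kn : (index y t < n)%N by rewrite -{2}(size_tuple t) index_mem.
set k := index y t in kn; have yk : t`_k = y by rewrite nth_index.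
have terms (i j : 'I_n.+1) : (i < j)%N -> v (\sum_(i <= k < j) t`_k) != -oo%E.
  move=> ij; apply: v_ninfty; rewrite -(pos_sub (nth 0 t) (ltnW ij)).
  by apply: (pos_gt (lexx 0) t_gt0 ij); rewrite -ltnS.
have inner (i : 'I_n.+1) : (\sum_(j < n.+1 | (i < j)%N && (j - i <= m)%N)
    v (\sum_(i <= k < j) t`_k) != -oo)%E.
  by apply/negP => /eqP/esum_eqNyP[j [_ /andP[ij _] e]]; have := terms i j ij; rewrite e.
rewrite (_ : (\sum_(i < n.+1) _)%R = +oo%E).
  by rewrite addye// gt0_muley ?lte_fin.
apply/esum_eqyP => [i _|]; first exact: inner.
exists (inord k); split; rewrite ?mem_index_enum//.
apply/esum_eqyP => [j /andP[ij _]|]; first exact: terms.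
exists (inord k.+1); rewrite !inordK ?ltnS//; last exact: ltnW.
split; rewrite ?mem_index_enum// ?leqnn ?subSnn//.
by rewrite big_nat1 yk (V_hard_core hV)// -yk t_gt0.
Qed.

Definition Qn n beta : \bar R := int_seq n (fun l => (boltzmann n beta l)%:E).

Lemma partition_functionE n beta : 0 < beta ->
  partition_function v m p n.+1 beta = Qn n beta.
Proof.
move=> beta0; rewrite /partition_function /Qn.
pose E n' (l : seq R) : \bar R := (\sum_(i < n'.+1) \sum_(j < n'.+1 | (i < j)%N && (j - i <= m)%N)
      v (\sum_(i <= k < j) l`_k)%R + (p * \sum_(k < n') l`_k)%:E)%E.
rewrite [LHS](_ : _ = int_seq n (fun l => expeR (- (beta%:E * E n l))))//.
apply: eq_int_seq => l [sl l0].
have {}sl : size l == n by rewrite sl.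
exact: (expeR_energy (t := Tuple sl)).
Qed.

Let f_ge_vmin x : rhc < x -> f zmax <= f x := f_min hV (z := x).

(** At most m particles on each side of the cut take part in bonds across it, and each bond is at
    least [f zmax]. *)
Lemma chain_energy_cat n k l : size l = (n + k)%N -> all (fun y => rhc < y) l ->
  chain_energy n (take n l) + chain_energy k (drop n l) + (m * m)%:R * f zmax <=
  chain_energy (n + k) l.
Proof.
move=> sl lr; set z := nth 0 l; set z1 := nth 0 (take n l); set z2 := nth 0 (drop n l).
have z_gt i : (i < n + k)%N -> rhc < z i by move=> ik; apply: (all_nthP 0 lr); rewrite sl.
have pos1 j : (j <= n)%N -> pos z1 j = pos z j.
  by move=> jn; apply: eq_bigr => i _; rewrite /z1 nth_take// (leq_trans (ltn_ord i)).
have pos2 j : pos z (n + j) = pos z n + pos z2 j.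
  rewrite /pos big_split_ord; congr (_ + _); apply: eq_bigr => i _.
  by rewrite /z2 nth_drop.
have e1 : list_energy f m z1 (particles n) = list_energy f m z (particles n).
  elim: {-2}n (leqnn n) => [|j IH] jn; first by rewrite /particles /= !big_nil.
  rewrite !particlesS /= IH ?(ltnW jn)// !sum_particles; congr (_ + _).
  apply: eq_bigr => i _; rewrite /pair_energy !pos1//.
  by rewrite (leq_trans _ (ltnW jn))// -ltnS.
have vle0 : f zmax <= 0 := ltW (f_zmax_lt0 hV).
suff main : list_energy f m z (particles n) + list_energy f m z2 (particles k)
   + (minn k m * m)%:R * f zmax <= list_energy f m z (particles (n + k)).
  have : (m * m)%:R * f zmax <= (minn k m * m)%:R * f zmax.
    by rewrite ler_wnM2r// ler_nat leq_mul2r geq_minr orbT.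
  rewrite /chain_energy -/z -/z1 -/z2 e1 pos1// pos2; move: main; lra.
have : (k <= k)%N by []; elim: {1 3 4 5}k => [|j IH] jk.
  by rewrite addn0 min0n !mul0r /particles /= big_nil !addr0.
have {}IH := IH (ltnW jk); rewrite addnS !particlesS /= !sum_particles.
rewrite -(big_mkord xpredT (fun q => pair_energy f m z q (n + j).+1)).
rewrite (big_cat_nat (n := n))//=; last by rewrite -addnS leq_addr.
rewrite (big_addn 0 (n + j).+1 n) -addnS addKn [X in _ <= _ + X + _]big_mkord.
have -> : \sum_(i < j.+1) pair_energy f m z (i + n) (n + j.+1) =
    \sum_(i < j.+1) pair_energy f m z2 i j.+1.
  apply: eq_bigr => i _; rewrite /pair_energy [(i + n)%N]addnC subnDl !pos2.
  by rewrite opprD addrACA subrr add0r.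
(* Only the first m particles to the right of the cut have partners on its left, each at most m. *)
have cross : (minn j.+1 m * m)%:R * f zmax - (minn j m * m)%:R * f zmax <=
    \sum_(0 <= i < n) pair_energy f m z i (n + j.+1).
  have [jm|mj] := ltnP j m; last first.
    rewrite (minn_idPr (leqW mj)) subrr big_nat_cond sumr_ge0// => i.
    move=> /andP[/andP[_ i_n] _]; rewrite /pair_energy ifN// -ltnNge.
    by move: mj i_n; clear; lia.
  rewrite (minn_idPl jm) -mulrBl -natrB ?leq_mul2r ?leqnSn ?orbT// -mulnBl subSnn mul1n.
  rewrite big_mkord; apply: (@le_trans _ _ (\sum_(i < n)
      (if (n + j.+1 - i <= m)%N then f zmax else 0))).
    rewrite (reindex_inj rev_ord_inj) /=.
    apply: (@le_trans _ _ (\sum_(i < n) (if (i < m)%N then f zmax else 0))); last first.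
      apply: ler_sum => i _; have [h|_] := leqP (n + j.+1 - rev_ord i) m; last by case: ifP.
      by rewrite ifT//; move: h (ltn_ord i); clear; rewrite /=; lia.
    rewrite -big_mkcond /= sumr_const -[f zmax *+ _]mulr_natl ler_wnM2r// ler_nat.
    have [nm|mn] := leqP n m.
      by apply: leq_trans (max_card _) _; rewrite card_ord.
    rewrite -sum1_card -(big_ord_widen n (fun=> 1%N) (ltnW mn)).
    by rewrite sum1_card card_ord.
  apply: ler_sum => i _; rewrite /pair_energy; case: ifP => // _.
  apply: f_ge_vmin; apply: (pos_gt (V_hc_ge0 hV) z_gt); last by rewrite leq_add2l.
  by have := ltn_ord i; clear; lia.
move: cross IH; lra.
Qed.

Lemma boltzmann_cat n k beta l : 0 < beta -> size l = (n + k)%N ->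
  boltzmann (n + k) beta l <=
  expR (- (beta * ((m * m)%:R * f zmax))) *
    (boltzmann n beta (take n l) * boltzmann k beta (drop n l)).
Proof.
move=> beta0 sl; rewrite {1}/boltzmann; case: ifPn => [lr|_]; last first.
  by rewrite !mulr_ge0 ?expR_ge0 ?boltzmann_ge0.
have /andP[h1 h2] : all (fun y => rhc < y) (take n l) && all (fun y => rhc < y) (drop n l).
  by rewrite -all_cat cat_take_drop.
rewrite /boltzmann h1 h2 -!expRD ler_expR -!opprD lerN2 -!mulrDr ler_wpM2l ?(ltW beta0)//.
by rewrite addrC; exact: chain_energy_cat.
Qed.

End Partition.

(** * Patterns of good and bad steps, and decay for large beta *)

Section SumOverPatterns.
Variables (R : realType) (S : Type) (wg : S -> R -> R) (sg : S -> R -> S)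
  (wb : R -> R) (s0 : S).
Hypothesis wg_ge0 : forall s y, 0 <= wg s y.
Hypothesis wb_ge0 : forall y, 0 <= wb y.

Fixpoint pattern_state (s : S) (B : nat -> bool) (z : nat -> R) k : S :=
  if k is k'.+1 then
    if B k' then s0 else sg (pattern_state s B z k') (z k')
  else s.

Lemma pattern_stateS (s : S) (B : nat -> bool) (z : nat -> R) k : pattern_state s B z k.+1 =
  pattern_state (if B 0%N then s0 else sg s (z 0%N)) (fun i => B i.+1) (fun i => z i.+1) k.
Proof. by elim: k => //= k <-. Qed.

(** The pattern [B] from the energy bound depends on the configuration in an uncontrolled way. Its
    weight is one term in the expansion of the sum over all patterns, which no longer refers to
    it. *)
Lemma pattern_le_good_bad (s : S) (B : nat -> bool) (l : seq R) :
  \prod_(i < size l) (if B i then wb (nth 0 l i)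
     else wg (pattern_state s B (nth 0 l) i) (nth 0 l i)) <=
  good_bad_sum wg sg wb s0 s l.
Proof.
elim: l s B => [|y l IH] s B /=; first by rewrite big_ord0.
rewrite big_ord_recl.
pose s' := if B 0%N then s0 else sg s y.
rewrite (eq_bigr (fun i : 'I_(size l) => if B i.+1 then wb (nth 0 l i)
   else wg (pattern_state s' (fun i => B i.+1) (nth 0 l) i) (nth 0 l i))); last first.
  by move=> i _; rewrite lift0 pattern_stateS.
have := IH s' (fun i => B i.+1); rewrite /s' /= => {}IH.
have gb_ge0 t : 0 <= good_bad_sum wg sg wb s0 t l by exact: good_bad_sum_ge0.
case: (B 0%N) IH => IH.
  by rewrite -[leLHS]add0r lerD ?mulr_ge0// ler_wpM2l.
by rewrite -[leLHS]addr0 lerD ?mulr_ge0// ler_wpM2l.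
Qed.

End SumOverPatterns.

Section LargeBeta.
Variable R : realType.

Lemma expR_half_ge (x : R) : 0 <= x -> x ^+ 2 / 4 <= expR x.
Proof.
move=> x0; have -> : expR x = expR (x / 2) ^+ 2.
  by rewrite -expRM_natl; congr expR; field.
have -> : x ^+ 2 / 4 = (x / 2) ^+ 2 by field.
rewrite ler_sqr ?nnegrE ?divr_ge0 ?expR_ge0//.
by apply: le_trans (expR_ge1Dx _); rewrite lerDr.
Qed.

Lemma expRN_small (k eta : R) : 0 < k -> 0 < eta ->
  (* The threshold comes from [expR x >= x ^+ 2 / 4] at [x = k * b]. *)
  exists2 b0, 0 < b0 & forall b, b0 <= b -> b * expR (- (k * b)) <= eta.
Proof.
move=> k0 eta0; exists (4 / (k ^+ 2 * eta)).
  by rewrite divr_gt0// mulr_gt0// exprn_gt0.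
move=> b bb.
have b0 : 0 < b by apply: lt_le_trans bb; rewrite divr_gt0// mulr_gt0// exprn_gt0.
have kb : 0 < k * b by rewrite mulr_gt0.
rewrite expRN ler_pdivrMr ?expR_gt0//.
apply: le_trans (ler_wpM2l (ltW eta0) (expR_half_ge (ltW kb))).
move: bb; rewrite ler_pdivrMr ?mulr_gt0 ?exprn_gt0// => h.
have := ler_wpM2r (ltW b0) h; rewrite exprMn.
by move=> h'; rewrite -subr_ge0; move: h'; rewrite -subr_ge0; move: (k ^+ 2) => K; nra.
Qed.

Lemma integral_exp_decay_le (r : R) : 0 < r ->
  (\int[@lebesgue_measure R]_(y in `]0%R, +oo[) (expR (- (r * y)))%:E <= (r^-1)%:E)%E.
Proof.
move=> r0; rewrite -[leRHS]mule1 -(integral_exponential_pdf r0).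
rewrite -integral_scale ?invr_gt0//; last first.
  by move=> y _; rewrite lee_fin exponential_pdf_ge0// ltW.
rewrite [leLHS]integral_mkcond; apply: integral_le => y _.
  by rewrite /patch; case: ifP => // _; rewrite lee_fin expR_ge0.
rewrite /patch; case: ifPn => [|_]; last first.
  by rewrite mule_ge0// lee_fin ?invr_ge0 ?exponential_pdf_ge0// ltW.
rewrite inE /= in_itv /= andbT => y0.
rewrite -EFinM lee_fin /exponential_pdf patchT ?inE/= ?in_itv/= ?andbT ?(ltW y0)//.
by rewrite mulKf ?gt_eqF// mulNr.
Qed.

End LargeBeta.

(** * Upper and lower bounds on the partition function *)

Section PartitionBounds.
Variables (R : realType) (v : R -> \bar R) (rhc zmin zmax alpha1 alpha2 s : R).
Hypothesis hV : assumptionV v rhc zmin zmax alpha1 alpha2 s.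
Variables (d : nat) (p a : R).
Hypothesis d_gt0 : (0 < d)%N.
Hypothesis p_gt0 : 0 < p.
Local Notation m := d.+1.
Local Notation f := (vreal v).
Local Notation per := (energy_per f d p).
Hypothesis zmin_a : zmin < a.
Hypothesis a_zmax : a < zmax.
Hypothesis per1_a : per1 v d p a = 0.
Hypothesis per_a_lt0 : per a < 0.
Hypothesis per_a_min : forall y, zmin <= y <= zmax ->
  per a + convexity v zmin zmax d / 2 * (y - a) ^+ 2 <= per y.
Local Notation mu := (per2 v d a).
Local Notation H := (stage_matrix (stiff v a) mu m).
Local Notation Q := (Qn v rhc d p).

Let Hsym : forall i j, H i j = H j i. Proof. exact: stage_matrix_sym. Qed.
Let mu0 : 0 < mu. Proof. exact: (mu_gt0 hV d zmin_a a_zmax). Qed.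
Let H_ge w : mu * w 0%N ^+ 2 <= qf d.+1 H w.
Proof. by apply: stage_matrix_ge => // c cm; exact: (stiff_le0 hV zmin_a cm). Qed.

Definition limit_gain : R := gain d H (ric_lim d H).
Local Notation coo := limit_gain.

Lemma limit_gain_gt0 : 0 < coo.
Proof. exact/(gain_gt0 mu0 H_ge)/(ric_lim_nonneg Hsym mu0 H_ge). Qed.

Definition gauss_rate beta : R := Num.sqrt (2 * pi / (beta * coo)).

Lemma sqrt_ratio (b c1 beta c2 : R) : 0 < b -> 0 < c1 -> 0 < beta -> 0 < c2 ->
  Num.sqrt (2 * pi / (b * c1)) =
  Num.sqrt (2 * pi / (beta * c2)) * Num.sqrt ((beta * c2) / (b * c1)).
Proof.
move=> b0 c10 beta0 c20; rewrite -sqrtrM; last first.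
  by rewrite divr_ge0 ?mulr_ge0 ?pi_ge0 ?ltW.
congr Num.sqrt; field; rewrite !gt_eqF//.
Qed.

Lemma Qn_le eta : 0 < eta -> exists2 b0, 0 < b0 & forall beta, b0 <= beta ->
  exists2 M, 0 < M & forall n,
    (Q n beta <= (M * (expR (- (beta * per a)) * (gauss_rate beta * expR eta)) ^+ n)%:E)%E.
Proof.
move=> eta0; have c0 := limit_gain_gt0.
(* Each of the three terms of [upper_rate] may exceed its share of the Gaussian rate by the fraction
   [e]. The loss [1 - th] and the finite iterate [J] contribute a factor [1 + e] each under the
   root, hence [1 + e] in all. *)
pose e := eta / 3; have e0 : 0 < e by rewrite divr_gt0.
have e1 : 0 < 1 + e by rewrite addr_gt0.
pose th := e / (1 + e).
have th1E : 1 - th = (1 + e)^-1 by rewrite /th; field; rewrite gt_eqF.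
have th0 : 0 < th by rewrite divr_gt0.
have th1' : 0 < 1 - th by rewrite th1E invr_gt0.
have th1 : th < 1 by rewrite -subr_gt0.
have [kap [p' [kap0 p'0 lowE]]] :=
  chain_energy_ge hV p_gt0 zmin_a a_zmax per1_a per_a_lt0 per_a_min th0 th1.
have [J cJ] : exists J, coo <= (1 + e) * gain d H (ricn d H J).
  have cl : coo / (1 + e) < coo by rewrite ltr_pdivrMr// ltr_pMr// ltrDl.
  have := cvgr_gt coo (gain_cvg Hsym mu0 H_ge) _ cl.
  case=> N _ /(_ N (leqnn N)) /= h; exists N.
  by rewrite mulrC -ler_pdivrMr// ltW.
have gJ0 : 0 < gain d H (ricn d H J).
  exact/(gain_gt0 mu0 H_ge)/(ricn_nonneg Hsym mu0 H_ge).
(* [G] brings [sig mu / G] below [e] times the Gaussian rate; it does not depend on beta, and so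
   neither does the price [K] of a reset. *)
pose G := 1 + Num.sqrt (coo / ((1 - th) * mu)) / e.
have G1 : 1 <= G by rewrite lerDl divr_ge0 ?sqrtr_ge0 ?ltW.
pose K := p'^-1 * (G ^+ d * \sum_(j < J.+1) G ^+ j).
have G0 : 0 <= G by exact: le_trans G1.
have K0 : 0 <= K.
  by rewrite !mulr_ge0 ?invr_ge0 ?(ltW p'0) ?exprn_ge0// sumr_ge0// => j _; rewrite exprn_ge0.
pose eta' := e / ((1 + coo / (2 * pi)) * (1 + K)).
have pi2 : 0 < 2 * pi :> R by rewrite mulr_gt0 ?pi_gt0.
have q1 : 0 < 1 + coo / (2 * pi) by rewrite addr_gt0// divr_gt0.
have K1 : 0 < 1 + K by rewrite ltr_pwDl.
have eta'0 : 0 < eta' by rewrite divr_gt0// mulr_gt0.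
have [b0 b00 hb0] := expRN_small kap0 eta'0.
exists (b0 + 1); first by rewrite addr_gt0.
move=> beta hbeta.
have beta1 : 1 <= beta by apply: le_trans hbeta; rewrite lerDr ltW.
have beta0 : 0 < beta by exact: lt_le_trans beta1.
pose b := beta * (1 - th); have b_gt0 : 0 < b by rewrite mulr_gt0.
pose wb y := expR (- (beta * (kap + p' * y))).
have wb_ge0 y : 0 <= wb y by exact: expR_ge0.
have mwb : measurable_fun setT wb.
  apply: measurableT_comp => //; apply: measurableT_comp => //.
  apply: measurable_funM; first exact: measurable_cst.
  by apply: measurable_funD => //; apply: measurable_funM => //; exact: measurable_cst.
pose W := expR (- (kap * beta)) * p'^-1.
have W0 : 0 <= W by rewrite mulr_ge0 ?expR_ge0 ?invr_ge0// ltW.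
have intW : (\int[@lebesgue_measure R]_(y in `]0%R, +oo[) (wb y)%:E <= W%:E)%E.
  apply: (@le_trans _ _ (\int[@lebesgue_measure R]_(y in `]0%R, +oo[)
     ((expR (- (kap * beta)))%:E * (expR (- (p' * y)))%:E))%E).
    apply: integral_le => y; rewrite /= in_itv/= andbT => y0; first by rewrite lee_fin.
    rewrite -EFinM lee_fin -expRD ler_expR mulrDr opprD [beta * kap]mulrC lerD2l lerN2.
    by rewrite mulrA ler_wpM2r ?(ltW y0)// ler_peMl// ltW.
  rewrite integral_scale ?expR_gt0//.
  by rewrite EFinM lee_pmul2l ?lte_fin ?expR_gt0//; exact: integral_exp_decay_le.
have [M M0 hM] := int_good_bad_gauss_le Hsym mu0 H_ge a J b_gt0 wb_ge0 mwb W0 intW G1.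
have g0 : 0 < gauss_rate beta by rewrite sqrtr_gt0 divr_gt0// mulr_gt0.
have rate_le : upper_rate d H mu b W G J <= gauss_rate beta * expR eta.
  apply: (@le_trans _ _ (gauss_rate beta * (1 + eta))); last first.
    by rewrite ler_pM2l// expR_ge1Dx.
  have -> : gauss_rate beta * (1 + eta) =
      gauss_rate beta * (1 + e) + gauss_rate beta * e + gauss_rate beta * e.
    by rewrite /e; field.
  rewrite /upper_rate; apply: lerD; first apply: lerD.
  - rewrite (sqrt_ratio b_gt0 gJ0 beta0 c0) -/(gauss_rate beta) ler_pM2l//.
    rewrite -(ler_sqr) ?nnegrE ?sqrtr_ge0 ?(ltW e1)// sqr_sqrtr; last first.
      by rewrite divr_ge0 ?mulr_ge0 ?ltW.
    rewrite ler_pdivrMr ?mulr_gt0// /b th1E.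
    rewrite (_ : (1 + e) ^+ 2 * _ = beta * ((1 + e) * gain d H (ricn d H J))).
      by rewrite ler_pM2l.
    by field; rewrite gt_eqF.
  - rewrite (sqrt_ratio b_gt0 mu0 beta0 c0) -/(gauss_rate beta) -mulrA ler_pM2l//.
    rewrite (_ : beta * coo / (b * mu) = coo / ((1 - th) * mu)); last first.
      by rewrite /b; field; rewrite !gt_eqF.
    rewrite ler_pdivrMr ?(lt_le_trans _ G1)//.
    rewrite (_ : e * G = e + Num.sqrt (coo / ((1 - th) * mu))) ?lerDr ?(ltW e0)//.
    by rewrite /G; field; rewrite gt_eqF.
  (* The Gaussian rate decays only like the inverse square root of beta. Multiplied by a constant
     times beta it exceeds 1, which turns the small weight of bad steps into a relative error. *)
  have g_ge : (1 + coo / (2 * pi)) * beta * gauss_rate beta >= 1.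
    have q0 : 0 < beta * coo / (2 * pi) by rewrite divr_gt0// mulr_gt0.
    have sq1 : gauss_rate beta * Num.sqrt (beta * coo / (2 * pi)) = 1.
      rewrite /gauss_rate -sqrtrM; last by rewrite divr_ge0 ?mulr_ge0 ?pi_ge0 ?ltW.
      have pi0 := pi_gt0 R.
      have aux (P x y : R) : 0 < P -> 0 < x -> 0 < y -> 2 * P / (y * x) * (y * x / (2 * P)) = 1.
        by move=> ? ? ?; field; rewrite !gt_eqF.
      by rewrite aux// sqrtr1.
    rewrite -[leLHS]sq1 [leRHS]mulrC ler_pM2l//.
    apply: (@le_trans _ _ (1 + beta * coo / (2 * pi))).
      rewrite -(ler_sqr) ?nnegrE ?sqrtr_ge0 ?addr_ge0 ?(ltW q0)// sqr_sqrtr ?(ltW q0)//.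
      by rewrite sqrrD expr1n mul1r; have := sqr_ge0 (beta * coo / (2 * pi)); have := q0; lra.
    by rewrite [leRHS]mulrDl mul1r lerD// [leRHS]mulrAC [beta * _]mulrC.
  have -> : W * (G ^+ d * \sum_(j < J.+1) G ^+ j) = expR (- (kap * beta)) * K.
    by rewrite /W /K; ring.
  have h1 : beta * expR (- (kap * beta)) <= eta'.
    by apply: hb0; apply: le_trans hbeta; rewrite lerDl.
  have E0 := expR_ge0 (- (kap * beta)).
  have h2 : expR (- (kap * beta)) * K <=
      ((1 + coo / (2 * pi)) * beta * gauss_rate beta) * (expR (- (kap * beta)) * K).
    by rewrite ler_peMl// mulr_ge0.
  apply: (le_trans h2).
  have -> : ((1 + coo / (2 * pi)) * beta * gauss_rate beta) * (expR (- (kap * beta)) * K) =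
    gauss_rate beta * ((1 + coo / (2 * pi)) * K * (beta * expR (- (kap * beta)))) by ring.
  rewrite ler_pM2l//.
  apply: (@le_trans _ _ ((1 + coo / (2 * pi)) * (1 + K) * eta')).
    have A0 : 0 <= (1 + coo / (2 * pi)) * K by rewrite mulr_ge0// ltW.
    have B0 : 0 <= beta * expR (- (kap * beta)) by rewrite mulr_ge0// ltW.
    by apply: (ler_pM A0 B0 _ h1); apply: ler_wpM2l; [exact: ltW q1|rewrite lerDr].
  by rewrite /eta' mulrC divfK// gt_eqF// mulr_gt0// ltr_pwDl.
exists M => // n.
have rate0 : 0 <= upper_rate d H mu b W G J.
  rewrite /upper_rate !addr_ge0 ?sqrtr_ge0 ?divr_ge0 ?sqrtr_ge0// mulr_ge0//.
  by rewrite mulr_ge0 ?exprn_ge0// sumr_ge0// => j _; rewrite exprn_ge0.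
pose wg := fun (s : nat * (nat -> R)) (y : R) => expR (- (b / 2 * stage_cost d H mu a s y)).
apply: (@le_trans _ _ (((expR (- (beta * per a))) ^+ n)%:E *
   int_seq n (fun l => (good_bad_sum wg (extend_state a) wb (reset_state R) (reset_state R) l)%:E))%E).
  rewrite -int_seq_scale ?exprn_gt0 ?expR_gt0//; last first.
    by move=> l _; rewrite lee_fin good_bad_sum_ge0// => *; exact: expR_ge0.
  apply: int_seq_le => l [sl lp]; first by rewrite lee_fin boltzmann_ge0.
  rewrite -EFinM lee_fin /boltzmann; case: ifPn => [lr|_]; last first.
    by rewrite mulr_ge0 ?exprn_ge0 ?expR_ge0// good_bad_sum_ge0// => *; exact: expR_ge0.
  have z_gt i : (i < n)%N -> rhc < nth 0 l i by move=> i_n; apply: (all_nthP 0 lr); rewrite sl.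
  have [B hB] := lowE n (nth 0 l) z_gt.
  have pat := @pattern_le_good_bad _ _ wg (extend_state a) wb (reset_state R)
     (fun _ _ => expR_ge0 _) (fun _ => expR_ge0 _) (reset_state R) B l.
  apply: le_trans (ler_wpM2l _ pat); last by rewrite exprn_ge0 ?expR_ge0.
  have stE k : pattern_state (extend_state a) (reset_state R) (reset_state R) B (nth 0 l) k
      = chain_state a (nth 0 l) B k.
    by elim: k => //= k ->.
  rewrite -expRM_natl sl.
  have -> : \prod_(i < n) (if B i then wb (nth 0 l i) else
      wg (pattern_state (extend_state a) (reset_state R) (reset_state R) B (nth 0 l) i) (nth 0 l i))
    = expR (- (beta * \sum_(i < n) spacing_bound d a kap p' th mu (stiff v a) (nth 0 l) B i)).
    rewrite mulr_sumr -sumrN expR_sum; apply: eq_bigr => i _.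
    rewrite stE /spacing_bound; case: ifP => // _; rewrite /wg /b; congr expR.
    by rewrite !mulrA; congr (- (_ * _)); field.
  rewrite -expRD ler_expR; move: hB; rewrite big_split /= sumr_const card_ord -/(chain_energy _ _ _ _ _).
  rewrite -[per a *+ n]mulr_natl => hB.
  have := ler_wpM2l (ltW beta0) hB; rewrite mulrDr /chain_energy.
  by move=> h; rewrite mulrN -opprD lerN2 mulrCA.
apply: (@le_trans _ _ (((expR (- (beta * per a))) ^+ n)%:E *
    (upper_rate d H mu b W G J ^+ n * M)%:E)%E).
  by rewrite lee_pmul2l ?lte_fin ?exprn_gt0 ?expR_gt0//; exact: hM.
rewrite -EFinM lee_fin [leRHS]mulrC exprMn [leLHS]mulrA ler_wpM2r ?(ltW M0)//.
by rewrite ler_wpM2l ?exprn_ge0 ?expR_ge0// lerXn2r ?nnegrE// mulr_ge0 ?(ltW g0)// expR_ge0.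
Qed.

Lemma Qn_ge eta : 0 < eta -> exists2 b0, 0 < b0 & forall beta, b0 <= beta ->
  exists2 M, 0 < M & forall n,
    ((M * (expR (- (beta * per a)) * (gauss_rate beta * expR (- eta))) ^+ n)%:E <= Q n beta)%E.
Proof.
move=> eta0; have c0 := limit_gain_gt0.
have b0' : 0 < a - zmin by rewrite subr_gt0.
have [del [K [del0 dela upE]]] := chain_energy_le hV zmin_a a_zmax per1_a eta0 b0'.
have zmin0 : 0 < zmin by apply: le_lt_trans (V_hc_ge0 hV) (V_zmin_gt hV).
have del_lt : del < a by lra.
have [rho rho0 lowQ] := int_gauss_chain_ge Hsym mu0 H_ge d_gt0 del0 del_lt.
set c := gain d H _ in lowQ; have cE : c = coo by [].
pose k := coo * rho ^+ 2 / 4.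
have k0 : 0 < k by rewrite divr_gt0// mulr_gt0// exprn_gt0.
(* One half of the allowed loss, [expR (- (eta / 2))], covers the truncated Gaussian tails; the
   other covers the factor [1 + eta] in the quadratic form. *)
pose tiny := (1 - expR (- (eta / 2))) / 2.
have tiny0 : 0 < tiny.
  by rewrite divr_gt0// subr_gt0 -expR0 ltr_expR oppr_lt0 divr_gt0.
have [b0 b00 hb0] := expRN_small k0 tiny0.
have e1 : 0 < 1 + eta by rewrite addr_gt0.
exists (b0 + 1); first by rewrite addr_gt0.
move=> beta hbeta.
have beta1 : 1 <= beta by apply: le_trans hbeta; rewrite lerDr ltW.
have beta0 : 0 < beta by exact: lt_le_trans beta1.
pose b := beta * (1 + eta); have b_gt0 : 0 < b by rewrite mulr_gt0.
have [P [P0 PE hP]] := lowQ b b_gt0.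
have g0 : 0 < gauss_rate beta.
  by rewrite sqrtr_gt0 divr_gt0 ?mulr_gt0 ?pi_gt0.
have tail : 2 * expR (- (b * c * rho ^+ 2 / 4)) <= 1 - expR (- (eta / 2)).
  have h : beta * expR (- (k * beta)) <= tiny.
    by apply: hb0; apply: le_trans hbeta; rewrite lerDl.
  have h2 : expR (- (b * c * rho ^+ 2 / 4)) <= expR (- (k * beta)).
    rewrite ler_expR lerN2 cE (_ : b * coo * _ / 4 = k * beta * (1 + eta)); last first.
      by rewrite /b /k; field.
    by rewrite ler_peMr ?lerDl ?(ltW eta0)// mulr_ge0// ltW.
  have h3 : expR (- (k * beta)) <= beta * expR (- (k * beta)).
    by rewrite ler_peMl ?expR_ge0.
  by move: h; rewrite /tiny; lra.
have half0 := expR_gt0 (- (eta / 2)).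
have pos1 : 0 < 1 - 2 * expR (- (b * c * rho ^+ 2 / 4)) by lra.
have {}hP := hP pos1.
have rate_ge : gauss_rate beta * expR (- eta) <=
   Num.sqrt (2 * pi / (b * c)) * (1 - 2 * expR (- (b * c * rho ^+ 2 / 4))).
  have -> : expR (- eta) = expR (- (eta / 2)) * expR (- (eta / 2)).
    by rewrite -expRD; congr expR; field.
  rewrite mulrA; apply: ler_pM; rewrite ?mulr_ge0 ?(ltW g0) ?(ltW half0)//; last by lra.
  rewrite cE (sqrt_ratio b_gt0 c0 beta0 c0) ler_pM2l//.
  rewrite -ler_sqr ?nnegrE ?sqrtr_ge0 ?(ltW half0)// sqr_sqrtr; last first.
    by rewrite divr_ge0 ?mulr_ge0 ?ltW.
  rewrite (_ : beta * coo / (b * coo) = (1 + eta)^-1); last first.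
    by rewrite /b; field; rewrite !gt_eqF.
  rewrite -expRM_natl (_ : 2%:R * - (eta / 2) = - eta); last by field.
  by rewrite expRN lef_pV2 ?posrE ?expR_gt0// expR_ge1Dx.
exists (expR (- (beta * K))); first exact: expR_gt0.
move=> n.
apply: (@le_trans _ _ ((expR (- (beta * K)) * expR (- (beta * per a)) ^+ n)%:E *
    int_seq n (fun l => (P l)%:E))%E).
  apply: (@le_trans _ _ ((expR (- (beta * K)) * expR (- (beta * per a)) ^+ n)%:E *
    ((Num.sqrt (2 * pi / (b * c)) * (1 - 2 * expR (- (b * c * rho ^+ 2 / 4)))) ^+ n)%:E)%E).
    rewrite -EFinM lee_fin exprMn mulrA ler_wpM2l ?mulr_ge0 ?exprn_ge0 ?expR_ge0//.
    by rewrite lerXn2r ?nnegrE ?mulr_ge0 ?expR_ge0 ?sqrtr_ge0 ?(ltW g0)// ltW.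
  by rewrite lee_pmul2l ?lte_fin ?mulr_gt0 ?exprn_gt0 ?expR_gt0.
rewrite -int_seq_scale ?mulr_gt0 ?exprn_gt0 ?expR_gt0//; last first.
  by move=> l _; rewrite lee_fin.
apply: int_seq_le => l [sl lp].
  by rewrite -EFinM lee_fin !mulr_ge0 ?exprn_ge0 ?expR_ge0.
rewrite -EFinM lee_fin; have [->|nz] := eqVneq (P l) 0.
  by rewrite mulr0 boltzmann_ge0.
have [-> near] := PE l nz.
have near_i i : (i < n)%N -> `|nth 0 l i - a| <= del.
  by move=> i_n; apply: (all_nthP 0 near); rewrite sl.
have lr : all (fun y => rhc < y) l.
  apply/allP => y yl; have := allP near y yl; rewrite ler_norml => /andP[h _].
  by have := V_zmin_gt hV; lra.
rewrite /boltzmann lr -expRM_natl -!expRD ler_expR.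
have := upE n (nth 0 l) near_i; rewrite stage_sumE sl -/(chain_energy _ _ _ _ _) => h.
have := ler_wpM2l (ltW beta0) h; rewrite /chain_energy.
set E := list_energy _ _ _ _ + _; set SS := \sum_(i < n) _.
have -> : beta * (n%:R * per a + K + (1 + eta) / 2 * SS) =
   beta * K + n%:R * (beta * per a) + b / 2 * SS by rewrite /b; field.
by rewrite mulrN -!opprD lerN2.
Qed.

End PartitionBounds.

(** * The limit of large systems *)

Section Fekete.
Variable R : realType.

Lemma subadditive_mul_le (u : nat -> R) k q r :
  (forall n k, u (n + k)%N <= u n + u k) -> u (q * k + r)%N <= q%:R * u k + u r.
Proof.
move=> sub; elim: q => [|q IH]; first by rewrite mul0n mul0r !add0n add0r.
by rewrite mulSn -addnA -nat1r mulrDl mul1r -addrA; apply: le_trans (sub _ _) _; rewrite lerD2l.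
Qed.

(** Fekete's subadditive lemma; the limit is the infimum of the quotients. *)
Lemma fekete (u : nat -> R) (B : R) : (forall n k, u (n + k)%N <= u n + u k) ->
  (forall n, B * n%:R <= u n) -> cvgn (fun n => u n.+1 / n.+1%:R).
Proof.
move=> sub low; pose t n := u n.+1 / n.+1%:R.
pose A := range t; pose l := inf A.
have Alb : has_lbound A.
  by exists B => _ [n _ <-]; rewrite /t ler_pdivlMr ?ltr0n.
have Ainf : has_inf A by split => //; exists (t 0%N), 0%N.
have l_le n : l <= t n by apply: ge_inf => //; exists n.
apply/cvg_ex; exists l; apply/cvgrPdist_le => e e0.
have e20 : 0 < e / 2 by rewrite divr_gt0.
have [_ [k' _ <-] tk] := inf_adherent e20 Ainf.
rewrite -/l in tk; set k := k'.+1.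
(* After division with remainder by [k], the first summand bounds [u] at the remainder and the
   second the error from replacing the multiple of [k] by n. *)
pose M := \sum_(r < k) `|u r| + k%:R * `|t k'|.
have M0 : 0 <= M by rewrite addr_ge0 ?mulr_ge0// sumr_ge0.
near=> n; rewrite distrC ger0_norm ?subr_ge0 ?l_le//.
have n0 : 0 < n.+1%:R :> R by rewrite ltr0n.
have Mn : M / n.+1%:R <= e / 2.
  rewrite ler_pdivrMr// mulrC -ler_pdivrMr//.
  apply: le_trans (_ : n%:R <= _); last by rewrite ler_nat.
  near: n; exact: nbhs_infty_ger.
have uk : u k = k%:R * t k' by rewrite /t mulrC divfK.
have un : u n.+1 <= n.+1%:R * t k' + M.
  rewrite {1}(divn_eq n.+1 k); apply: le_trans (subadditive_mul_le k _ _ sub) _.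
  have rk : (n.+1 %% k < k)%N by rewrite ltn_mod.
  have h1 : u (n.+1 %% k)%N <= \sum_(r < k) `|u r|.
    rewrite (bigD1 (Ordinal rk))//=; apply: le_trans (ler_norm _) _.
    by rewrite lerDl sumr_ge0.
  have h2 : (n.+1 %/ k)%:R * u k = n.+1%:R * t k' - (n.+1 %% k)%:R * t k'.
    by rewrite uk mulrA -natrM {2}(divn_eq n.+1 k) natrD mulrDl addrK.
  have h3 : - ((n.+1 %% k)%:R * t k') <= k%:R * `|t k'|.
    apply: le_trans (_ : (n.+1 %% k)%:R * `|t k'| <= _).
      by rewrite -mulrN ler_wpM2l// ler_normr lexx orbT.
    by rewrite ler_wpM2r// ler_nat ltnW.
  by rewrite h2 /M; lra.
have : t n <= t k' + M / n.+1%:R.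
  by rewrite /t ler_pdivrMr// mulrDl divfK ?gt_eqF// mulrC.
rewrite -/(t n) => tn; rewrite lerBlDr (le_trans tn)//.
apply: le_trans (lerD (ltW tk) Mn) _.
by rewrite -addrA -splitr addrC.
Unshelve. all: by end_near. Qed.

End Fekete.

(** * Asymptotics of the Gibbs free energy *)

Section Gibbs.
Variables (R : realType) (v : R -> \bar R) (rhc zmin zmax alpha1 alpha2 s : R).
Hypothesis hV : assumptionV v rhc zmin zmax alpha1 alpha2 s.
Variables (d : nat) (p a : R).
Hypothesis d_gt0 : (0 < d)%N.
Hypothesis p_gt0 : 0 < p.
Local Notation m := d.+1.
Local Notation f := (vreal v).
Local Notation per := (energy_per f d p).
Hypothesis zmin_a : zmin < a.
Hypothesis a_zmax : a < zmax.
Hypothesis per1_a : per1 v d p a = 0.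
Hypothesis per_a_lt0 : per a < 0.
Hypothesis per_a_min : forall y, zmin <= y <= zmax ->
  per a + convexity v zmin zmax d / 2 * (y - a) ^+ 2 <= per y.
Local Notation Q := (Qn v rhc d p).
Local Notation gauss_rate := (gauss_rate v d a).

Lemma Qn_submul n k beta (h : R) : 0 < beta -> 0 < h -> Q k beta = h%:E ->
  (Q (n + k) beta <= (expR (- (beta * ((m * m)%:R * f zmax))) * h)%:E * Q n beta)%E.
Proof.
move=> beta0 h0 Qk; set c := expR _; have c0 : 0 < c by exact: expR_gt0.
rewrite EFinM -muleA.
apply: (@le_trans _ _ (c%:E * int_seq (n + k) (fun l =>
   (boltzmann v rhc d p n beta (take n l) * boltzmann v rhc d p k beta (drop n l))%:E))%E).
  rewrite -int_seq_scale//; last first.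
    by move=> l _; rewrite lee_fin mulr_ge0 ?boltzmann_ge0.
  apply: int_seq_le => l [sl _]; first by rewrite lee_fin boltzmann_ge0.
  by rewrite -EFinM lee_fin (boltzmann_cat hV).
rewrite lee_pmul2l ?lte_fin//; apply: int_seq_cat => //.
- by rewrite -Qk.
- by move=> l; exact: boltzmann_ge0.
- by move=> l; exact: boltzmann_ge0.
Qed.

(** The value of [limn] means something only once the sequence converges; this is Fekete's lemma for
    the logarithm of [Q], and the two bounds on [Q] then enclose the limit. *)
Lemma gibbs_asymptotics eta : 0 < eta -> exists2 b0, 0 < b0 & forall beta, b0 <= beta ->
  `|gibbs_free_energy v m p beta - (per a - beta^-1 * ln (gauss_rate beta))| <= eta * beta^-1.
Proof.
move=> eta0.
have [b1 b10 hb1] := Qn_le hV p_gt0 zmin_a a_zmax per1_a per_a_lt0 per_a_min eta0.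
have [b2 b20 hb2] := Qn_ge hV d_gt0 zmin_a a_zmax per1_a eta0.
exists (b1 + b2); first by rewrite addr_gt0.
move=> beta hbeta.
have beta0 : 0 < beta by apply: lt_le_trans hbeta; rewrite addr_gt0.
have [M1 M10 up] : exists2 M, 0 < M & forall n, (Q n beta <=
   (M * (expR (- (beta * per a)) * (gauss_rate beta * expR eta)) ^+ n)%:E)%E.
  by apply: hb1; apply: le_trans hbeta; rewrite lerDl ltW.
have [M2 M20 lo] : exists2 M, 0 < M & forall n, ((M * (expR (- (beta * per a)) *
   (gauss_rate beta * expR (- eta))) ^+ n)%:E <= Q n beta)%E.
  by apply: hb2; apply: le_trans hbeta; rewrite lerDr ltW.
have g0 : 0 < gauss_rate beta.
  rewrite sqrtr_gt0 divr_gt0 ?mulr_gt0 ?pi_gt0//.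
  exact: (limit_gain_gt0 hV d zmin_a a_zmax).
pose rate x := expR (- (beta * per a)) * (gauss_rate beta * expR x).
have rate0 x : 0 < rate x by rewrite !mulr_gt0 ?expR_gt0.
have ln_rate x : ln (rate x) = - (beta * per a) + ln (gauss_rate beta) + x.
  by rewrite /rate !lnM ?posrE ?mulr_gt0 ?expR_gt0// !expRK addrA.
pose q n := fine (Q n beta).
have Qpos n : (0 < Q n beta)%E.
  by apply: lt_le_trans (lo n); rewrite lte_fin mulr_gt0//; exact: exprn_gt0 (rate0 (- eta)).
have Qfin n : Q n beta = (q n)%:E.
  rewrite /q fineK// ge0_fin_numE ?(ltW (Qpos n))//.
  by apply: le_lt_trans (up n) _; rewrite ltry.
have q0 n : 0 < q n by have := Qpos n; rewrite Qfin lte_fin.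
have q_up n : ln (q n) <= ln M1 + n%:R * ln (rate eta).
  have := up n; rewrite Qfin lee_fin -/(rate eta) => h.
  have r0 : 0 < rate eta ^+ n by exact: exprn_gt0.
  rewrite [n%:R * _]mulr_natl -lnXn// -lnM ?posrE//.
  by rewrite ler_ln ?posrE// mulr_gt0.
have q_lo n : ln M2 + n%:R * ln (rate (- eta)) <= ln (q n).
  have := lo n; rewrite Qfin lee_fin -/(rate (- eta)) => h.
  have r0 : 0 < rate (- eta) ^+ n by exact: exprn_gt0.
  rewrite [n%:R * _]mulr_natl -lnXn// -lnM ?posrE//.
  by rewrite ler_ln ?posrE// mulr_gt0.
(* Adding the cost of the cut makes the logarithm of [Q] exactly subadditive. *)
pose C := - (beta * ((m * m)%:R * f zmax)).
pose u n := ln (q n) + C.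
have sub n k : u (n + k)%N <= u n + u k.
  have := Qn_submul n beta0 (q0 k) (Qfin k); rewrite !Qfin -EFinM lee_fin -/C.
  rewrite -ler_ln ?posrE ?mulr_gt0 ?expR_gt0// !lnM ?posrE ?mulr_gt0 ?expR_gt0// expRK /u.
  by lra.
have [B hB] : exists B, forall n, B * n%:R <= u n.
  exists (ln (rate (- eta)) - `|ln M2 + C|) => -[|n].
    have := sub 0%N 0%N; rewrite addn0 mulr0; lra.
  have := q_lo n.+1; rewrite /u mulrBl.
  have : `|ln M2 + C| <= `|ln M2 + C| * n.+1%:R by rewrite ler_peMr// ler1n.
  have : - `|ln M2 + C| <= ln M2 + C by rewrite lerNl ler_normr lexx orbT.
  by rewrite [ln (rate _) * _]mulrC; lra.
have /cvg_ex[l ul] := fekete sub hB.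
have hc : (fun n : nat => n.+1%:R^-1 : R) @ \oo --> 0 := @cvg_harmonic R.
have l_up : l <= ln (rate eta).
  have h : (fun n : nat => ln (rate eta) + (ln M1 + C) * n.+1%:R^-1) @ \oo -->
     ln (rate eta) + (ln M1 + C) * 0.
    by apply: cvgD; [exact: cvg_cst|apply: cvgMl_tmp].
  rewrite mulr0 addr0 in h; apply: (ler_cvg_to ul h); apply: nearW => n.
  rewrite ler_pdivrMr ?ltr0n// mulrDl -mulrA mulVf ?pnatr_eq0// mulr1 /u.
  by have := q_up n.+1; rewrite [n.+1%:R * _]mulrC; lra.
have l_lo : ln (rate (- eta)) <= l.
  have h : (fun n : nat => ln (rate (- eta)) + (ln M2 + C) * n.+1%:R^-1) @ \oo -->
     ln (rate (- eta)) + (ln M2 + C) * 0.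
    by apply: cvgD; [exact: cvg_cst|apply: cvgMl_tmp].
  rewrite mulr0 addr0 in h; apply: (ler_cvg_to h ul); apply: nearW => n.
  rewrite ler_pdivlMr ?ltr0n// mulrDl -mulrA mulVf ?pnatr_eq0// mulr1 /u.
  by have := q_lo n.+1; rewrite [n.+1%:R * _]mulrC; lra.
pose F N := (beta * N%:R)^-1 * ln (fine (partition_function v m p N beta)).
(* N particles have N - 1 spacings, so [F n.+2] involves [u n.+1]; the quotient of the two counts
   tends to 1. *)
have FE n : F n.+2 = beta^-1 * ((u n.+1 / n.+1%:R) * (1 - n.+2%:R^-1) - C * n.+2%:R^-1).
  rewrite /F (partition_functionE hV)// -/(q n.+1) /u -[n.+2%:R]natr1.
  have n1 : 0 < n.+1%:R :> R by rewrite ltr0n.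
  by field; rewrite !gt_eqF// addr_gt0.
have hc2 : (fun n : nat => n.+2%:R^-1 : R) @ \oo --> 0.
  by rewrite (cvg_shiftS (fun n : nat => n.+1%:R^-1 : R)).
have Fl : F @ \oo --> beta^-1 * l.
  rewrite -(cvg_shiftS F) -(cvg_shiftS (fun n => F n.+1)) /=.
  under eq_cvg do rewrite FE.
  rewrite (_ : beta^-1 * l = beta^-1 * (l * (1 - 0) - C * 0)); last by rewrite subr0 mulr1 mulr0 subr0.
  apply: cvgMl_tmp; apply: cvgB; last by apply: cvgMl_tmp.
  by apply: cvgM => //; apply: cvgB => //; exact: cvg_cst.
rewrite /gibbs_free_energy -/F (cvg_lim (@norm_hausdorff _ _) Fl).
rewrite !ln_rate in l_up l_lo.
rewrite (_ : - (beta^-1 * l) - _ =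
  (- (beta * per a) + ln (gauss_rate beta) - l) * beta^-1); last by field; rewrite gt_eqF.
rewrite normrM [`|beta^-1|]gtr0_norm ?invr_gt0// ler_wpM2r ?invr_ge0 ?(ltW beta0)//.
by rewrite ler_norml; apply/andP; split; lra.
Qed.

End Gibbs.

(** * The surface energy *)

Section SurfaceForm.
Variables (R : realType) (phi : nat -> R) (d : nat).
Local Notation m := d.+1.
Implicit Types (z : nat -> R) (n c k : nat).

(** The entries before time k, newest first. The padding by zeros lets a window overhang the
    boundary and see only what lies inside. *)
Definition past z k : nat -> R := fun j => if (j < k)%N then z (k - j.+1)%N else 0.

Lemma pastS z k : past z k.+1 = push (z k) (past z k).
Proof. by apply/funext => -[|j]; rewrite /past /= ?subn1// ltnS subSS. Qed.

Lemma past0 z : past z 0 = fun=> 0.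
Proof. exact/funext. Qed.

Definition trunc n z : nat -> R := fun i => if (i < n)%N then z i else 0.

Lemma past_trunc n z k : (k <= n)%N -> past (trunc n z) k = past z k.
Proof.
move=> kn; apply/funext => j; rewrite /past /trunc; case: ifP => // jk.
by rewrite ifT//; move: jk kn; clear; lia.
Qed.

Definition surface_form i j : R :=
  \sum_(1 <= c < m.+1) \sum_(0 <= k < (minn i j).+1 | (maxn i j < k + c)%N) phi c.

Lemma sum_indicator_window n c k z :
  \sum_(i < n) (if (k <= i < k + c)%N then z i else 0) = \sum_(j < c) trunc n z (k + j)%N.
Proof.
pose F i := if (k <= i < k + c)%N then trunc n z i else 0.
rewrite (eq_bigr (fun i : 'I_n => F i)); last first.
  by move=> i _; rewrite /F /trunc ltn_ord.
rewrite (sum_ord_widen (F := F) (leq_maxl n (k + c))); last first.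
  by move=> j nj; rewrite /F /trunc [(j < n)%N]ltnNge nj /=; case: ifP.
rewrite -(sum_ord_widen (F := F) (leq_maxr n (k + c))); last first.
  by move=> j kj; rewrite /F [(j < k + c)%N]ltnNge kj andbF.
rewrite big_split_ord /= big1 ?add0r; last first.
  by move=> i _; rewrite /F leqNgt ltn_ord.
by apply: eq_bigr => j _; rewrite /F leq_addr ltn_add2l ltn_ord.
Qed.

Lemma surface_formE n z :
  \sum_(i < n) \sum_(j < n) surface_form i j * z i * z j =
  \sum_(1 <= c < m.+1) phi c * \sum_(k < n) (\sum_(j < c) trunc n z (k + j)%N) ^+ 2.
Proof.
pose I c k i := if (k <= i < k + c)%N then z i else 0.
have S (i j : 'I_n) : surface_form i j * z i * z j =
    \sum_(1 <= c < m.+1) phi c * \sum_(k < n) I c k i * I c k j.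
  rewrite /surface_form !mulr_suml; apply: eq_bigr => c _.
  rewrite big_mkcond /= big_mkord -mulrA mulr_suml mulr_sumr.
  pose F k := (if (maxn i j < k + c)%N && (k < (minn i j).+1)%N then phi c else 0) * (z i * z j).
  rewrite (eq_bigr (fun k : 'I_(minn i j).+1 => F k)); last first.
    by move=> k _; rewrite /F ltn_ord andbT.
  rewrite (sum_ord_widen (F := F) (N := n)); last 2 first.
  - exact: leq_ltn_trans (geq_minl i j) (ltn_ord i).
  - by move=> k hk; rewrite /F [(k < _)%N]ltnNge hk andbF mul0r.
  apply: eq_bigr => k _; rewrite /F /I gtn_max ltnS leq_min.
  case: (leqP k i) => ki; case: (leqP k j) => kj; case: (ltnP i (k + c)) => ic;
    case: (ltnP j (k + c)) => jc; rewrite /= ?mul0r ?mulr0//.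
under eq_bigr do under eq_bigr do rewrite S.
under eq_bigr do rewrite exchange_big /=.
rewrite exchange_big /=; apply: eq_bigr => c _.
under eq_bigr do rewrite -mulr_sumr exchange_big /=.
rewrite -mulr_sumr exchange_big /=; congr (_ * _); apply: eq_bigr => k _.
rewrite -sum_indicator_window expr2 mulr_suml; apply: eq_bigr => i _.
by rewrite mulr_sumr.
Qed.

Lemma past_window_inner c k z :
  \sum_(j < c) past z (k + c) j = \sum_(j < c) z (k + j)%N.
Proof.
rewrite (reindex_inj rev_ord_inj) /=; apply: eq_bigr => j _; rewrite /past.
have jc := ltn_ord j; rewrite ifT; last by move: jc; clear; lia.
by congr z; move: jc; clear; lia.
Qed.

Lemma past_window_crossing c k z : (k <= c)%N ->
  \sum_(j < c) past z k j = \sum_(j < k) z j.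
Proof.
move=> kc; rewrite -(sum_ord_widen (F := past z k) kc); last first.
  by move=> j kj; rewrite /past ltnNge kj.
rewrite (reindex_inj rev_ord_inj) /=; apply: eq_bigr => j _; rewrite /past.
have jk := ltn_ord j; rewrite ifT; last by move: jk; clear; lia.
by congr z; move: jk; clear; lia.
Qed.

(** The windows of length c that overhang the boundary, sorted by the number [k.+1 < c] of spacings
    inside. *)
Definition crossing_form z : R :=
  \sum_(1 <= c < m.+1) phi c * \sum_(k < c.-1) (\sum_(i < k.+1) z i) ^+ 2.

(** Windows are sorted by their last spacing: the first [c.-1] of them overhang the boundary, and
    the others are the intervals of the surface energy. The m extra steps let every window that
    meets the truncated sequence come to its end. *)
Lemma window_sq_sum n z : (d <= n)%N ->
  \sum_(k < n + m) \sum_(1 <= c < m.+1) phi c * (\sum_(j < c) past (trunc n z) k.+1 j) ^+ 2 =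
  \sum_(i < n) \sum_(j < n) surface_form i j * z i * z j + crossing_form z.
Proof.
move=> dn; rewrite surface_formE /crossing_form -big_split /= exchange_big /=.
apply: eq_big_nat => c /andP[c1 cm]; rewrite -mulr_sumr -mulrDr; congr (_ * _).
rewrite (_ : (n + m = c.-1 + (n + (m - c).+1))%N); last by move: c1 cm; clear; lia.
rewrite big_split_ord /= addrC; congr (_ + _); last first.
  apply: eq_bigr => k _; rewrite past_window_crossing; last first.
    by have := ltn_ord k; clear; lia.
  congr (_ ^+ 2); apply: eq_bigr => i _; rewrite /trunc ifT//.
  by move: (ltn_ord i) (ltn_ord k) dn cm; clear; rewrite ltnS; lia.
rewrite big_split_ord /= [X in _ + X]big1 ?addr0 => [|k _].
  apply: eq_bigr => k _; rewrite (_ : (c.-1 + k).+1 = (k + c)%N); last first.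
    by move: c1; clear; lia.
  by rewrite past_window_inner.
rewrite (_ : (c.-1 + (n + k)).+1 = (n + k + c)%N); last by move: c1; clear; lia.
rewrite past_window_inner big1 ?expr0n// => j _.
by rewrite /trunc ifF//; apply/negbTE; rewrite -leqNgt -addnA leq_addr.
Qed.

Variable mu : R.
Hypothesis mu_gt0 : 0 < mu.
Hypothesis muE : mu = \sum_(1 <= c < m.+1) c%:R ^+ 2 * phi c.
Hypothesis phi_le0 : forall c, (2 <= c <= m)%N -> phi c <= 0.
Local Notation H := (stage_matrix phi mu m).

Let Hsym : forall i j, H i j = H j i. Proof. exact: stage_matrix_sym. Qed.
Let H_ge w : mu * w 0%N ^+ 2 <= qf m H w.
Proof. exact: stage_matrix_ge. Qed.

Local Notation coo := (gain d H (ric_lim d H)).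

Definition innovation z k : R := z k + drift d H (ric_lim d H) (past z k).

Lemma gain_lim_gt0 : 0 < coo.
Proof. exact/(gain_gt0 mu_gt0 H_ge)/(ric_lim_nonneg Hsym mu_gt0 H_ge). Qed.

Lemma crossing_form_le0 z : crossing_form z <= 0.
Proof.
rewrite /crossing_form big_nat_cond; apply: sumr_le0 => -[|[|c]] /andP[cm _] //.
  by rewrite big_ord0 mulr0.
apply: mulr_le0_ge0; first exact: phi_le0.
by apply: sumr_ge0 => k _; exact: sqr_ge0.
Qed.

Lemma stage_sum_innovation z n :
  \sum_(k < n) qf m H (past z k.+1) + qf d (ric_lim d H) (past z n) =
  coo * \sum_(k < n) innovation z k ^+ 2.
Proof.
elim: n => [|n IH]; first by rewrite !big_ord0 mulr0 past0 qf0 addr0.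
rewrite big_ord_recr /= pastS [in RHS]big_ord_recr /= mulrDr -IH -!addrA; congr (_ + _).
exact: (ric_lim_square Hsym mu_gt0 H_ge).
Qed.

Let sq (x : R) := x ^+ 2.

(** The identity [muE] is what makes the squares telescope: the coefficient of the newest square is
    the sum of all [c ^+ 2 * phi c]. *)
Lemma stage_sum_windows z n :
  \sum_(k < n) qf m H (past z k.+1) =
  \sum_(k < n) \sum_(1 <= c < m.+1) phi c * (\sum_(j < c) past z k.+1 j) ^+ 2
  + \sum_(1 <= c < m.+1) phi c * c%:R * potential sq c (past z n).
Proof.
elim: n => [|n IH].
  rewrite !big_ord0 add0r big1// => c _; rewrite past0 potential_const ?mulr0//.
  by rewrite /sq expr0n.
rewrite [LHS]big_ord_recr /= IH [in RHS]big_ord_recr /= -!addrA; congr (_ + _).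
rewrite pastS stage_matrixE// -(sum_deficit phi)// /=.
rewrite {1}muE mulr_suml addrA -big_split -sumrB -big_split /=; apply: eq_bigr => c _.
have h : \sum_(j < c) push (z n) (past z n) j ^+ 2 = c%:R * sq (z n) +
    potential sq c (past z n) - potential sq c (push (z n) (past z n)) := sum_window sq c _ _.
by rewrite /deficit h /sq; ring.
Qed.

(** Two expressions for the total stage cost are equated. At time [n + m] only zeros of the
    truncated sequence remain in the history, so all end terms vanish. *)
Lemma surface_innovation n z : (d <= n)%N ->
  \sum_(i < n) \sum_(j < n) surface_form i j * z i * z j + crossing_form z =
  coo * \sum_(k < n + m) innovation (trunc n z) k ^+ 2.
Proof.
move=> dn; rewrite -window_sq_sum// -stage_sum_innovation stage_sum_windows.
have pz j : (j < m)%N -> past (trunc n z) (n + m) j = 0.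
  move=> jm; rewrite /past; case: ifP => // _; rewrite /trunc ifF//.
  by apply/negbTE; rewrite -leqNgt; move: jm; clear; lia.
rewrite [X in _ + X + _]big_nat_cond [X in _ + X + _]big1 => [|c /andP[/andP[_ cm] _]].
  rewrite addr0 (@eq_qf _ d _ _ (fun=> 0)) ?qf0 ?addr0// => i id.
  by apply: pz; exact: ltnW.
rewrite /potential big1 ?mulr0// => j _; rewrite pz; last exact: leq_trans (ltn_ord j) cm.
by rewrite /sq expr0n mulr0.
Qed.

(** Coercivity is inherited from the stage costs, as the overhanging windows have a nonpositive
    form. *)
Lemma surface_form_ge n z : (d <= n)%N ->
  mu * \sum_(i < n) z i ^+ 2 <= \sum_(i < n) \sum_(j < n) surface_form i j * z i * z j.
Proof.
move=> dn; have e := surface_innovation z dn.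
have c := crossing_form_le0 z.
have h := stage_sum_innovation (trunc n z) (n + m).
have q0 := ric_lim_nonneg Hsym mu_gt0 H_ge (past (trunc n z) (n + m)).
have : mu * \sum_(i < n) z i ^+ 2 <= \sum_(k < n + m) qf m H (past (trunc n z) k.+1).
  rewrite mulr_sumr big_split_ord /= -[leLHS]addr0; apply: lerD.
    apply: ler_sum => i _; apply: le_trans (H_ge _).
    by rewrite pastS /= /trunc ltn_ord.
  by apply: sumr_ge0 => i _; exact: (H_nonneg mu_gt0 H_ge).
move: e c h q0; lra.
Qed.

End SurfaceForm.

(** * Partial minimization of the surface energy *)

Section ReducedForm.
Variables (R : realType) (phi : nat -> R) (d : nat) (mu : R).
Local Notation m := d.+1.
Hypothesis mu_gt0 : 0 < mu.
Hypothesis muE : mu = \sum_(1 <= c < m.+1) c%:R ^+ 2 * phi c.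
Hypothesis phi_le0 : forall c, (2 <= c <= m)%N -> phi c <= 0.
Local Notation H := (stage_matrix phi mu m).
Local Notation A := (ric_lim d H).
Local Notation coo := (gain d H A).
Local Notation innov := (innovation phi d mu).
Local Notation S := (surface_form phi d).
Implicit Types x z : nat -> R.

Let Hsym : forall i j, H i j = H j i. Proof. exact: stage_matrix_sym. Qed.
Let H_ge w : mu * w 0%N ^+ 2 <= qf m H w.
Proof. exact: stage_matrix_ge. Qed.
Let coo_gt0 : 0 < coo. Proof. exact: gain_lim_gt0. Qed.

Lemma drift_sq_le : exists2 K, 0 <= K &
  forall x, drift d H A x ^+ 2 <= K * \sum_(i < d) x i ^+ 2.
Proof.
pose c i := stage_form d H A 0 i.+1 / coo.
pose B := \sum_(i < d) \sum_(j < d) `|c i * c j|.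
have B0 : 0 <= B by rewrite sumr_ge0// => ? _; rewrite sumr_ge0.
exists (d%:R * B); first by rewrite mulr_ge0.
move=> x; apply: le_trans (_ : qf d (fun i j => c i * c j) x <= _); last first.
  apply: qf_le_sq => i j hi hj.
  rewrite /B (bigD1 (Ordinal hi))//= (bigD1 (Ordinal hj))//= -addrA lerDl.
  by rewrite addr_ge0// sumr_ge0// => ? _; rewrite sumr_ge0.
rewrite le_eqVlt; apply/orP; left; apply/eqP.
rewrite expr2 {1}/drift mulr_suml; apply: eq_bigr => i _.
by rewrite /drift mulr_sumr; apply: eq_bigr => j _; rewrite -/(c i) -/(c j); ring.
Qed.

Lemma sum_past_sq_le z i n : \sum_(k < n) past z k i ^+ 2 <= \sum_(k < n) z k ^+ 2.
Proof.
elim: n => [|n IH]; first by rewrite !big_ord0.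
have [ni|i_n] := leqP n i.
  rewrite big1 ?sumr_ge0// => [|k _]; first by move=> k _; exact: sqr_ge0.
  rewrite /past ifF ?expr0n//; apply/negbTE; rewrite -leqNgt.
  by apply: leq_trans ni; rewrite -ltnS.
rewrite (_ : n.+1 = i.+1 + (n - i))%N; last by move: i_n; clear; lia.
rewrite big_split_ord /= big1 ?add0r => [|k _]; last first.
  by rewrite /past ltnNge -ltnS ltn_ord expr0n.
rewrite -(_ : n.+1 = i.+1 + (n - i))%N; last by move: i_n; clear; lia.
rewrite (big_ord_widen n.+1 (fun k => past z (i.+1 + k) i ^+ 2)); last first.
  by move: i_n; clear; lia.
rewrite big_mkcond; apply: ler_sum => k _; case: ifP => _; last exact: sqr_ge0.
by rewrite /past leq_addr addKn.
Qed.

Lemma innov_series_cvg z : ell2 z -> cvgn (fun n => \sum_(k < n) innov z k ^+ 2).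
Proof.
move=> ez; have [K K0 hK] := drift_sq_le.
apply: nondecreasing_is_cvgn.
  by apply/nondecreasing_seqP => n; rewrite big_ord_recr lerDl sqr_ge0.
have [L zL] : exists L, forall n, \sum_(k < n) z k ^+ 2 <= L.
  exists (limn (series (fun i => z i ^+ 2))) => n.
  have := nondecreasing_cvgn_le _ ez n; rewrite /series /= big_mkord; apply.
  by apply/nondecreasing_seqP => k; rewrite /series /= !big_mkord big_ord_recr lerDl sqr_ge0.
exists (2 * L + 2 * (K * (d%:R * L))) => _ [n _ <-].
apply: (@le_trans _ _ (\sum_(k < n) (2 * z k ^+ 2 + 2 * (K * \sum_(i < d) past z k i ^+ 2)))).
  apply: ler_sum => k _; have := hK (past z k); rewrite /innovation.
  move: (K * _) => X; set y := drift _ _ _ _ => h.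
  by have := sqr_ge0 (z k - y); rewrite sqrrB sqrrD; lra.
rewrite big_split /= -!mulr_sumr exchange_big /=; apply: lerD.
  by apply: ler_wpM2l => //; exact: zL.
apply: ler_wpM2l => //; apply: ler_wpM2l => //.
rewrite mulr_natl -[X in _ *+ X]card_ord -sumr_const; apply: ler_sum => i _.
exact: le_trans (sum_past_sq_le z i n) (zL n).
Qed.

(** Truncation creates m further innovations. They see only entries of [z] with index at least n,
    and [e n], an increment of a convergent series, bounds their squares. *)
Lemma tail_innov_cvg0 z : ell2 z ->
  (fun n => \sum_(k < m) innov (trunc (n + d) z) (n + d + k)%N ^+ 2) @ \oo --> 0.
Proof.
move=> ez; have [K K0 hK] := drift_sq_le.
pose u := series (fun i => z i ^+ 2).
pose e n := u (n + d)%N - u n.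
have e0 : e @ \oo --> 0.
  rewrite -(subrr (limn u)); apply: cvgB; last exact: ez.
  by rewrite (cvg_shiftn d u); exact: ez.
have eE n : e n = \sum_(n <= i < n + d) z i ^+ 2.
  by rewrite /e /u /series /= (big_cat_nat (n := n)) ?leq_addr//= addrAC subrr add0r.
have term n k j : (j < d)%N -> past (trunc (n + d) z) (n + d + k) j ^+ 2 <= e n.
  move=> jd; rewrite eE; have sum0 : 0 <= \sum_(n <= i < n + d) z i ^+ 2.
    by rewrite sumr_ge0// => i _; exact: sqr_ge0.
  rewrite /past; case: ifP => _; last by rewrite expr0n.
  rewrite /trunc; case: ifP => hi; last by rewrite expr0n.
  set i := (n + d + k - j.+1)%N in hi *.
  have ni : (n <= i)%N by rewrite /i; move: jd; clear; lia.
  rewrite (big_cat_nat (n := i))//=; last exact: ltnW.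
  rewrite [X in _ + X]big_ltn// addrCA lerDl addr_ge0// sumr_ge0// => q _; exact: sqr_ge0.
have bound n : 0 <= \sum_(k < m) innov (trunc (n + d) z) (n + d + k)%N ^+ 2 <=
    m%:R * (K * d%:R) * e n.
  rewrite sumr_ge0/= => [|k _]; last exact: sqr_ge0.
  rewrite -mulrA mulr_natl -[X in _ *+ X]card_ord -sumr_const; apply: ler_sum => k _.
  rewrite /innovation {1}/trunc ltnNge leq_addr /= add0r.
  apply: le_trans (hK _) _; rewrite -mulrA ler_wpM2l//.
  rewrite mulr_natl -[X in _ *+ X]card_ord -sumr_const; apply: ler_sum => j _.
  exact: term.
apply: (@squeeze_cvgr _ _ _ _ (fun=> 0) (fun n => m%:R * (K * d%:R) * e n)).
- by apply: nearW => n; exact: bound.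
- exact: cvg_cst.
- by rewrite -(mulr0 (m%:R * (K * d%:R))); apply: cvgMl_tmp.
Qed.

Lemma quad_form_cvg z : ell2 z ->
  (fun n => \sum_(i < n) \sum_(j < n) S i j * z i * z j) @ \oo -->
  coo * limn (fun n => \sum_(k < n) innov z k ^+ 2) - crossing_form phi d z.
Proof.
move=> ez; set L := limn _.
rewrite -(cvg_shiftn d).
have -> : [sequence \sum_(i < (n + d)%N) \sum_(j < (n + d)%N) S i j * z i * z j]_n =
    (fun n => coo * (\sum_(k < n + d) innov z k ^+ 2 +
      \sum_(k < m) innov (trunc (n + d) z) (n + d + k)%N ^+ 2) - crossing_form phi d z).
  apply/funext => n /=.
  have := surface_innovation mu_gt0 muE phi_le0 z (leq_addl n d).
  move=> /(canRL (addrK _)) ->; congr (_ * _ - _).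
  rewrite big_split_ord /=; congr (_ + _); apply: eq_bigr => k _.
  rewrite /innovation past_trunc ?(ltnW (ltn_ord k))//.
  by rewrite {1}/trunc ltn_ord.
apply: cvgB; last exact: cvg_cst.
rewrite -[L]addr0; apply: cvgMl_tmp; apply: cvgD; last exact: tail_innov_cvg0.
by rewrite (cvg_shiftn d (fun n => \sum_(k < n) innov z k ^+ 2)); exact: innov_series_cvg.
Qed.

Definition completed_form z : R :=
  coo * \sum_(k < d) innov z k ^+ 2 - crossing_form phi d z.

Lemma quad_form_ge z : ell2 z -> completed_form z <= quad_form S z.
Proof.
move=> ez; rewrite /quad_form (cvg_lim (@norm_hausdorff _ _) (quad_form_cvg ez)).
rewrite lerD2r ler_wpM2l ?(ltW coo_gt0)//.
apply: (nondecreasing_cvgn_le _ (innov_series_cvg ez) d).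
by apply/nondecreasing_seqP => n; rewrite big_ord_recr lerDl sqr_ge0.
Qed.

(* The minimizer continues [x] so that all later innovations vanish. *)
Fixpoint optimal_past (x : nat -> R) k : nat -> R :=
  if k is k'.+1 then
    push (if (k' < d)%N then x k' else - drift d H A (optimal_past x k')) (optimal_past x k')
  else fun=> 0.

Definition optimal x k : R := optimal_past x k.+1 0%N.

Lemma past_optimal x k : past (optimal x) k = optimal_past x k.
Proof. by elim: k => [|k IH]; rewrite ?past0// pastS IH. Qed.

Lemma optimal_lt x k : (k < d)%N -> optimal x k = x k.
Proof. by move=> kd; rewrite /optimal /= kd. Qed.

Lemma innov_optimal x k : (d <= k)%N -> innov (optimal x) k = 0.
Proof.
by move=> dk; rewrite /innovation past_optimal /optimal /= ltnNge dk /= addNr.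
Qed.

Lemma sum_innov_optimal x n : (d <= n)%N ->
  \sum_(k < n) innov (optimal x) k ^+ 2 = \sum_(k < d) innov (optimal x) k ^+ 2.
Proof.
move=> dn; rewrite -(sum_ord_widen (F := fun k => innov (optimal x) k ^+ 2) dn)//.
by move=> j dj; rewrite innov_optimal// expr0n.
Qed.

(** The minimizer is defined by a recursion without evident decay. Its squares are bounded by the
    stage costs, whose sum is at most [coo] times the squared innovations, and only d of these are
    nonzero. *)
Lemma optimal_ell2 x : ell2 (optimal x).
Proof.
apply: nondecreasing_is_cvgn.
  by apply/nondecreasing_seqP => n; rewrite /series /= !big_mkord big_ord_recr lerDl sqr_ge0.
exists (mu^-1 * (coo * \sum_(k < d) innov (optimal x) k ^+ 2)) => _ [n _ <-].
rewrite /series /= big_mkord -ler_pdivrMl ?invr_gt0// invrK.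
pose N := maxn n d.
apply: (@le_trans _ _ (mu * \sum_(k < N) optimal x k ^+ 2)).
  rewrite ler_wpM2l ?(ltW mu_gt0)//.
  rewrite (big_ord_widen N (fun k => optimal x k ^+ 2) (leq_maxl n d)) big_mkcond.
  by apply: ler_sum => k _; case: ifP => // _; exact: sqr_ge0.
rewrite -(sum_innov_optimal x (leq_maxr n d)) -stage_sum_innovation//.
rewrite -[leLHS]addr0; apply: lerD; last exact: (ric_lim_nonneg Hsym mu_gt0 H_ge).
rewrite mulr_sumr; apply: ler_sum => k _; apply: le_trans (H_ge _).
by rewrite pastS.
Qed.

Lemma quad_form_optimal x : quad_form S (optimal x) = completed_form (optimal x).
Proof.
rewrite /quad_form (cvg_lim (@norm_hausdorff _ _) (quad_form_cvg (@optimal_ell2 x))).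
rewrite /completed_form; congr (_ * _ - _); apply/cvg_lim => //.
rewrite -(cvg_shiftn d); apply: cvg_near_cst; apply: nearW => n /=.
by rewrite sum_innov_optimal// leq_addl.
Qed.

Lemma eq_completed_form x z : (forall i, (i < d)%N -> z i = x i) ->
  completed_form z = completed_form x.
Proof.
move=> zx; rewrite /completed_form; congr (_ * _ - _).
  apply: eq_bigr => k _; rewrite /innovation zx//; congr ((_ + _) ^+ 2).
  apply: eq_bigr => i _; congr (_ * _); rewrite /past; case: ifP => // _.
  by rewrite zx// (leq_ltn_trans (leq_subr _ _)).
apply: eq_big_nat => c /andP[c1 cm]; congr (_ * _); apply: eq_bigr => k _.
congr (_ ^+ 2); apply: eq_bigr => i _; apply: zx.
by move: (ltn_ord i) (ltn_ord k) c1 cm; clear; rewrite !ltnS; lia.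
Qed.

(** The coercivity of the surface energy at the minimizer; it makes the reduced matrix
    positive-definite. *)
Lemma completed_form_ge x : mu * \sum_(i < d) x i ^+ 2 <= completed_form x.
Proof.
have xo : forall i, (i < d)%N -> optimal x i = x i by move=> i; exact: optimal_lt.
rewrite -(eq_completed_form xo) -quad_form_optimal.
have cv : (fun n => \sum_(i < n) \sum_(j < n) S i j * optimal x i * optimal x j) @ \oo -->
    quad_form S (optimal x).
  by apply/cvg_ex; eexists; exact: quad_form_cvg (@optimal_ell2 x).
apply: (ler_cvg_to (cvg_cst _) cv); near=> n.
have dn : (d <= n)%N by near: n; exact: nbhs_infty_ge.
apply: le_trans (surface_form_ge mu_gt0 muE phi_le0 _ dn).
rewrite ler_wpM2l ?(ltW mu_gt0)//.
rewrite (big_ord_widen n (fun k => x k ^+ 2) dn) big_mkcond.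
by apply: ler_sum => k _; case: ifP => [kd|_]; rewrite ?sqr_ge0// optimal_lt.
Unshelve. all: by end_near. Qed.

Lemma inf_quad_form (x : nat -> R) (T : set (nat -> R)) :
  (forall z, T z <-> ell2 z /\ forall i, (i < d)%N -> z i = x i) ->
  inf [set quad_form S z | z in T] = completed_form x.
Proof.
move=> TE.
have xo : forall i, (i < d)%N -> optimal x i = x i by move=> i; exact: optimal_lt.
have T0 : T (optimal x) by apply/TE; split; [exact: optimal_ell2|].
have lb y : [set quad_form S z | z in T] y -> completed_form x <= y.
  by move=> [z /TE[ez zx] <-]; rewrite -(eq_completed_form zx); exact: quad_form_ge.
have mem : [set quad_form S z | z in T] (completed_form x).
  by exists (optimal x) => //; rewrite quad_form_optimal (eq_completed_form xo).
apply/le_anti/andP; split.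
  by apply: ge_inf => //; exists (completed_form x) => y; exact: lb.
by apply: lb_le_inf; [exists (completed_form x)|exact: lb].
Qed.

End ReducedForm.

(** * The stiffness matrix *)

Section ColumnVectors.
Variables (R : realType) (d : nat).

Definition entries (x : 'cV[R]_d) (i : nat) : R :=
  if insub i is Some j then x j 0 else 0.

Lemma entriesE (x : 'cV[R]_d) (i : 'I_d) : entries x i = x i 0.
Proof. by rewrite /entries valK. Qed.

Lemma mx_formE (A : 'M[R]_d) (x : 'cV[R]_d) :
  (x^T *m A *m x) 0 0 = \sum_(i < d) \sum_(j < d) A i j * entries x i * entries x j.
Proof.
rewrite mxE exchange_big /=; apply: eq_bigr => j _.
rewrite mxE mulr_suml; apply: eq_bigr => i _.
by rewrite mxE !entriesE; ring.
Qed.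

Lemma mx_form_basis (A : 'M[R]_d) (i j : 'I_d) (x := delta_mx i 0 + delta_mx j 0 : 'cV[R]_d) :
  (x^T *m A *m x) 0 0 = A i i + A j j + (A i j + A j i).
Proof.
have e (B : 'M[R]_d) (k l : 'I_d) :
    ((delta_mx k 0 : 'cV[R]_d)^T *m B *m (delta_mx l 0 : 'cV[R]_d)) 0 0 = B k l.
  by rewrite trmx_delta -rowE -colE !mxE.
rewrite (_ : x^T = (delta_mx i 0)^T + (delta_mx j 0)^T); last exact: raddfD.
rewrite /x !mulmxDl !mulmxDr [LHS]mxE [X in X + _]mxE [X in _ + X]mxE !e; ring.
Qed.

Lemma symmetric_form_inj (A B : 'M[R]_d) : A^T = A -> B^T = B ->
  (forall x : 'cV[R]_d, (x^T *m A *m x) 0 0 = (x^T *m B *m x) 0 0) -> A = B.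
Proof.
move=> sA sB h; apply/matrixP => i j.
have sAij : A j i = A i j by rewrite -{1}sA mxE.
have sBij : B j i = B i j by rewrite -{1}sB mxE.
have dg k : A k k = B k k.
  by have := h (delta_mx k 0 + delta_mx k 0); rewrite !mx_form_basis; lra.
have := h (delta_mx i 0 + delta_mx j 0).
by rewrite !mx_form_basis sAij sBij (dg i) (dg j); lra.
Qed.

End ColumnVectors.

Section StiffnessMatrix.
Variables (R : realType) (phi : nat -> R) (d : nat) (mu : R).
Local Notation m := d.+1.
Hypothesis mu_gt0 : 0 < mu.
Hypothesis muE : mu = \sum_(1 <= c < m.+1) c%:R ^+ 2 * phi c.
Hypothesis phi_le0 : forall c, (2 <= c <= m)%N -> phi c <= 0.
Local Notation H := (stage_matrix phi mu m).
Local Notation A := (ric_lim d H).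
Local Notation coo := (gain d H A).

(** The unit lower triangular matrix U of the overview. In row k, [z_j] stands at position
    [k - j - 1] of the past, and position 0 of the stage form belongs to the newest entry, hence the
    index [k - j]. *)
Definition innovation_mx : 'M[R]_d := \matrix_(k, j)
  (if j == k then 1 else if (j < k)%N then stage_form d H A 0 (k - j) / coo else 0).

Definition full_mx : 'M[R]_d := coo *: (innovation_mx^T *m innovation_mx).

Definition crossing_mx : 'M[R]_d := \matrix_(i, j)
  \sum_(1 <= c < m.+1) phi c * \sum_(k < c.-1) (if (i <= k)%N && (j <= k)%N then 1 else 0).

Lemma det_full_mx : \det full_mx = coo ^+ d.
Proof.
rewrite /full_mx detZ det_mulmx det_tr det_trig.
  by rewrite big1 ?mulr1// => i _; rewrite mxE eqxx.
apply/is_trig_mxP => i j ij; rewrite mxE ifN; first by rewrite ltnNge (ltnW ij).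
by rewrite neq_ltn ij orbT.
Qed.

Lemma innovation_mxE (x : 'cV[R]_d) (k : 'I_d) :
  innovation phi d mu (entries x) k = (innovation_mx *m x) k 0.
Proof.
rewrite mxE (bigD1 k)//= mxE eqxx mul1r -entriesE /innovation; congr (_ + _).
pose F j := if (j < k)%N then stage_form d H A 0 (k - j) / coo * entries x j else 0.
rewrite [RHS](_ : _ = \sum_(j < k) F j); last first.
  rewrite (sum_ord_widen (F := F) (ltnW (ltn_ord k))); last first.
    by move=> j kj; rewrite /F ltnNge kj.
  rewrite [RHS](bigD1 k)//= {1}/F ltnn add0r; apply: eq_bigr => j /negbTE jk.
  by rewrite mxE jk /F entriesE; case: ifP => // _; rewrite mul0r.
pose G j := stage_form d H A 0 j.+1 / coo * past (entries x) k j.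
rewrite /drift (eq_bigr (fun j : 'I_d => G j))// -(sum_ord_widen (F := G) (ltnW (ltn_ord k))).
  rewrite (reindex_inj rev_ord_inj) /=; apply: eq_bigr => j _.
  have jk := ltn_ord j; rewrite /F /G /past jk ifT; last by move: jk; clear; lia.
  by congr (_ / _ * entries x _); [congr stage_form|]; move: jk; clear; lia.
by move=> j kj; rewrite /G /past ltnNge kj mulr0.
Qed.

Lemma crossing_mx_form (x : 'cV[R]_d) :
  (x^T *m crossing_mx *m x) 0 0 = crossing_form phi d (entries x).
Proof.
rewrite mx_formE /crossing_form.
under eq_bigr do under eq_bigr do rewrite mxE !mulr_suml.
under eq_bigr do rewrite exchange_big /=.
rewrite exchange_big /=; apply: eq_big_nat => c /andP[c1 cm].
have kd (k : 'I_c.-1) : (k < d)%N.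
  by apply: leq_trans (ltn_ord k) _; move: c1 cm; clear; lia.
under eq_bigr do under eq_bigr do rewrite -mulrA -mulrA mulr_suml.
under eq_bigr do rewrite -mulr_sumr exchange_big /=.
rewrite -mulr_sumr exchange_big /=; congr (_ * _); apply: eq_bigr => k _.
pose F (i : nat) := if (i <= k)%N then entries x i else 0.
have -> : \sum_(i < k.+1) entries x i = \sum_(i < d) F i.
  rewrite -(sum_ord_widen (F := F) (kd k)); last by move=> j kj; rewrite /F leqNgt kj.
  by apply: eq_bigr => i _; rewrite /F -ltnS ltn_ord.
rewrite expr2 mulr_suml; apply: eq_bigr => i _.
rewrite mulr_sumr; apply: eq_bigr => j _; rewrite /F.
by case: (i <= k)%N; case: (j <= k)%N; rewrite /= ?mul0r ?mul1r ?mulr0.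
Qed.

Lemma full_mx_form (x : 'cV[R]_d) : (x^T *m full_mx *m x) 0 0 =
  coo * \sum_(k < d) innovation phi d mu (entries x) k ^+ 2.
Proof.
rewrite /full_mx -scalemxAr -scalemxAl mxE; congr (_ * _).
rewrite mulmxA -trmx_mul -mulmxA mxE; apply: eq_bigr => k _.
by rewrite [_^T 0 k]mxE -innovation_mxE expr2.
Qed.

Lemma reduced_mx_form (x : 'cV[R]_d) :
  (x^T *m (full_mx - crossing_mx) *m x) 0 0 = completed_form phi d mu (entries x).
Proof.
rewrite mulmxBr mulmxBl [LHS]mxE full_mx_form [X in _ + X]mxE crossing_mx_form.
by [].
Qed.

(** [crossing_mx] will turn out to be the Hessian of the interaction, so that adding it in the
    stiffness matrix leaves [full_mx], whose determinant is known. *)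
Lemma is_reduced_full : is_reduced_matrix (surface_form phi d) (full_mx - crossing_mx).
Proof.
split; first split.
- rewrite linearB /= /full_mx linearZ /= trmx_mul trmxK; congr (_ - _).
  apply/matrixP => i j; rewrite !mxE; apply: eq_bigr => c _; congr (_ * _).
  by apply: eq_bigr => k _; rewrite andbC.
- move=> x x0; rewrite reduced_mx_form.
  apply: lt_le_trans (completed_form_ge mu_gt0 muE phi_le0 _).
  rewrite mulr_gt0// lt_neqAle eq_sym sumr_ge0 ?andbT => [|i _]; last exact: sqr_ge0.
  rewrite psumr_neq0 => [|i _]; last exact: sqr_ge0.
  have [/existsP[i xi]|/existsPn h] := boolP [exists i, x i 0 != 0].
    apply/hasP; exists i; rewrite ?mem_index_enum//= entriesE.
    by rewrite lt_neqAle sqr_ge0 andbT eq_sym sqrf_eq0.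
  exfalso; move: x0 => /eqP; apply; apply/colP => i; rewrite mxE.
  by apply/eqP; have := h i; rewrite negbK.
- move=> x; rewrite reduced_mx_form; apply/esym; apply: (inf_quad_form mu_gt0 muE phi_le0).
  move=> z; split=> -[ez zx]; split=> // i.
    by move=> id; rewrite (zx (Ordinal id)) -entriesE.
  by rewrite zx// entriesE.
Qed.

Lemma reduced_matrixE : reduced_matrix (surface_form phi d) d = full_mx - crossing_mx.
Proof.
apply: xget_unique; first exact: is_reduced_full.
move=> D [[sD _] hD]; have [[sF _] hF] := is_reduced_full.
by apply: symmetric_form_inj => // x; rewrite hD hF.
Qed.

End StiffnessMatrix.

(** * Directional derivatives and the Hessian of the interaction *)

Lemma is_derive_line (R : realType) (V : normedModType R) (F : V -> R) (y w : V) (D : R) :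
  is_derive (0 : R) 1 (fun h : R => F (h *: w + y)) D -> is_derive y w F D.
Proof.
move=> [G0 GD]; pose G h := F (h *: w + y).
have e : (fun h : R => h^-1 *: (F (h *: w + y) - F y)) =
    (fun h => h^-1 *: (G (h *: 1 + 0) - G 0)).
  apply/funext => h; rewrite /G scale0r add0r addr0.
  by rewrite (_ : h *: 1 = h) //; exact: mulr1.
apply: DeriveDef; first by rewrite /derivable e.
by rewrite -GD /derive e.
Qed.

Lemma is_derive_sum_fun (R : realType) (V : normedModType R) n (F : 'I_n -> V -> R)
    (D : 'I_n -> R) (y w : V) : (forall i, is_derive y w (F i) (D i)) ->
  is_derive y w (fun y => \sum_(i < n) F i y) (\sum_(i < n) D i).
Proof.
move=> FD; rewrite (_ : (fun _ => _) = \sum_(i < n) F i); first exact: is_derive_sum.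
by apply/funext => z; rewrite fct_sumE.
Qed.

(** The bonds across the cut, given by a left end i and a right end [d + t], are sorted by the
    difference [c = d - i + t] of their end indices. *)
Lemma sum_triangle (R : zmodType) d (F : nat -> nat -> R) :
  \sum_(i < d) \sum_(t < i.+1) F t (d - i)%N = \sum_(c < d.+1) \sum_(k < c) F k (c - k)%N.
Proof.
elim: d => [|d IH]; first by rewrite big_ord0 big_ord1 big_ord0.
rewrite [RHS]big_ord_recr /= -IH big_ord_recl [X in X + _]big_ord1 subn0.
rewrite [X in _ = _ + X]big_ord_recl subn0 addrCA; congr (_ + _).
rewrite -big_split /=; apply: eq_bigr => i _.
by rewrite /bump /= add1n subSS big_ord_recr.
Qed.

Section Hessian.
Variables (R : realType) (v : R -> \bar R) (rhc zmin zmax alpha1 alpha2 s : R).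
Hypothesis hV : assumptionV v rhc zmin zmax alpha1 alpha2 s.
Variables (d : nat) (a : R).
Hypothesis ra : rhc < a.
Local Notation f := (vreal v).
Local Notation f1 := ((vreal v)^`()%classic).
Local Notation f2 := (d2 v).
Implicit Types (y : 'rV[R]_d) (k n c : nat).

Let rhc_ge0 : 0 <= rhc. Proof. exact: V_hc_ge0 hV. Qed.
Let a_gt0 : 0 < a. Proof. exact: le_lt_trans ra. Qed.

Definition prefix y k : R := \sum_(l < d | (l <= k)%N) y 0 l.

Definition crossing_energy y : R :=
  \sum_(c < d.+1) \sum_(k < c) f ((c - k)%:R * a + prefix y k).

Definition admissible : set 'rV[R]_d := [set y | forall l, rhc < y 0 l].

Lemma admissible_gt y n k : admissible y -> (0 < n)%N -> rhc < n%:R * a + prefix y k.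
Proof.
move=> hy n0; apply: (lt_le_trans ra); rewrite -[leLHS]addr0; apply: lerD.
  by rewrite ler_peMl ?(ltW a_gt0)// ler1n.
by apply: sumr_ge0 => l _; apply: le_trans (ltW (hy l)).
Qed.

Lemma near_admissible : \forall y \near (const_mx a : 'rV[R]_d), admissible y.
Proof.
have h l : nbhs (const_mx a : 'rV[R]_d) [set y : 'rV[R]_d | rhc < y 0 l].
  have : (fun y : 'rV[R]_d => y 0 l) @ (const_mx a : 'rV[R]_d) --> a.
    by have := @coord_continuous R 1 d 0 l (const_mx a); rewrite /continuous_at mxE.
  by move=> /cvgr_gt; apply.
exact: (@filter_forall _ _ _ _ (nbhs_filter (const_mx a : 'rV[R]_d)) h).
Qed.

Lemma prefix_const k : (k < d)%N -> prefix (const_mx a) k = k.+1%:R * a.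
Proof.
move=> kd; rewrite /prefix (eq_bigr (fun=> a)); last by move=> l _; rewrite mxE.
rewrite -(big_ord_widen d (fun=> a) kd) sumr_const card_ord mulr_natl //.
Qed.

Lemma window_row_mx y (i t : 'I_d) :
  \sum_(k < d + d | (i <= k <= d + t)%N) row_mx (const_mx a) y 0 k =
  (d - i)%:R * a + prefix y t.
Proof.
rewrite big_mkcond big_split_ord /= -!big_mkcond /=; congr (_ + _).
  rewrite (eq_bigr (fun=> a)); last by move=> k _; rewrite row_mxEl mxE.
  rewrite (eq_bigl (fun k : 'I_d => true && (i <= k)%N)); last first.
    by move=> k; have := ltn_ord k; clear; lia.
  by rewrite -(big_geq_mkord _ _ predT (fun=> a)) sumr_const_nat mulr_natl.
rewrite /prefix; apply: eq_big => [l|l _]; last by rewrite row_mxEr.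
by have := ltn_ord i; clear; lia.
Qed.

Lemma fine_interaction y : admissible y ->
  fine (interaction v (const_mx a) y) = crossing_energy y.
Proof.
move=> hy; pose F t n := f (n%:R * a + prefix y t).
have vF (i t : 'I_d) : v (\sum_(k < d + d | (i <= k <= d + t)%N) row_mx (const_mx a) y 0 k)%R
    = (F t (d - i)%N)%:E.
  by rewrite window_row_mx (v_fin hV)// admissible_gt// subn_gt0.
rewrite /interaction big_mkcond big_split_ord /= [X in (_ + X)%E]big1 ?adde0 => [|i _]; last first.
  by rewrite ltnNge leq_addr.
rewrite [X in fine X](_ : _ = (\sum_(i < d) \sum_(t < i.+1) F t (d - i)%N)%:E); last first.
  rewrite -sumEFin; apply: eq_bigr => i _; rewrite ltn_ord.
  rewrite big_mkcond big_split_ord /= [X in (X + _)%E]big1 ?add0e => [|j _]; last first.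
    by rewrite leqNgt ltn_ord.
  rewrite -big_mkcond /= (eq_bigr (fun t : 'I_d => (F t (d - i)%N)%:E)) => [|t _]; last exact: vF.
  rewrite sumEFin (big_ord_widen d (fun t => F t (d - i)%N) (ltn_ord i)); congr EFin.
  by apply: eq_bigl => t; have := ltn_ord i; clear; lia.
exact: sum_triangle.
Qed.

Lemma is_derive_prefix (g : R -> R) (g' b : R) k (j : 'I_d) y :
  is_derive (b + prefix y k) 1 g g' ->
  is_derive y (delta_mx 0 j) (fun y => g (b + prefix y k))
    (if (j <= k)%N then g' else 0).
Proof.
move=> dg; apply: is_derive_line; pose e : R := (j <= k)%N%:R.
have lin h : b + prefix (h *: delta_mx 0 j + y) k = (b + prefix y k) + e * h.
  rewrite -addrA; congr (_ + _); rewrite addrC /prefix.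
  under eq_bigr do rewrite !mxE eqxx /=.
  rewrite big_split /=; congr (_ + _); rewrite /e.
  have [jk|jk] := boolP (j <= k)%N.
    rewrite (bigD1 j)//= eqxx big1 ?addr0 => [|l /andP[_ /negbTE ->]]; last exact: mulr0.
    by rewrite mulrC.
  rewrite big1 ?mul0r// => l lk; case: eqP => [lj|]; last by rewrite mulr0.
  by rewrite -lj lk in jk.
have dl : is_derive (0 : R) 1 (fun h => b + prefix y k + e * h) e.
  by apply: is_derive_eq; rewrite -![_ *: _]/(_ * _) /= add0r mul1r mulr1.
have dg' : is_derive (b + prefix y k + e * 0) 1 g g' by rewrite mulr0 addr0.
have := @is_derive1_comp R g (fun h => b + prefix y k + e * h) 0 g' e dg' dl.
rewrite (_ : _ \o _ = fun h => g (b + prefix (h *: delta_mx 0 j + y) k)); last first.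
  by apply/funext => h /=; rewrite lin.
by rewrite /e; case: ifP => _; rewrite ?mulr1 ?mulr0.
Qed.

Definition crossing_gradient (j : 'I_d) y : R :=
  \sum_(c < d.+1) \sum_(k < c)
    (if (j <= k)%N then f1 ((c - k)%:R * a + prefix y k) else 0).

Lemma crossing_energy_derive (j : 'I_d) y : admissible y ->
  is_derive y (delta_mx 0 j) crossing_energy (crossing_gradient j y).
Proof.
move=> hy; apply: is_derive_sum_fun => c; apply: is_derive_sum_fun => k.
apply: is_derive_prefix; apply: (f_derive hV).
by rewrite admissible_gt// subn_gt0.
Qed.

Lemma crossing_gradient_derive (i j : 'I_d) y : admissible y ->
  is_derive y (delta_mx 0 i) (crossing_gradient j)
    (\sum_(c < d.+1) \sum_(k < c)
      (if (i <= k)%N && (j <= k)%N then f2 ((c - k)%:R * a + prefix y k) else 0)).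
Proof.
move=> hy; apply: is_derive_sum_fun => c; apply: is_derive_sum_fun => k.
case: (j <= k)%N; rewrite ?andbT ?andbF; last exact: is_derive_cst.
apply: is_derive_prefix; apply: (f1_derive hV).
by rewrite admissible_gt// subn_gt0.
Qed.

Lemma hessian_interaction :
  hessian (fun y => fine (interaction v (const_mx a) y)) (const_mx a) =
  crossing_mx (fun c => f2 (a * c%:R)) d.
Proof.
apply/matrixP => i j; rewrite !mxE.
(* The inner derivative is differentiated again, so it must be known on a neighbourhood: hence the
   passage to interior points of [admissible]. *)
rewrite (@near_eq_derive _ _ _ _ (crossing_gradient j)); last first.
  apply: filterS (nbhs_interior near_admissible) => y hy.
  have [_ <-] := crossing_energy_derive j (nbhs_singleton hy).
  by apply: near_eq_derive; apply: filterS hy => z; exact: fine_interaction.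
have [_ ->] := crossing_gradient_derive i j (nbhs_singleton near_admissible).
rewrite big_add1 big_mkord; apply: eq_bigr => c _; rewrite mulr_sumr; apply: eq_bigr => k _.
case: ifP => _; last by rewrite mulr0.
rewrite mulr1; have kc : (k < c)%N := ltn_ord k.
rewrite prefix_const; last by apply: leq_trans kc _; rewrite -ltnS.
rewrite -mulrDl -natrD mulrC; congr (f2 (_ * _%:R)).
by rewrite addnS subnK// ltnW.
Qed.

End Hessian.

(** * Identification of the ground state and conclusion *)

Section GroundState.
Variables (R : realType) (v : R -> \bar R) (rhc zmin zmax alpha1 alpha2 s : R).
Hypothesis hV : assumptionV v rhc zmin zmax alpha1 alpha2 s.
Variables (d : nat) (p a : R).
Hypothesis p_gt0 : 0 < p.
Hypothesis zmin_a : zmin < a.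
Hypothesis a_zmax : a < zmax.
Local Notation per := (energy_per (vreal v) d p).
Hypothesis per_a_lt0 : per a < 0.
Hypothesis per_a_min : forall y, zmin <= y <= zmax ->
  per a + convexity v zmin zmax d / 2 * (y - a) ^+ 2 <= per y.

Let ra : rhc < a. Proof. exact: lt_trans (V_zmin_gt hV) zmin_a. Qed.

Lemma energy_per_spacingE r : rhc < r -> energy_per_spacing v d.+1 p r = (per r)%:E.
Proof.
move=> hr; rewrite /energy_per_spacing /energy_per EFinD -sumEFin; congr (_ + _)%E.
by apply: eq_big_nat => c /andP[c1 _]; rewrite (v_fin hV)//; exact: (ge_mul_nat hV).
Qed.

Lemma energy_per_spacing_core r : 0 < r -> r <= rhc -> energy_per_spacing v d.+1 p r = +oo%E.
Proof.
move=> r0 rr; rewrite /energy_per_spacing big_ltn//= mul1r (V_hard_core hV r0 rr).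
rewrite addye ?addey//; rewrite -ltNye.
apply: lt_le_trans (_ : (\sum_(2 <= k < d.+2) - (alpha1 * (k%:R * r) `^ (- s)))%:E <= _)%E.
  exact: ltNyr.
rewrite -sumEFin [leLHS]big_nat_cond [leRHS]big_nat_cond; apply: lee_sum => c /andP[/andP[c2 _] _]; apply: (V_lower hV).
by rewrite mulr_gt0// ltr0n; exact: leq_trans c2.
Qed.

(** Competitors are excluded by range: infinite energy in the core, positive energy up to [zmin],
    strict convexity up to [zmax], and beyond it comparison with [zmax]. *)
Lemma equilibrium_spacingE : equilibrium_spacing v d.+1 p = a.
Proof.
have lt r : 0 < r -> r != a ->
    (energy_per_spacing v d.+1 p a < energy_per_spacing v d.+1 p r)%E.
  move=> r0 ne; rewrite (energy_per_spacingE ra).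
  have [rr|rr] := leP r rhc; first by rewrite energy_per_spacing_core// ltry.
  rewrite energy_per_spacingE// lte_fin.
  have [rz|rz] := leP r zmin.
    exact: lt_trans per_a_lt0 (per_small hV d p_gt0 rr rz).
  have conv y : zmin <= y <= zmax -> y != a -> per a < per y.
    move=> yI ya; apply: lt_le_trans (per_a_min yI); rewrite ltrDl.
    rewrite mulr_gt0 ?divr_gt0 ?(convexity_gt0 hV)//.
    by rewrite exprn_even_gt0//= subr_eq0.
  have [rzm|rzm] := leP r zmax; first by apply: conv => //; rewrite (ltW rz).
  have zI : zmin <= zmax <= zmax by rewrite lexx ltW// (V_zmin_zmax hV).
  apply: lt_le_trans (conv _ zI _) _; first by rewrite gt_eqF.
  apply: le_trans (per_large hV d p (ltW rzm)).
  by rewrite lerDl mulr_ge0 ?(ltW p_gt0)// subr_ge0 ltW.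
have a0 : 0 < a by exact: le_lt_trans (V_hc_ge0 hV) ra.
apply: xget_unique; first by split.
move=> b [b0 hb]; apply/eqP/negP => /negP ne.
have := lt_trans (lt b b0 ne) (hb a a0 _).
by rewrite ltxx eq_sym => /(_ ne).
Qed.

Lemma ground_energyE : ground_energy v d.+1 p = per a.
Proof. by rewrite /ground_energy equilibrium_spacingE energy_per_spacingE. Qed.

Lemma det_stiffness_matrix : \det (stiffness_matrix v d.+1 a) = limit_gain v d a ^+ d.
Proof.
rewrite /stiffness_matrix /= (hessian_interaction hV d ra).
have -> : (fun c => d2 v (a * c%:R)) = stiff v a by apply/funext => c; rewrite /stiff mulrC.
have -> : surface_hessian v d.+1 a = surface_form (stiff v a) d.
  apply/funext => i; apply/funext => j; rewrite /surface_hessian /surface_form.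
  by apply: eq_bigr => c _; apply: eq_bigr => k _; rewrite /stiff mulrC.
have mu0 := mu_gt0 hV d zmin_a a_zmax.
rewrite (@reduced_matrixE _ (stiff v a) d (per2 v d a) mu0 erefl).
  by rewrite subrK det_full_mx.
by move=> c cm; apply: (stiff_le0 hV zmin_a cm).
Qed.

End GroundState.

Theorem theorem2p8 (R : realType) (v : R -> \bar R)
    (rhc zmin zmax alpha1 alpha2 s : R) (m : nat) (p : R)
    (hV : assumptionV v rhc zmin zmax alpha1 alpha2 s)
    (hm : (2 <= m)%N) (hp0 : 0 < p) (hp : p < pstar v zmax)
    (hrhc : 0 < rhc) :
  let d := m.-1 in
  let C := stiffness_matrix v m (equilibrium_spacing v m p) in
  (gibbs_free_energy v m p : R -> R^o) =
    (fun beta : R => ground_energy v m p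
      - beta^-1 * ln (Num.sqrt (2 * pi / (beta * (\det C) `^ (d%:R^-1)))))
    +o_+oo (fun beta : R => beta^-1 : R^o).
Proof.
case: m hm => [|d]// d_gt0 /=.
have [a [/andP[zmin_a a_zmax] per1_a per_a_lt0 per_a_min]] := per_minimizer hV d hp0 hp.
rewrite (ground_energyE hV hp0 zmin_a a_zmax per_a_lt0 per_a_min).
rewrite (equilibrium_spacingE hV hp0 zmin_a a_zmax per_a_lt0 per_a_min).
rewrite (det_stiffness_matrix hV d zmin_a a_zmax).
have coo0 := limit_gain_gt0 hV d zmin_a a_zmax.
have -> : (limit_gain v d a ^+ d) `^ (d%:R^-1) = limit_gain v d a.
  by rewrite -powR_mulrn ?(ltW coo0)// -powRrM mulfV ?pnatr_eq0 -?lt0n// powRr1// ltW.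
apply/eqaddoP => _/posnumP[eta].
have [b0 b0_gt0 hb0] :=
  gibbs_asymptotics hV d_gt0 hp0 zmin_a a_zmax per1_a per_a_lt0 per_a_min [gt0 of eta%:num].
near=> beta; have hb : b0 <= beta by near: beta; apply: nbhs_pinfty_ge; exact: num_real.
by rewrite [`|beta^-1|]ger0_norm ?invr_ge0 ?(le_trans (ltW b0_gt0))//; exact: hb0.
Unshelve. all: by end_near. Qed.
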